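(* Let $X_1,X_2,\ldots$ be iid complex-valued random variables which are absolutely continuous (with respect to Lebesgue measure on $\mathbb{C}$) and have a bounded density. In addition, assume $\mathbb{E}|X_1|<\infty$. Let $\varphi:\mathbb{C}\to\mathbb{R}$ be a twice continuously differentiable function with compact support which does not depend on $n$. Then $$\frac{1}{\sqrt n}\left(\sum_{j=1}^{n-1}\varphi(w_j^{(n)})-\mathbb{E}\left[\sum_{j=1}^{n-1}\varphi(w_j^{(n)})\right]\right)\longrightarrow N(0,v^2)$$ in distribution as $n\to\infty$, where $w_1^{(n)},\ldots,w_{n-1}^{(n)}$ are the critical points (with multiplicity) of the polynomial $p_n(z):=\prod_{i=1}^n(z-X_i)$ and $v^2$ is the variance of $\varphi(X_1)$.
   Context: $N(0,v^2)$ is the real normal distribution with mean $0$ and variance $v^2$ (a point mass at $0$ if $v=0$). *)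

(* Defs.v *)
From HB Require Import structures.
From mathcomp Require Import all_boot all_order all_algebra.
From mathcomp Require Import complex finmap.
From mathcomp Require Import all_classical all_reals all_analysis.

Set Implicit Arguments.
Unset Strict Implicit.
Unset Printing Implicit Defensive.

Import Order.TTheory GRing.Theory Num.Theory.
Import numFieldNormedType.Exports.

Local Open Scope classical_set_scope.
Local Open Scope ring_scope.

(* R[i] carries neither a topology nor a measurable structure in the library:
   its Borel sigma-algebra, its Lebesgue measure and real differentiability on
   it are transported from R * R along the chart (x, y) |-> x + iy. *)
Definition cplx (R : Type) (u : R * R) : R[i] := Complex u.1 u.2.

Section complex_borel.
Context (R : realType).

Definition complex_measurable (A : set R[i]) : Prop :=
  measurable (@cplx R @^-1` A).

Let complex_measurable0 : complex_measurable set0.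
Proof. by rewrite /complex_measurable preimage_set0. Qed.

Let complex_measurableC (A : set R[i]) :
  complex_measurable A -> complex_measurable (~` A).
Proof. by rewrite /complex_measurable preimage_setC; exact: measurableC. Qed.

Let complex_measurable_bigcup (F : (set R[i])^nat) :
  (forall i, complex_measurable (F i)) -> complex_measurable (\bigcup_i F i).
Proof.
by rewrite /complex_measurable preimage_bigcup => mF; exact: bigcup_measurable.
Qed.

HB.instance Definition _ := isPointed.Build R[i] 0.
HB.instance Definition _ := isMeasurable.Build default_measure_display R[i]
  complex_measurable0 complex_measurableC complex_measurable_bigcup.

Lemma measurable_cplx : measurable_fun [set: R * R] (@cplx R).
Proof. by move=> _ A mA; rewrite setTI. Qed.

Definition complex_lebesgue : set R[i] -> \bar R :=
  pushforward (lebesgue_measure \x lebesgue_measure)%E (@cplx R).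

Let complex_lebesgue0 : complex_lebesgue set0 = 0%E.
Proof. by rewrite /complex_lebesgue /pushforward preimage_set0 measure0. Qed.

Let complex_lebesgue_ge0 (A : set R[i]) : (0 <= complex_lebesgue A)%E.
Proof. by rewrite /complex_lebesgue /pushforward measure_ge0. Qed.

Let complex_lebesgue_sigma_additive : semi_sigma_additive complex_lebesgue.
Proof.
move=> F mF tF mUF; rewrite /complex_lebesgue /pushforward preimage_bigcup.
apply: measure_semi_sigma_additive => //.
apply/trivIsetP => i j _ _ ij; rewrite -preimage_setI.
by move/trivIsetP : tF => /(_ _ _ I I ij) ->; rewrite preimage_set0.
Qed.

HB.instance Definition _ := isMeasure.Build _ _ _ complex_lebesgue
  complex_lebesgue0 complex_lebesgue_ge0 complex_lebesgue_sigma_additive.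

End complex_borel.

Section random_variables.
Context (d d' : measure_display) (T : measurableType d) (T' : measurableType d').
Context (R : realType) (P : probability T R).

Definition mutually_independent (X : nat -> {RV P >-> T'}) : Prop :=
  forall (J : {fset nat}) (A : nat -> set T'),
    (forall i, i \in J -> measurable (A i)) ->
    P (\bigcap_(i in [set` J]) (X i @^-1` A i)) =
    (\prod_(i <- J) P (X i @^-1` A i))%E.

Definition identically_distributed (X : nat -> {RV P >-> T'}) : Prop :=
  forall (i j : nat) (A : set T'), measurable A ->
    distribution P (X i) A = distribution P (X j) A.

Definition has_density (mu : set T' -> \bar R) (X : {RV P >-> T'})
    (f : T' -> R) : Prop :=
  [/\ measurable_fun [set: T'] f, (forall x, 0 <= f x) &
      forall A, measurable A ->
        distribution P X A = (\int[mu]_(x in A) (f x)%:E)%E].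

(* Convergence of the distribution functions at every continuity point of the
   limiting one; that the Y n are random variables is part of the claim. *)
Definition cvg_in_distribution (Y : nat -> T -> R)
    (nu : probability (measurableTypeR R) R) : Prop :=
  (forall n, measurable_fun [set: T] (Y n)) /\
  (forall x : R, {for x, continuous (fun y : R => nu `]-oo, y]%classic)} ->
    P [set w | Y n w <= x] @[n --> \oo] --> nu `]-oo, x]%classic).

End random_variables.

(* The library's [normal_prob 0 0] is the uniform law on [0, 1]. *)
Definition normal_law (R : realType) (v : R) :
    probability (measurableTypeR R) R :=
  if v == 0 then \d_(0 : measurableTypeR R) : probability _ R
  else normal_prob 0 v : probability _ R.

(* f is (Frechet) differentiable with continuous derivative; since R * R has
   finite dimension, continuity of x |-> 'd f x amounts to continuity of
   x |-> 'd f x v for every v. *)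
Definition cont_diff (R : realType) (f : R * R -> R) : Prop :=
  (forall x, differentiable f x) /\ (forall v, continuous ('D_v f)).

Definition twice_cont_diff (R : realType) (f : R * R -> R) : Prop :=
  cont_diff f /\ (forall v, cont_diff ('D_v f)).

Definition compactly_supported (R : realType) (f : R * R -> R) : Prop :=
  compact (closure [set x | f x != 0]).

(* The roots of p listed with multiplicity, in an unspecified order. *)
Definition roots_of (F : closedFieldType) (p : {poly F}) : seq F :=
  sval (closed_field_poly_normal p).

Section critical_points.
Context (R : realType) (x : nat -> R[i]) (n : nat).

Definition root_poly : {poly R[i]} := \prod_(i < n) ('X - (x i)%:P).

Definition critical_points : seq R[i] := roots_of root_poly^`().

End critical_points.

(* Main.v *)
(** Let [q = p_n' / (n p_n)]. For a constant [C > 0], [C^-1 ln |z - a|^2] is a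
    fundamental solution of the Laplacian, so integrating [Laplacian phi]
    against [ln |q|^2] gives [C] times the discrepancy between the sums of [phi]
    over the critical points and over the zeros. Since [q z] is the mean of the
    [1 / (z - X_i)], the expectation of [|ln |q z||] is [O(ln n)], locally
    uniformly in [z]. The upper bound on [ln |q z|] only needs the expectation of
    [1 / |z - X_1|], finite because the density is bounded. The lower bound is
    controlled by [1 / |z - X_n + W^-1|], where [W] is the sum of
    [1 / (z - X_i)] over [i < n]: as [W] is independent of [X_n], conditioning
    on it leaves a bounded density again. Hence the discrepancy is [O(ln n)]
    in [L^1], negligible at scale [sqrt n], and what remains is the central limit
    theorem for the bounded iid variables [phi (X_i)]: Lindeberg's replacement
    compares expectations of functions with a uniform second order Taylor
    expansion, and a spline of this kind approximates the indicator functions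
    of half-lines. *)

Require Import Defs.
From HB Require Import structures.
From mathcomp Require Import all_boot all_order all_algebra.
From mathcomp Require Import complex finmap.
From mathcomp Require Import all_classical all_reals all_analysis.
From mathcomp Require Import measurable_realfun ring lra.

Set Implicit Arguments.
Unset Strict Implicit.
Unset Printing Implicit Defensive.

Import Order.TTheory GRing.Theory Num.Theory.
Import numFieldNormedType.Exports.

Local Open Scope classical_set_scope.
Local Open Scope ring_scope.

(** * Calculus on the plane *)

(** The critical points are not explicit functions of the [X i]. The logarithmic potential gets
    around this because it sees them only through values of the derivative of the polynomial, which
    are polynomial in [z] and in the [X i]. This yields the bound on the discrepancy and also the
    measurability of the linear statistic. The singularity of the logarithm is handled by
    regularization: [ln (|z - a|^2 + e^2)] is smooth, so one-dimensional integrations by parts along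
    the axes suffice, and its Laplacian is a fixed integrable kernel rescaled to width [e], an
    approximate identity up to its total mass. That mass enters only as a positive factor common to
    zeros and critical points. Centring costs nothing: subtracting the expectation of the
    discrepancy at most doubles its [L^1] norm, so a first-moment bound is enough. Since
    [ln m <= 4 m^(1/4)], the comparison with the iid sum holds with rate [m^(-1/4)], which dominates
    the Lindeberg error [m^(-1/2)]. *)

Section measurability.
Context {R : realType}.

Lemma measurable_inv : measurable_fun [set: R] (@GRing.inv R).
Proof.
(* Real powers want a nonnegative base, hence the square; at 0 the leading factor makes both sides
   0. *)
have -> : @GRing.inv R = fun x => x * (x ^+ 2) `^ (-1).
  apply/funext => x; rewrite (powR_inv1 (sqr_ge0 x)).
  have [->|x0] := eqVneq x 0; first by rewrite invr0 mul0r.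
  by rewrite expr2 invfM mulrA divff// mul1r.
apply: measurable_funM => //.
by apply: (measurableT_comp (measurable_powR (-1))) => //; exact: exprn_measurable.
Qed.

Lemma measurable_funV d (T : measurableType d) (f : T -> R) :
  measurable_fun [set: T] f -> measurable_fun [set: T] (fun x => (f x)^-1).
Proof. by move=> mf; exact: (measurableT_comp measurable_inv). Qed.

(** The product sigma-algebra is generated by rectangles, so [A] is written as a countable union:
    the boxes with rational end points contained in it, enumerated by [unpickle]. *)
Lemma open_measurable_prod (A : set (R * R)) : open A -> measurable A.
Proof.
move=> oA.
pose box (q : rat * rat * (rat * rat)) : set (R * R) :=
  `]ratr q.1.1, ratr q.1.2[%classic `*` `]ratr q.2.1, ratr q.2.2[%classic.
pose F (n : nat) : set (R * R) := if choice.unpickle n is Some q then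
  (if `[< (box q `<=` A)%classic >] then box q else set0) else set0.
have -> : A = (\bigcup_n F n)%classic.
  apply/seteqP; split => [[x y] Axy|z [n _]]; last first.
    rewrite /F; case: (choice.unpickle n : option (rat * rat * (rat * rat))) => // q.
    by case: asboolP => // qA; exact: qA.
  have /nbhs_ballP[e /= e0 eA] : nbhs (x, y) A by apply: open_nbhs_nbhs.
  have [a] := @rat_in_itvoo R (x - e) x ltac:(lra); rewrite in_itv/= => /andP[a1 a2].
  have [b] := @rat_in_itvoo R x (x + e) ltac:(lra); rewrite in_itv/= => /andP[b1 b2].
  have [a'] := @rat_in_itvoo R (y - e) y ltac:(lra); rewrite in_itv/= => /andP[a1' a2'].
  have [b'] := @rat_in_itvoo R y (y + e) ltac:(lra); rewrite in_itv/= => /andP[b1' b2'].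
  exists (choice.pickle ((a, b), (a', b'))); first exact: I.
  rewrite /F choice.pickleK.
  case: asboolP => [_|/=[]].
    by split; rewrite /= in_itv/=; apply/andP; split.
  move=> [u v] [/=]; rewrite !in_itv/= => /andP[u1 u2] /andP[v1 v2].
  by apply: eA; split; rewrite /ball/= ltr_norml; apply/andP; split; lra.
apply: bigcupT_measurable => n; rewrite /F; case: (choice.unpickle n : option (rat * rat * (rat * rat))) => // q.
by case: asboolP => // _; apply: measurableX; exact: measurable_itv.
Qed.

Lemma continuous_measurable_prod (f : R * R -> R) :
  continuous f -> measurable_fun [set: R * R] f.
Proof.
move=> /continuousP cf; apply: (measurability _ (RGenOpens.measurableE R)).
move=> _ [_ [a [b ->] <-]]; rewrite setTI; apply: open_measurable_prod.
exact/cf/interval_open.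
Qed.

End measurability.

Section integration_by_parts_twice.
Context {R : realType}.
Notation mu := (@lebesgue_measure R).

Lemma is_derive_continuous (f : R -> R) (df : R -> R) :
  (forall x : R, is_derive x 1 f (df x)) -> continuous f.
Proof.
move=> h x; apply/differentiable_continuous/derivable1_diffP.
exact: (@ex_derive _ _ _ _ _ _ _ (h x)).
Qed.

Lemma integral_itv_cutoff (h : R -> R) (B : R) : 
  (forall x, B <= `|x| -> h x = 0) ->
  (\int[mu]_x (h x)%:E = \int[mu]_(x in `[(- B)%R, B]) (h x)%:E)%E.
Proof.
move=> h0; rewrite [RHS]integral_mkcond; apply: eq_integral => x _.
rewrite patchE; case: ifPn => //; rewrite notin_setE/= in_itv/= => /negP.
by rewrite -ler_norml -ltNge => /ltW /h0 ->.
Qed.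

Lemma integral_by_parts_twice (f f1 f2 g g1 g2 : R -> R) (B : R) : 0 < B ->
  (forall x : R, is_derive x 1 f (f1 x)) -> (forall x : R, is_derive x 1 f1 (f2 x)) ->
  (forall x : R, is_derive x 1 g (g1 x)) -> (forall x : R, is_derive x 1 g1 (g2 x)) ->
  continuous f2 -> continuous g2 ->
  (forall x, B <= `|x| -> [/\ f x = 0, f1 x = 0 & f2 x = 0]) ->
  (\int[mu]_x (f2 x * g x)%:E = \int[mu]_x (f x * g2 x)%:E)%E.
Proof.
move=> B0 df df1 dg dg1 cf2 cg2 f0.
have cf := is_derive_continuous df; have cg := is_derive_continuous dg.
rewrite (@integral_itv_cutoff _ B); last by move=> x /f0[_ _ ->]; rewrite mul0r.
rewrite (@integral_itv_cutoff _ B); last by move=> x /f0[-> _ _]; rewrite mul0r.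
have cfg2 : continuous (fun x => f x * g2 x).
  by move=> x; apply: cvgM; [exact: cf|exact: cg2].
have cf2g : continuous (fun x => f2 x * g x).
  by move=> x; apply: cvgM; [exact: cf2|exact: cg].
have ci (h : R -> R) : continuous h -> mu.-integrable `[- B, B] (EFin \o h).
  move=> ch; apply: continuous_compact_integrable; first exact: segment_compact.
  exact: continuous_subspaceT.
(* The one-dimensional Green identity: [F] is a primitive of [f2 g - f g2] and vanishes at both end
   points, where [f] and [f1] do. *)
pose F x := f1 x * g x - f x * g1 x.
have dF (x : R) : is_derive x 1 F (f2 x * g x - f x * g2 x).
  have dfg := is_deriveM (df1 x) (dg x).
  have dfg' := is_deriveM (df x) (dg1 x).
  apply: (is_derive_eq (is_deriveB dfg dfg')).
  rewrite /GRing.scale/=; ring.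
have H : (\int[mu]_(x in `[(- B)%R, B]) (f2 x * g x - f x * g2 x)%:E = 0)%E.
  rewrite (@continuous_FTC2 _ _ F); last 4 first.
  - by lra.
  - by apply: continuous_subspaceT => x; apply: cvgB; [exact: cf2g|exact: cfg2].
  - have cF := is_derive_continuous dF; split.
    + by move=> x _; exact: (@ex_derive _ _ _ _ _ _ _ (dF x)).
    + by apply: cvg_at_right_filter; exact: cF.
    + by apply: cvg_at_left_filter; exact: cF.
  - by move=> x _; rewrite derive1E; exact: (@derive_val _ _ _ _ _ _ _ (dF x)).
  have [fB f1B _] : [/\ f B = 0, f1 B = 0 & f2 B = 0].
    by apply: f0; rewrite ger0_norm// ltW.
  have [fNB f1NB _] : [/\ f (- B) = 0, f1 (- B) = 0 & f2 (- B) = 0].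
    by apply: f0; rewrite normrN ger0_norm// ltW.
  by rewrite /F fB f1B fNB f1NB !mul0r !subr0 -EFinB subrr.
move: H; under eq_integral do rewrite EFinB.
rewrite (integralB _ (ci _ cf2g) (ci _ cfg2))//.
have fin1 := integrable_fin_num _ (ci _ cf2g).
have fin2 := integrable_fin_num _ (ci _ cfg2).
move: fin1 fin2 => /=.
case: (integral _ _ _) => // r _; case: (integral _ _ _) => // r' _.
by rewrite -EFinB => -[] /eqP; rewrite subr_eq0 => /eqP ->.
Qed.

End integration_by_parts_twice.

Section plane_integrals.
Context {R : realType}.
Notation mu := (@lebesgue_measure R).
Notation mu2 := (mu \x mu)%E.
Implicit Types (a z : R * R) (f g h : R * R -> R) (B : R).

Definition sqnorm z : R := z.1 ^+ 2 + z.2 ^+ 2.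

Lemma prod_norm_ge1 z B : B <= `|z.1| -> B <= `|z|.
Proof. by rewrite prod_normE/= le_max => ->. Qed.

Lemma prod_norm_ge2 z B : B <= `|z.2| -> B <= `|z|.
Proof. by rewrite prod_normE/= le_max => ->; rewrite orbT. Qed.

Definition square B : set (R * R) := `[- B, B]%classic `*` `[- B, B]%classic.

Lemma notin_square B z : ~ square B z -> B <= `|z|.
Proof.
move=> sz; rewrite leNgt; apply/negP; rewrite prod_normE/= gt_max => /andP[z1 z2].
by apply: sz; split => /=; rewrite in_itv/= -ler_norml ltW.
Qed.

Lemma measurable_square B : measurable (square B).
Proof. by apply: measurableX; exact: measurable_itv. Qed.

Lemma square_finite B : (mu2 (square B) < +oo)%E.
Proof.
rewrite product_measure1E; [|exact: measurable_itv..].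
rewrite /= lebesgue_measure_itv.
by case: ifPn => _; rewrite ?mule0 ?ltry.
Qed.

Lemma integrable_bounded_support h B M : measurable_fun [set: R * R] h ->
  (forall z, `|h z| <= M) -> (forall z, B <= `|z| -> h z = 0) ->
  mu2.-integrable [set: R * R] (EFin \o h).
Proof.
move=> mh hM h0.
have -> : EFin \o h = (EFin \o h) \_ (square B).
  apply/funext => z; rewrite patchE; case: ifPn => //; rewrite notin_setE.
  by move=> /notin_square/h0/= ->.
rewrite -integrable_mkcond; last exact: measurable_square.
apply: measurable_bounded_integrable.
- exact: measurable_square.
- exact: square_finite.
- exact: measurable_funTS.
- exists M; split; first exact: num_real.
  by move=> y My z _; exact: le_trans (hM z) (ltW My).
Qed.

Lemma continuous_support_bounded h B : continuous h ->
  (forall z, B <= `|z| -> h z = 0) -> exists M, forall z, `|h z| <= M.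
Proof.
move=> ch h0.
have cB : compact (square B) by apply: compact_setX; exact: segment_compact.
have /compact_bounded[M [_ hM]] : compact (h @` square B).
  by apply: continuous_compact => //; exact: continuous_subspaceT.
exists (`|M| + 1) => z; have [sz|/notin_square/h0 ->] := pselect (square B z).
  by apply: hM; [rewrite ltr_pwDr// ler_norm|exists z].
by rewrite normr0 addr_ge0.
Qed.

Lemma integrable_continuous_support h B : continuous h ->
  (forall z, B <= `|z| -> h z = 0) -> mu2.-integrable [set: R * R] (EFin \o h).
Proof.
move=> ch h0; have [M hM] := continuous_support_bounded ch h0.
by apply: integrable_bounded_support h0; [exact: continuous_measurable_prod|].
Qed.

End plane_integrals.

Section regularized_logarithm.
Context {R : realType}.
Notation mu := (@lebesgue_measure R).
Notation mu2 := (mu \x mu)%E.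
Variables (a c : R).
Hypothesis c0 : 0 < c.
Let q (x : R) := (x - a) ^+ 2 + c.
Let q_gt0 x : 0 < q x. Proof. by rewrite ltr_wpDl// sqr_ge0. Qed.

Let dq (x : R) : is_derive x 1 q (2 * (x - a)).
Proof. by apply: is_derive_eq; rewrite /GRing.scale/=; ring. Qed.

(** One coordinate is frozen: [c] will be its squared offset plus [e ^+ 2], so the logarithm is
    smooth along the whole line. *)
Lemma is_derive_ln_sqrD (x : R) :
  is_derive x 1 (fun x => ln ((x - a) ^+ 2 + c)) (2 * (x - a) / ((x - a) ^+ 2 + c)).
Proof.
have dln := is_derive1_ln (q_gt0 x).
by apply: (is_derive_eq (is_derive1_comp dln (dq x))); rewrite mulrC.
Qed.

Lemma is_derive2_ln_sqrD (x : R) :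
  is_derive x 1 (fun x => 2 * (x - a) / ((x - a) ^+ 2 + c))
    (2 * (c - (x - a) ^+ 2) / ((x - a) ^+ 2 + c) ^+ 2).
Proof.
have q0 := lt0r_neq0 (q_gt0 x).
have dV := @is_deriveV R q x _ 1 q0 (dq x).
have dl : is_derive x 1 (fun x => 2 * (x - a)) 2.
  by apply: is_derive_eq; rewrite /GRing.scale/=; ring.
apply: (is_derive_eq (is_deriveM dl dV)).
by move: q0; rewrite /GRing.scale/= /q => q0; field.
Qed.

Lemma continuous_derive2_ln_sqrD :
  continuous (fun x : R => 2 * (c - (x - a) ^+ 2) / ((x - a) ^+ 2 + c) ^+ 2).
Proof.
move=> x.
have cxa : (fun t : R => (t - a) ^+ 2) t @[t --> x] --> (x - a) ^+ 2.
  by apply: (cvg_comp (fun t => t - a) (fun t => t ^+ 2));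
    [apply: cvgB; [exact: cvg_id|exact: cvg_cst]|exact: sqr_continuous].
apply: cvgM.
  by apply: cvgM; [exact: cvg_cst|apply: cvgB; [exact: cvg_cst|exact: cxa]].
apply: cvgV; first by rewrite expf_neq0// lt0r_neq0// q_gt0.
apply: (cvg_comp (fun t => (t - a) ^+ 2 + c) (fun t => t ^+ 2)).
  by apply: cvgD; [exact: cxa|exact: cvg_cst].
exact: sqr_continuous.
Qed.

End regularized_logarithm.

(** * The logarithmic potential of a Laplacian *)

Section regularized_representation.
Context {R : realType}.
Notation mu := (@lebesgue_measure R).
Notation mu2 := (mu \x mu)%E.

(** Exactly what integration by parts along each axis consumes, with a common support radius [B] in
    the max norm. *)
Record C2_partials (f fx fy fxx fyy : R * R -> R) (B : R) : Prop := C2Partials {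
  C2_B : 0 < B ;
  C2_x : forall x y : R, is_derive x 1 (fun t => f (t, y)) (fx (x, y)) ;
  C2_xx : forall x y : R, is_derive x 1 (fun t => fx (t, y)) (fxx (x, y)) ;
  C2_y : forall x y : R, is_derive y 1 (fun t => f (x, t)) (fy (x, y)) ;
  C2_yy : forall x y : R, is_derive y 1 (fun t => fy (x, t)) (fyy (x, y)) ;
  C2_cf : continuous f ;
  C2_cxx : continuous fxx ;
  C2_cyy : continuous fyy ;
  C2_supp : forall z, B <= `|z| ->
    [/\ f z = 0, fx z = 0, fy z = 0, fxx z = 0 & fyy z = 0] }.

Context (f fx fy fxx fyy : R * R -> R) (B : R).
Hypothesis fC2 : C2_partials f fx fy fxx fyy B.
Variables (a : R * R) (e : R).
Hypothesis e0 : 0 < e.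

Let q (z : R * R) := sqnorm (z - a) + e ^+ 2.

Let e20 : 0 < e ^+ 2. Proof. by rewrite exprn_gt0. Qed.

Let q_gt0 z : 0 < q z.
Proof. by rewrite ltr_wpDl// addr_ge0// sqr_ge0. Qed.

Lemma continuous_sqnormB b : continuous (fun z : R * R => sqnorm (z - b)).
Proof.
move=> z; apply: cvgD.
- apply: (cvg_comp (fun z : R * R => z.1 - b.1) (fun t => t ^+ 2)).
    by apply: cvgB; [exact: cvg_fst|exact: cvg_cst].
  exact: sqr_continuous.
- apply: (cvg_comp (fun z : R * R => z.2 - b.2) (fun t => t ^+ 2)).
    by apply: cvgB; [exact: cvg_snd|exact: cvg_cst].
  exact: sqr_continuous.
Qed.

Let cq : continuous q.
Proof. by move=> z; apply: cvgD; [exact: continuous_sqnormB|exact: cvg_cst]. Qed.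

Let clnq : continuous (fun z => ln (q z)).
Proof.
move=> z; apply: (cvg_comp q (@ln R)); first exact: cq.
exact: continuous_ln.
Qed.

Let qxx (z : R * R) := 2 * ((z.2 - a.2) ^+ 2 + e ^+ 2 - (z.1 - a.1) ^+ 2) / q z ^+ 2.
Let qyy (z : R * R) := 2 * ((z.1 - a.1) ^+ 2 + e ^+ 2 - (z.2 - a.2) ^+ 2) / q z ^+ 2.

Let cq2 (h : R * R -> R) : continuous h -> continuous (fun z => h z / q z ^+ 2).
Proof.
move=> ch z; apply: cvgM; first exact: ch.
apply: cvgV; first by rewrite expf_neq0// lt0r_neq0.
apply: (cvg_comp q (fun t => t ^+ 2)); first exact: cq.
exact: sqr_continuous.
Qed.

Let c1 (b : R) : continuous (fun z : R * R => (z.1 - b) ^+ 2).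
Proof.
move=> z; apply: (cvg_comp (fun z : R * R => z.1 - b) (fun t => t ^+ 2)).
  by apply: cvgB; [exact: cvg_fst|exact: cvg_cst].
exact: sqr_continuous.
Qed.

Let c2 (b : R) : continuous (fun z : R * R => (z.2 - b) ^+ 2).
Proof.
move=> z; apply: (cvg_comp (fun z : R * R => z.2 - b) (fun t => t ^+ 2)).
  by apply: cvgB; [exact: cvg_snd|exact: cvg_cst].
exact: sqr_continuous.
Qed.

Let cqxx : continuous qxx.
Proof.
apply: cq2 => z; apply: cvgM; first exact: cvg_cst.
apply: cvgB; last exact: c1.
by apply: cvgD; [exact: c2|exact: cvg_cst].
Qed.

Let cqyy : continuous qyy.
Proof.
apply: cq2 => z; apply: cvgM; first exact: cvg_cst.
apply: cvgB; last exact: c2.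
by apply: cvgD; [exact: c1|exact: cvg_cst].
Qed.

Let ci (h1 h2 : R * R -> R) : continuous h1 -> continuous h2 ->
  (forall z, B <= `|z| -> h1 z = 0) ->
  mu2.-integrable [set: R * R] (EFin \o (fun z => h1 z * h2 z)).
Proof.
move=> ch1 ch2 h0; apply: (@integrable_continuous_support _ _ B).
  by move=> z; apply: cvgM; [exact: ch1|exact: ch2].
by move=> z /h0 ->; rewrite mul0r.
Qed.

Let f0 z : B <= `|z| -> f z = 0. Proof. by case/(C2_supp fC2). Qed.
Let fxx0 z : B <= `|z| -> fxx z = 0. Proof. by case/(C2_supp fC2). Qed.
Let fyy0 z : B <= `|z| -> fyy z = 0. Proof. by case/(C2_supp fC2). Qed.

Let cpair1 (h : R * R -> R) (y : R) : continuous h -> continuous (fun x => h (x, y)).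
Proof.
move=> ch x; apply: (cvg_comp (fun x => (x, y)) h); last exact: ch.
exact: (@cvg_pair _ _ _ (nbhs x) (nbhs x) (nbhs y) _ _ _ id (cst y)
  (@cvg_id _ _) (@cvg_cst _ _ _ _ _)).
Qed.

Let cpair2 (h : R * R -> R) (x : R) : continuous h -> continuous (fun y => h (x, y)).
Proof.
move=> ch y; apply: (cvg_comp (fun y => (x, y)) h); last exact: ch.
exact: (@cvg_pair _ _ _ (nbhs y) (nbhs x) (nbhs y) _ _ _ (cst x) id
  (@cvg_cst _ _ _ _ _) (@cvg_id _ _)).
Qed.

(** Fubini reduces to horizontal lines, on each of which both derivatives in the first coordinate
    are moved onto the logarithm. *)
Let reg_x : (\int[mu2]_z (fxx z * ln (q z))%:E = \int[mu2]_z (f z * qxx z)%:E)%E.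
Proof.
rewrite -(integral21_prod_meas1 (ci (C2_cxx fC2) clnq fxx0)).
rewrite -(integral21_prod_meas1 (ci (C2_cf fC2) cqxx f0)).
apply: eq_integral => y _; rewrite /fubini_G/=.
pose c := (y - a.2) ^+ 2 + e ^+ 2.
have c0 : 0 < c by rewrite ltr_wpDl// sqr_ge0.
have qE x : q (x, y) = (x - a.1) ^+ 2 + c by rewrite /q /sqnorm/= addrA.
under eq_integral do rewrite qE.
under [RHS]eq_integral do rewrite /qxx qE/= -/c.
apply: (integral_by_parts_twice (C2_B fC2) _ _ (is_derive_ln_sqrD a.1 c0)
  (is_derive2_ln_sqrD a.1 c0)).
- by move=> x; exact: (C2_x fC2).
- by move=> x; exact: (C2_xx fC2).
- exact: cpair1 (C2_cxx fC2).
- exact: continuous_derive2_ln_sqrD.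
- move=> x Bx; have /(C2_supp fC2)[-> -> _ -> _] // : B <= `|(x, y)|.
  exact: prod_norm_ge1.
Qed.

Let reg_y : (\int[mu2]_z (fyy z * ln (q z))%:E = \int[mu2]_z (f z * qyy z)%:E)%E.
Proof.
rewrite -(integral12_prod_meas1 (ci (C2_cyy fC2) clnq fyy0)).
rewrite -(integral12_prod_meas1 (ci (C2_cf fC2) cqyy f0)).
apply: eq_integral => x _; rewrite /fubini_F/=.
pose c := (x - a.1) ^+ 2 + e ^+ 2.
have c0 : 0 < c by rewrite ltr_wpDl// sqr_ge0.
have qE y : q (x, y) = (y - a.2) ^+ 2 + c by rewrite /q /sqnorm/= /c; ring.
under eq_integral do rewrite qE.
under [RHS]eq_integral do rewrite /qyy qE/= -/c.
apply: (integral_by_parts_twice (C2_B fC2) _ _ (is_derive_ln_sqrD a.2 c0)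
  (is_derive2_ln_sqrD a.2 c0)).
- by move=> y; exact: (C2_y fC2).
- by move=> y; exact: (C2_yy fC2).
- exact: cpair2 (C2_cyy fC2).
- exact: continuous_derive2_ln_sqrD.
- move=> y Bx; have /(C2_supp fC2)[-> _ -> _ ->] // : B <= `|(x, y)|.
  exact: prod_norm_ge2.
Qed.

(** In [qxx + qyy] the quadratic terms cancel and [4 e^2 / q^2] remains. Under [z = a + e u], and
    with the Jacobian [e^2], this becomes a kernel in [u] free of [e]. *)
Lemma laplacian_regularized_log :
  (\int[mu2]_z ((fxx z + fyy z) * ln (sqnorm (z - a) + e ^+ 2))%:E =
   \int[mu2]_z (f z * (4 * e ^+ 2 / (sqnorm (z - a) + e ^+ 2) ^+ 2))%:E)%E.
Proof.
under eq_integral do rewrite -/(q _) mulrDl EFinD.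
rewrite (integralD _ (ci (C2_cxx fC2) clnq fxx0) (ci (C2_cyy fC2) clnq fyy0))//=.
rewrite reg_x reg_y.
rewrite -(integralD _ (ci (C2_cf fC2) cqxx f0) (ci (C2_cf fC2) cqyy f0))//=.
apply: eq_integral => z _; rewrite -EFinD -mulrDr /qxx /qyy -mulrDl; congr (_ * (_ / _))%:E.
ring.
Qed.

End regularized_representation.

(** * Affine changes of variables *)

Definition pushforward_measure d1 d2 (T1 : measurableType d1)
  (T2 : measurableType d2) (R : realType) (m : {measure set T1 -> \bar R})
  (f : T1 -> T2) (mf : measurable_fun [set: T1] f) : {measure set T2 -> \bar R} :=
  measure_function_pushforward__canonical__measure_function_Measure m mf.

Section affine_change_of_variables.
Context {R : realType}.
Notation mu := (@lebesgue_measure R).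
Notation mu2 := (mu \x mu)%E.
Notation TR := (measurableTypeR R).
Variables (e : R) (e0 : 0 < e).

Let en : {nonneg R} := NngNum (ltW e0).

(** By uniqueness of Lebesgue measure it suffices to compare on half-open intervals. In the plane,
    uniqueness of the product measure plays the same role on rectangles. *)
Lemma lebesgue_measure_affine (a : R) (A : set R) : measurable A ->
  (mu A = e%:E * mu ((fun x => a + e * x)%R @^-1` A))%E.
Proof.
pose h : R -> measurableTypeR R := fun x => a + e * x.
have mh : measurable_fun [set: measurableTypeR R] h.
  by apply: measurable_funD => //; exact: mulrl_measurable.
move=> mA; rewrite -[RHS]/(mscale en (pushforward_measure mu mh) A).
apply: (@lebesgue_measure_unique _ (mscale en (pushforward_measure mu mh))) => //= _ [[p r] _ <-].
rewrite /mscale/= /pushforward.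
have -> : h @^-1` `]p, r] = `](p - a) / e, (r - a) / e]%classic.
  apply/seteqP; split => x /=; rewrite !in_itv/= /h.
    move=> /andP[px xr]; apply/andP; split.
      by rewrite ltr_pdivrMr//; lra.
    by rewrite ler_pdivlMr//; lra.
  rewrite ltr_pdivrMr// ler_pdivlMr// => /andP[px xr]; apply/andP; split; lra.
rewrite !lebesgue_measure_itv/= !lte_fin ltr_pM2r ?invr_gt0// ltrD2r.
case: ifPn => pr; last by rewrite mule0.
by rewrite -!EFinD -EFinM; congr (_%:E); field; exact: lt0r_neq0.
Qed.

Lemma lebesgue_measure2_affine (a : R * R) (A : set (TR * TR)) : measurable A ->
  (mu2 A = (e ^+ 2)%:E * mu2 ((fun u => a + e *: u)%R @^-1` A))%E.
Proof.
pose h : TR * TR -> TR * TR := fun u => a + e *: u.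
have mh : measurable_fun [set: TR * TR] h.
  apply: measurable_fun_pair.
  - apply: measurable_funD => //; apply: measurable_funM => //; exact: measurable_fst.
  - apply: measurable_funD => //; apply: measurable_funM => //; exact: measurable_snd.
pose e2 : {nonneg R} := NngNum (sqr_ge0 e).
move=> mA; rewrite -[RHS]/(mscale e2 (pushforward_measure mu2 mh) A).
apply: (@product_measure_unique _ _ _ _ R lebesgue_measure lebesgue_measure (mscale e2 (pushforward_measure mu2 mh))) => //= X Y mX mY.
rewrite /mscale/= /pushforward.
have -> : h @^-1` (X `*` Y) =
    ((fun x => a.1 + e * x) @^-1` X) `*` ((fun x => a.2 + e * x) @^-1` Y) by [].
have mpre (b : R) (Z : set R) : measurable Z ->
    measurable ((fun x => b + e * x) @^-1` Z).
  move=> mZ; rewrite -[X in measurable X]setTI.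
  by apply: measurable_funD => //; exact: mulrl_measurable.
rewrite product_measure1E; [|exact: mpre..].
rewrite [in RHS](lebesgue_measure_affine a.1 mX) [in RHS](lebesgue_measure_affine a.2 mY).
by rewrite EFin_expe expe2 muleACA.
Qed.

Lemma ge0_integral2_affine (a : R * R) (F : R * R -> \bar R) :
  measurable_fun [set: R * R] F -> (forall z, (0 <= F z)%E) ->
  (\int[mu2]_z F z = (e ^+ 2)%:E * \int[mu2]_u F (a + e *: u)%R)%E.
Proof.
move=> mF F0.
pose h : TR * TR -> TR * TR := fun u => a + e *: u.
have mh : measurable_fun [set: TR * TR] h.
  apply: measurable_fun_pair.
  - apply: measurable_funD => //; apply: measurable_funM => //; exact: measurable_fst.
  - apply: measurable_funD => //; apply: measurable_funM => //; exact: measurable_snd.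
pose e2 : {nonneg R} := NngNum (sqr_ge0 e).
transitivity (\int[mscale e2 (pushforward_measure mu2 mh)]_z F z)%E.
  by apply: eq_measure_integral => A mA _; exact: lebesgue_measure2_affine.
rewrite (@ge0_integral_mscale _ _ R (pushforward_measure mu2 mh) _ measurableT
  e2 F mF (fun z _ => F0 z)).
exact: (congr1 (fun t => (e ^+ 2)%:E * t)%E
  (@ge0_integral_pushforward _ _ _ _ _ _ mh mu2 _ F measurableT mF
    (fun z _ => F0 z))).
Qed.

Lemma integral2_affine (a : R * R) (F : R * R -> \bar R) :
  mu2.-integrable [set: R * R] F ->
  (\int[mu2]_z F z = (e ^+ 2)%:E * \int[mu2]_u F (a + e *: u)%R)%E.
Proof.
move=> iF; have mF := measurable_int _ iF.
have Ep := ge0_integral2_affine a (measurable_funepos mF) (fun z => funepos_ge0 F z).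
have En := ge0_integral2_affine a (measurable_funeneg mF) (fun z => funeneg_ge0 F z).
have nfin := integrable_neg_fin_num measurableT iF.
have n0 : (0 <= \int[mu2]_u F^\- (a + e *: u)%R)%E by exact: integral_ge0.
have E : (\int[mu2]_u F (a + e *: u)%R =
    \int[mu2]_u F^\+ (a + e *: u)%R - \int[mu2]_u F^\- (a + e *: u)%R)%E.
  rewrite [LHS]integralE; congr (_ - _)%E; apply: eq_integral => u _.
    by rewrite !funeposE.
  by rewrite !funenegE.
(* A product distributes over an extended difference once [n] is finite; an infinite [n] would make
   [e ^+ 2 * n] infinite as well. *)
have G (p n : \bar R) : (0 <= n)%E -> ((e ^+ 2)%:E * n)%E \is a fin_num ->
    ((e ^+ 2)%:E * (p - n) = (e ^+ 2)%:E * p - (e ^+ 2)%:E * n)%E.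
  move=> n0' nf; rewrite muleBr//; move: n0' nf.
  case: n => [r _ _|_|//]; first by rewrite fin_num_adde_defl.
  by rewrite gt0_muley// lte_fin exprn_gt0.
move: nfin; rewrite En => nfin.
rewrite [LHS]integralE Ep En E; exact: (esym (G _ _ n0 nfin)).
Qed.

End affine_change_of_variables.

(** * Integrability of the inverse distance *)

Section inverse_distance.
Context {R : realType}.
Notation mu := (@lebesgue_measure R).
Notation mu2 := (mu \x mu)%E.
Notation TR := (measurableTypeR R).

Lemma measurable_prod_norm : measurable_fun [set: TR * TR] (fun z => `|z| : R).
Proof.
have -> : (fun z : TR * TR => `|z| : R) = (fun z => Num.max `|z.1| `|z.2|).
  by apply/funext => z; rewrite prod_normE.
by apply: measurable_maxr; apply: measurableT_comp.
Qed.

Lemma measurable_prod_dist (c : R * R) :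
  measurable_fun [set: TR * TR] (fun z => `|z - c| : R).
Proof.
apply: (measurableT_comp measurable_prod_norm).
apply: measurable_fun_pair.
- exact: measurable_funB.
- exact: measurable_funB.
Qed.

Lemma measurable_prod_ball (c : R * R) (r : R) :
  measurable [set z : TR * TR | `|z - c| < r].
Proof.
rewrite -[X in measurable X]setTI.
have -> : [set z : TR * TR | `|z - c| < r] = (fun z => `|z - c|) @^-1` `]-oo, r[.
  by apply/seteqP; split => z /=; rewrite in_itv.
exact: measurable_prod_dist.
Qed.

Lemma lebesgue_measure_prod_ball (c : R * R) (r : R) : 0 < r ->
  mu2 [set z : TR * TR | `|z - c| < r] = (4 * r ^+ 2)%:E.
Proof.
move=> r0.
have -> : [set z : TR * TR | `|z - c| < r] = ball c.1 r `*` ball c.2 r.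
  apply/seteqP; split => z /=; rewrite prod_normE/= gt_max /ball/=.
    by move=> /andP[]; rewrite distrC => -> ; rewrite distrC => ->.
  by move=> [] + +; rewrite distrC => ->; rewrite distrC => ->.
rewrite product_measure1E; [|exact: measurable_ball..].
rewrite /= !lebesgue_measure_ball ?ltW// -EFinM; congr (_%:E); ring.
Qed.

(** Take the least [m] with [x^-1 <= 2 ^+ m]. It is positive because [x < 1], and minimality says
    that [k = m - 1] violates the inequality. *)
Lemma dyadic_bracket (x : R) : 0 < x -> x < 1 ->
  exists k : nat, x < 2 ^- k /\ x^-1 <= 2 ^+ k.+1.
Proof.
move=> x0 x1.
have ex : exists m, x^-1 <= 2 ^+ m.
  exists (Num.bound x^-1); apply/ltW; exact: upper_nthrootP.
have [m hm mmin] := ex_minnP ex.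
case: m hm mmin => [|k] hm mmin.
  by move: hm; rewrite expr0 invf_le1// leNgt x1.
exists k; split => //.
rewrite -[ltLHS]invrK ltf_pV2 ?posrE ?invr_gt0 ?exprn_gt0//.
by rewrite ltNge; apply/negP => /mmin; rewrite ltnn.
Qed.

Variables (m : {measure set (TR * TR) -> \bar R}) (A : R).
Hypothesis A0 : 0 <= A.
Hypothesis mA : forall (c : R * R) (r : R), 0 < r ->
  (m [set z | (`|z - c| < r)%R] <= (A * r ^+ 2)%:E)%E.

(* The integrand is at most [2 ^+ k.+1] on the ring [2 ^- k.+1 <= `|z - c| < 2 ^- k]. *)
Lemma integral_inverse_dist (c : R * R) :
  (\int[m]_z (if `|z - c| < 1 then `|z - c|^-1 else 0)%:E <= (4 * A)%:E)%E.
Proof.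
pose b (k : nat) : set (TR * TR) := [set z | `|z - c| < 2 ^- k].
pose F (k : nat) (z : TR * TR) : \bar R := (2 ^+ k.+1 * \1_(b k) z)%:E.
have mb k : measurable (b k) by exact: measurable_prod_ball.
have mF k : measurable_fun [set: TR * TR] (F k).
  by apply/measurable_EFinP; apply: measurable_funM => //; exact: measurable_indic.
have F0 k z : (0 <= F k z)%E by rewrite lee_fin mulr_ge0.
have ub : (\int[m]_z (if `|z - c| < 1 then `|z - c|^-1 else 0)%:E <=
    \int[m]_z (\sum_(0 <= k <oo) F k z))%E.
  apply: ge0_le_integral => //.
  - by move=> z _; case: ifP => // _; rewrite lee_fin invr_ge0.
  - apply/measurable_EFinP; apply: measurable_fun_ifT => //.
    + apply: measurable_fun_ltr => //; exact: measurable_prod_dist.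
    + by apply: measurable_funV; exact: measurable_prod_dist.
  - by apply: ge0_emeasurable_sum => // k z _ _; exact: F0.
  move=> z _; case: ifPn => [zc1|_]; last exact: nneseries_ge0.
  (* At the centre the integrand is 0, by the convention [0^-1 = 0]. *)
  have [zc|zc] := eqVneq z c.
    by rewrite zc subrr normr0 invr0; exact: nneseries_ge0.
  have zc0 : 0 < `|z - c| by rewrite normr_gt0 subr_eq0.
  have [k [k1 k2]] := dyadic_bracket zc0 zc1.
  apply: (@le_trans _ _ (F k z)).
    by rewrite /F lee_fin indicE mem_set ?mulr1.
  apply: (@le_trans _ _ (\sum_(0 <= i < k.+1) F i z)%E).
    by rewrite big_nat_recr//= leeDr// sume_ge0.
  exact: nneseries_lim_ge.
apply: (le_trans ub); rewrite integral_nneseries//.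
(* The [k]-th integral is at most [2^(k+1) * A * 4^(-k) = 4 A / 2^(k+1)], the general term of a
   geometric series with sum [4 A]. *)
apply: (le_trans _ (epsilon_trick0 xpredT (mulr_ge0 (ler0n R 4) A0))).
apply: lee_nneseries => k _; first by move=> _; exact: integral_ge0.
rewrite /F; under eq_integral do rewrite EFinM.
rewrite ge0_integralZl//; last by apply/measurable_EFinP; exact: measurable_indic.
rewrite integral_indic// setIT.
apply: (@le_trans _ _ ((2 ^+ k.+1)%:E * (A * (2 ^- k) ^+ 2)%:E)%E).
  by apply: lee_wpmul2l => //; exact: mA.
rewrite -EFinM lee_fin natrX exprS.
rewrite [leRHS](_ : _ = 2 * 2 ^+ k * (A * (2 ^- k) ^+ 2))//.
by field; rewrite expf_neq0.
Qed.

End inverse_distance.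

Section logarithmic_potential.
Context {R : realType}.
Notation mu := (@lebesgue_measure R).
Notation mu2 := (mu \x mu)%E.
Notation TR := (measurableTypeR R).

(* The Laplacian of [ln (sqnorm u + 1)]. *)
Definition poisson_kernel (u : R * R) : R := 4 / (sqnorm u + 1) ^+ 2.

Lemma sqnorm_ge0 (u : R * R) : 0 <= sqnorm u.
Proof. by rewrite addr_ge0 ?sqr_ge0. Qed.

Lemma continuous_sqnorm : continuous (@sqnorm R).
Proof.
have -> : @sqnorm R = fun z => sqnorm (z - 0).
  by apply/funext => z; rewrite subr0.
exact: continuous_sqnormB.
Qed.

Lemma continuous_poisson_kernel : continuous poisson_kernel.
Proof.
move=> z; apply: cvgM; first exact: cvg_cst.
have s0 := sqnorm_ge0 z.
apply: cvgV; first by rewrite expf_neq0// lt0r_neq0// ltr_wpDl.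
apply: (cvg_comp (fun t => sqnorm t + 1) (fun t => t ^+ 2)).
  by apply: cvgD; [exact: continuous_sqnorm|exact: cvg_cst].
exact: sqr_continuous.
Qed.

Lemma poisson_kernel_ge0 u : 0 <= poisson_kernel u.
Proof. by rewrite mulr_ge0// invr_ge0 sqr_ge0. Qed.

Lemma oneDsqr_gt0 (x : R) : 0 < oneDsqr x.
Proof. exact: lt_le_trans ltr01 (oneDsqr_ge1 x). Qed.

Lemma integralT_oneDsqrV : (\int[mu]_x ((oneDsqr x)^-1)%:E = pi%:E)%E.
Proof.
rewrite ge0_symfun_integralT; last 3 first.
- by move=> x; rewrite invr_ge0 ltW// oneDsqr_gt0.
- exact: continuous_oneDsqrV.
- by move=> x; rewrite /= /oneDsqr sqrrN.
by rewrite -set_itvcy integral0y_oneDsqr -EFinM; congr (_%:E); lra.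
Qed.

Lemma integrable_poisson_kernel :
  mu2.-integrable [set: R * R] (EFin \o poisson_kernel).
Proof.
have mV : measurable_fun [set: TR] (fun x => (oneDsqr x)^-1 : R).
  exact: continuous_measurable_fun (@continuous_oneDsqrV R).
apply/integrableP; split.
  by apply/measurable_EFinP; exact: continuous_measurable_prod continuous_poisson_kernel.
(* Since [(1 + x^2) (1 + y^2) <= (1 + x^2 + y^2)^2], the kernel lies below a product of Cauchy
   densities (up to a factor), and Tonelli applies. *)
pose G (z : TR * TR) : \bar R := (4 * (oneDsqr z.1)^-1 * (oneDsqr z.2)^-1)%:E.
have mG : measurable_fun [set: TR * TR] G.
  apply/measurable_EFinP; apply: measurable_funM.
    by apply: measurable_funM => //; apply: (measurableT_comp mV).
  exact: (measurableT_comp mV).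
have G0 z : (0 <= G z)%E.
  by rewrite lee_fin !mulr_ge0// invr_ge0 ltW// oneDsqr_gt0.
apply: (@le_lt_trans _ _ (\int[mu2]_z G z)%E).
  apply: ge0_le_integral => //.
    apply: measurableT_comp => //; apply/measurable_EFinP.
    exact: continuous_measurable_prod continuous_poisson_kernel.
  move=> z _; rewrite /= ger0_norm ?poisson_kernel_ge0// lee_fin.
  rewrite /poisson_kernel -mulrA ler_wpM2l// -invfM.
  have h1 := oneDsqr_gt0 z.1; have h2 := oneDsqr_gt0 z.2.
  rewrite lef_pV2 ?posrE ?mulr_gt0// ?exprn_gt0 ?ltr_wpDl ?sqnorm_ge0//.
  rewrite /sqnorm /oneDsqr.
  have := sqr_ge0 z.1; have := sqr_ge0 z.2.
  set s := z.1 ^+ 2; set t := z.2 ^+ 2 => t0 s0.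
  by nra.
rewrite fubini_tonelli1//= /fubini_F/= /G/=.
have V0 (x : R) : (0 <= ((oneDsqr x)^-1)%:E)%E.
  by rewrite lee_fin invr_ge0 ltW// oneDsqr_gt0.
have Z (k : R) : 0 <= k ->
    (\int[mu]_x (k * (oneDsqr x)^-1)%:E = (k * pi)%:E)%E.
  move=> k0; under eq_integral do rewrite EFinM.
  rewrite (@ge0_integralZl _ _ _ mu _ measurableT (fun x => (oneDsqr x)^-1%:E))//.
    by rewrite integralT_oneDsqrV.
  exact/measurable_EFinP.
under eq_integral => x _.
  rewrite Z; last by rewrite mulr_ge0// -lee_fin.
  rewrite mulrAC.
  over.
by rewrite Z ?ltry// mulr_ge0// pi_ge0.
Qed.

(* Its value is [4 * pi], but only its positivity matters. *)
Definition potential_constant : R := fine (\int[mu2]_u (poisson_kernel u)%:E)%E.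

Lemma potential_constantE :
  (\int[mu2]_u (poisson_kernel u)%:E)%E = potential_constant%:E.
Proof.
by rewrite fineK//; exact: (integrable_fin_num measurableT integrable_poisson_kernel).
Qed.

Lemma potential_constant_gt0 : 0 < potential_constant.
Proof.
rewrite -lte_fin -potential_constantE.
pose b := [set z : TR * TR | `|z - 0| < 1].
(* On the max-norm unit ball [sqnorm u < 2], so the kernel is at least [4 / 3^2]. *)
apply: (@lt_le_trans _ _ (\int[mu2]_u ((4 / 9) * \1_b u)%:E)%E).
  under eq_integral do rewrite EFinM.
  have mb : measurable b by exact: measurable_prod_ball.
  rewrite ge0_integralZl//; last by apply/measurable_EFinP; exact: measurable_indic.
  rewrite integral_indic// setIT.
  have Eb : mu2 b = (4 * 1 ^+ 2)%:E := lebesgue_measure_prod_ball 0 ltr01.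
  have mub : (0 < mu2 b)%E by rewrite Eb lte_fin; lra.
  by apply: mule_gt0; [rewrite lte_fin; lra|exact: mub].
apply: ge0_le_integral => //.
- apply/measurable_EFinP; apply: measurable_funM => //; apply: measurable_indic.
  exact: measurable_prod_ball.
- by apply/measurable_EFinP; exact: continuous_measurable_prod continuous_poisson_kernel.
move=> z _; rewrite lee_fin indicE.
have [|_] := boolP (z \in b); last by rewrite mulr0 poisson_kernel_ge0.
rewrite inE /b/= subr0 prod_normE/= gt_max => /andP[].
rewrite mulr1 => z1 z2.
have h1 : z.1 ^+ 2 < 1 by rewrite -[ltLHS]ger0_norm ?sqr_ge0// normrX exprn_ilt1.
have h2 : z.2 ^+ 2 < 1 by rewrite -[ltLHS]ger0_norm ?sqr_ge0// normrX exprn_ilt1.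
rewrite /poisson_kernel ler_wpM2l// lef_pV2 ?posrE ?exprn_gt0 ?ltr_wpDl ?sqnorm_ge0//.
rewrite /sqnorm; have := sqr_ge0 z.1; have := sqr_ge0 z.2.
by nra.
Qed.

(** A bound uniform in the regularization [s], with an integrable singularity. When the argument is
    at least 1, [ln t <= t - 1] is used; otherwise it is still at least [|u|^2], and
    [- ln |u|^2 = 2 ln (1 / |u|) <= 2 / |u|]. *)
Lemma abs_ln_sqnorm (u : R * R) (s : R) : u != 0 -> 0 <= s -> s <= 1 ->
  `|ln (sqnorm u + s)| <= sqnorm u + 2 * `|u|^-1.
Proof.
move=> u0 s0 s1.
have nu0 : 0 < `|u| by rewrite normr_gt0.
have nu2 : `|u| ^+ 2 <= sqnorm u.
  rewrite prod_normE/=; have [_|_] := leP `|u.1| `|u.2|.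
    by rewrite real_normK ?num_real// lerDr sqr_ge0.
  by rewrite real_normK ?num_real// lerDl sqr_ge0.
have N0 : 0 < sqnorm u by apply: lt_le_trans nu2; rewrite exprn_gt0.
have lnle (t : R) : 0 < t -> ln t <= t.
  by move=> t0; exact/ltW/ln_sublinear.
have [t1|t1] := leP 1 (sqnorm u + s).
  rewrite ger0_norm ?ln_ge0//.
  have : ln (sqnorm u + s) <= sqnorm u + s - 1.
    have := @le_ln1Dx _ (sqnorm u + s - 1); rewrite addrCA subrr addr0; apply.
    by rewrite ltrBrDl; lra.
  have : 0 <= `|u|^-1 by rewrite invr_ge0.
  by lra.
rewrite ler0_norm; last by rewrite ln_le0// ltW.
have : - ln (sqnorm u + s) <= - ln (`|u| ^+ 2).
  rewrite lerN2 ler_ln ?posrE ?exprn_gt0//; first by lra.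
  by lra.
have -> : - ln (`|u| ^+ 2) = 2 * ln (`|u|^-1).
  by rewrite lnV ?posrE// lnXn// mulr2n; ring.
have : ln `|u|^-1 <= `|u|^-1 by apply: lnle; rewrite invr_gt0.
by lra.
Qed.

End logarithmic_potential.

Section logarithmic_representation.
Context {R : realType}.
Notation mu := (@lebesgue_measure R).
Notation mu2 := (mu \x mu)%E.
Notation TR := (measurableTypeR R).

Lemma integrable_inverse_dist (c : R * R) : mu2.-integrable [set: R * R]
  (fun z => (if `|z - c| < 1 then `|z - c|^-1 else 0)%:E).
Proof.
have ge z : (0 <= (if `|z - c| < 1 then `|z - c|^-1 else 0)%:E :> \bar R)%E.
  by case: ifP => _; rewrite lee_fin// invr_ge0.
apply/integrableP; split.
  apply/measurable_EFinP; apply: measurable_fun_ifT => //.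
    by apply: measurable_fun_ltr => //; exact: measurable_prod_dist.
  by apply: measurable_funV; exact: measurable_prod_dist.
under eq_integral do rewrite gee0_abs//.
have A0 : 0 <= 4 :> R by [].
have mA (b : R * R) (r : R) : 0 < r ->
    (mu2 [set z : TR * TR | (`|z - b| < r)%R] <= (4 * r ^+ 2)%:E)%E.
  by move=> r0; rewrite le_eqVlt (lebesgue_measure_prod_ball b r0) eqxx.
exact: le_lt_trans (integral_inverse_dist A0 mA c) (ltry _).
Qed.

Lemma set1_prod (c : R * R) : [set c] = [set c.1] `*` [set c.2].
Proof.
apply/seteqP; split => [z ->//|[x y] /= [-> ->]].
by rewrite -surjective_pairing.
Qed.

Lemma negligible_point (c : R * R) : {ae mu2, forall z : TR * TR, z != c}.
Proof.
exists [set c]; split.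
- by rewrite set1_prod; exact: measurableX.
- by rewrite set1_prod product_measure1E//= lebesgue_measure_set1 mul0e.
- by move=> z /= /negP; rewrite negbK => /eqP.
Qed.

Context (f fx fy fxx fyy : R * R -> R) (B : R).
Hypothesis fC2 : C2_partials f fx fy fxx fyy B.
Variable (a : R * R).

Let lap z := fxx z + fyy z.
Let clap : continuous lap.
Proof. by move=> z; apply: cvgD; [exact: (C2_cxx fC2)|exact: (C2_cyy fC2)]. Qed.
Let lap0 z : B <= `|z| -> lap z = 0.
Proof. by move=> /(C2_supp fC2)[_ _ _ + +]; rewrite /lap => -> ->; rewrite addr0. Qed.

Let e (k : nat) : R := k.+1%:R^-1.
Let e_gt0 k : 0 < e k. Proof. by rewrite invr_gt0. Qed.
Let e_le1 k : e k <= 1. Proof. by rewrite invf_le1// ler1n. Qed.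
Let e_cvg : e k @[k --> \oo] --> (0 : R).
Proof. exact: cvg_harmonic. Qed.

Let u (k : nat) (z : R * R) := lap z * ln (sqnorm (z - a) + e k ^+ 2).
Let l (z : R * R) := lap z * ln (sqnorm (z - a)).

Let cln k : continuous (fun z : R * R => ln (sqnorm (z - a) + e k ^+ 2)).
Proof.
move=> z; apply: (cvg_comp (fun z => sqnorm (z - a) + e k ^+ 2) (@ln R)).
  by apply: cvgD; [exact: continuous_sqnormB|exact: cvg_cst].
by apply: continuous_ln; rewrite ltr_wpDl ?sqnorm_ge0// exprn_gt0.
Qed.

Let mu_ k : measurable_fun [set: TR * TR] (EFin \o u k).
Proof.
apply/measurable_EFinP; apply: continuous_measurable_prod => z.
by apply: cvgM; [exact: clap|exact: cln].
Qed.

Let ml : measurable_fun [set: TR * TR] (EFin \o l).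
Proof.
apply/measurable_EFinP; apply: measurable_funM.
  exact: continuous_measurable_prod.
exact: (measurableT_comp (@measurable_ln R)
  (continuous_measurable_prod (@continuous_sqnormB R a))).
Qed.

Let ucvg : {ae mu2, forall z : TR * TR,
  [set: TR * TR] z -> (EFin \o u k) z @[k --> \oo] --> (EFin \o l) z}.
Proof.
apply: filterS (negligible_point a) => z za _.
apply: cvg_EFin; first by exists 0%N.
rewrite /comp/=; apply: cvgM; first exact: cvg_cst.
have N0 : 0 < sqnorm (z - a).
  rewrite lt_neqAle sqnorm_ge0 andbT eq_sym; apply/negP.
  rewrite paddr_eq0 ?sqr_ge0// !sqrf_eq0 !subr_eq0 => /andP[/eqP z1 /eqP z2].
  by move/eqP : za; apply; rewrite [z]surjective_pairing z1 z2 -surjective_pairing.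
have c : (sqnorm (z - a) + e k ^+ 2) @[k --> \oo] --> sqnorm (z - a) + 0 ^+ 2.
  apply: cvgD; first exact: cvg_cst.
  by apply: (cvg_comp e (fun t => t ^+ 2)); [exact: e_cvg|exact: sqr_continuous].
rewrite expr0n/= addr0 in c.
exact: (cvg_comp _ _ c (continuous_ln N0)).
Qed.

(** The dominating function must not depend on [k]: [e k <= 1] makes [abs_ln_sqnorm] uniform, and
    the compact support of [lap] absorbs the growth at infinity. *)
Let bound : exists2 g : TR * TR -> \bar R, mu2.-integrable [set: TR * TR] g &
  {ae mu2, forall z : TR * TR, forall k,
    [set: TR * TR] z -> (`|(EFin \o u k) z| <= g z)%E}.
Proof.
have [M hM] := continuous_support_bounded clap lap0.
pose I (z : R * R) := if `|z - a| < 1 then `|z - a|^-1 else 0.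
have M0 : 0 <= M by exact: le_trans (normr_ge0 _) (hM 0).
pose g1 z := `|lap z| * (sqnorm (z - a) + 2).
have ig1 : mu2.-integrable [set: R * R] (EFin \o g1).
  apply: (@integrable_continuous_support _ _ B).
    move=> z; apply: cvgM; first by apply: cvg_norm; exact: clap.
    by apply: cvgD; [exact: continuous_sqnormB|exact: cvg_cst].
  by move=> z /lap0; rewrite /g1 => ->; rewrite normr0 mul0r.
exists (fun z => ((EFin \o g1) z + (2 * M)%:E * (I z)%:E)%E).
  apply: integrableD => //; apply: integrableZl => //.
  exact: integrable_inverse_dist.
apply: filterS (negligible_point a) => z za k _.
rewrite /= -EFinM -EFinD lee_fin /u normrM /g1.
have za0 : z - a != 0 by rewrite subr_eq0.
have := @abs_ln_sqnorm _ (z - a) (e k ^+ 2) za0 (sqr_ge0 _) (exprn_ile1 _ (ltW (e_gt0 k)) (e_le1 k)).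
have I0 : 0 <= I z by rewrite /I; case: ifP => // _; rewrite invr_ge0.
have : `|z - a|^-1 <= 1 + I z.
  rewrite /I; case: ifPn => [_|]; first by rewrite lerDr.
  by rewrite -leNgt addr0 => h; rewrite invf_le1//; exact: lt_le_trans h.
move=> h1 h2.
have lz := hM z; have lz0 := normr_ge0 (lap z).
apply: (@le_trans _ _ (`|lap z| * (sqnorm (z - a) + 2 * (1 + I z)))).
  by rewrite ler_wpM2l//; lra.
have : `|lap z| * I z <= M * I z by rewrite ler_wpM2r.
by lra.
Qed.

(** In the rescaled variable the kernel is fixed and only the argument of [f] moves, towards [a]; a
    bound of [f] times the kernel dominates. *)
Let rcvg : (\int[mu2]_z (f (a + e k *: z) * poisson_kernel z)%:E)%E @[k --> \oo]
  --> (\int[mu2]_z (f a * poisson_kernel z)%:E)%E.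
Proof.
have f0 z : B <= `|z| -> f z = 0 by case/(C2_supp fC2).
have [M hM] := continuous_support_bounded (C2_cf fC2) f0.
have M0 : 0 <= M by exact: le_trans (normr_ge0 _) (hM 0).
have cK := @continuous_poisson_kernel R.
have cfk k : continuous (fun z : R * R => f (a + e k *: z)).
  move=> z; apply: (cvg_comp (fun z => a + e k *: z) f); last exact: (C2_cf fC2).
  by apply: cvgD; [exact: cvg_cst|apply: cvgZl_tmp; exact: cvg_id].
have p1 k : measurable_fun [set: TR * TR]
    (fun z => (f (a + e k *: z) * poisson_kernel z)%:E).
  apply/measurable_EFinP; apply: continuous_measurable_prod => z.
  by apply: cvgM; [exact: cfk|exact: cK].
have p2 : measurable_fun [set: TR * TR] (fun z => (f a * poisson_kernel z)%:E).
  apply/measurable_EFinP; apply: continuous_measurable_prod => z.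
  by apply: cvgM; [exact: cvg_cst|exact: cK].
have key (z : R * R) : f (a + e k *: z) @[k --> \oo] --> f a.
  have c : (a + e k *: z) @[k --> \oo] --> a + 0 *: z.
    by apply: cvgD; [exact: cvg_cst|apply: cvgZr_tmp; exact: e_cvg].
  rewrite scale0r addr0 in c.
  have cf : continuous f by exact: (C2_cf fC2).
  exact: (cvg_comp (fun k => a + e k *: z) f c (cf a)).
have p3 : {ae mu2, forall z : TR * TR, [set: TR * TR] z ->
    (f (a + e k *: z) * poisson_kernel z)%:E @[k --> \oo] -->
    (f a * poisson_kernel z)%:E}.
  apply: aeW => z _; apply: cvg_EFin; first by exists 0%N.
  rewrite /comp/=; apply: cvgM; last exact: cvg_cst.
  exact: key.
have p4 : mu2.-integrable [set: TR * TR] (fun z => M%:E * (poisson_kernel z)%:E)%E.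
  by apply: integrableZl => //; exact: integrable_poisson_kernel.
have p5 : {ae mu2, forall z : TR * TR, forall k, [set: TR * TR] z ->
    (`|(f (a + e k *: z)%R * poisson_kernel z)%:E| <= M%:E * (poisson_kernel z)%:E)%E}.
  apply: aeW => z k _; rewrite /= -EFinM lee_fin normrM.
  by rewrite (ger0_norm (poisson_kernel_ge0 z)) ler_wpM2r ?poisson_kernel_ge0.
by have [_ _] := dominated_convergence measurableT p1 p2 p3 p4 p5.
Qed.

Let uE k : (\int[mu2]_z (EFin \o u k) z =
  \int[mu2]_z (f (a + e k *: z) * poisson_kernel z)%:E)%E.
Proof.
rewrite /u/= (laplacian_regularized_log fC2 a (e_gt0 k)).
have f0 z : B <= `|z| -> f z = 0 by case/(C2_supp fC2).
rewrite (@integral2_affine _ (e k) (e_gt0 k) a (fun z => (f z * (4 * e k ^+ 2 / (sqnorm (z - a) + e k ^+ 2) ^+ 2))%:E)); last first.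
  apply: (@integrable_continuous_support _ _ B); last by move=> z /f0 ->; rewrite mul0r.
  move=> z; apply: cvgM; first exact: (C2_cf fC2).
  apply: cvgM; first exact: cvg_cst.
  have s0 := sqnorm_ge0 (z - a).
  apply: cvgV; first by rewrite expf_neq0// lt0r_neq0// ltr_wpDl// exprn_gt0.
  apply: (cvg_comp (fun z => sqnorm (z - a) + e k ^+ 2) (fun t => t ^+ 2)).
    by apply: cvgD; [exact: continuous_sqnormB|exact: cvg_cst].
  exact: sqr_continuous.
have e0 := lt0r_neq0 (e_gt0 k).
have cfk : continuous (fun z : R * R => f (a + e k *: z)).
  move=> z; apply: (cvg_comp (fun z => a + e k *: z) f); last exact: (C2_cf fC2).
  by apply: cvgD; [exact: cvg_cst|apply: cvgZl_tmp; exact: cvg_id].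
have [M hM] := continuous_support_bounded (C2_cf fC2) f0.
have ifk : mu2.-integrable [set: TR * TR]
    (EFin \o (fun z => f (a + e k *: z) * poisson_kernel z)).
  apply: (@le_integrable _ _ _ mu2 _ measurableT _ (fun z => M%:E * (poisson_kernel z)%:E)%E).
  - apply/measurable_EFinP; apply: continuous_measurable_prod => z.
    by apply: cvgM; [exact: cfk|exact: continuous_poisson_kernel].
  - move=> z _; rewrite lee_fin !normrM ler_wpM2r//.
    exact: le_trans (hM _) (ler_norm _).
  - by apply: integrableZl => //; exact: integrable_poisson_kernel.
have E : (\int[mu2]_z (f (a + e k *: z)%R *
      (4 * e k ^+ 2 / (sqnorm ((a + e k *: z)%R - a) + e k ^+ 2) ^+ 2))%:E =
    (e k ^- 2)%:E * \int[mu2]_z (f (a + e k *: z)%R * poisson_kernel z)%:E)%E.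
  rewrite -(integralZl measurableT ifk); apply: eq_integral => z _.
  rewrite /= -EFinM; congr (_%:E).
  rewrite (addrC a) addrK /poisson_kernel.
  have -> : sqnorm (e k *: z) = e k ^+ 2 * sqnorm z.
    by rewrite /sqnorm /= /GRing.scale/= !exprMn -mulrDr.
  have s1 : sqnorm z + 1 != 0 by rewrite lt0r_neq0// ltr_wpDl// sqnorm_ge0.
  rewrite -[X in (_ + X) ^+ 2]mulr1 -mulrDr.
  by field; apply/andP.
rewrite E muleA.
have -> : ((e k ^+ 2)%:E * (e k ^- 2)%:E = 1 :> \bar R)%E.
  by rewrite -EFinM divff// expf_neq0.
by rewrite mul1e.
Qed.

(** The same integrals have two limits: dominated convergence removes the regularization from the
    logarithm, while on the other side of [uE] the kernel concentrates at [a]. *)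
Theorem logarithmic_potential :
  mu2.-integrable [set: R * R] (fun z => ((fxx z + fyy z) * ln (sqnorm (z - a)))%:E) /\
  (\int[mu2]_z ((fxx z + fyy z) * ln (sqnorm (z - a)))%:E =
    (potential_constant * f a)%:E)%E.
Proof.
have [g ig gbound] := bound.
have [il _ ucl] := dominated_convergence measurableT mu_ ml ucvg ig gbound.
split; first exact: il.
apply: (cvg_unique _ ucl) => //.
move: rcvg; under [X in X @ _ --> _]eq_fun do rewrite -uE.
under eq_integral do rewrite EFinM.
rewrite integralZl//; last exact: integrable_poisson_kernel.
by rewrite potential_constantE -EFinM mulrC.
Qed.

End logarithmic_representation.

(** * From directional derivatives to partial derivatives with compact support *)

Section twice_differentiable.
Context {R : realType}.
Implicit Types f : R * R -> R.

Lemma is_derive_fst f (x y : R) : differentiable f (x, y) ->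
  is_derive x 1 (fun t => f (t, y)) ('D_(1, 0) f (x, y)).
Proof.
move=> df; have dv : derivable f (x, y) (1, 0) by exact: diff_derivable.
have E : (fun h : R => h^-1 *: ((f \o shift (x, y)) (h *: (1, 0)) - f (x, y))) =
    (fun h : R => h^-1 *: (((fun t => f (t, y)) \o shift x) (h *: 1) - f (x, y))).
  apply/funext => h; congr (_ *: (f _ - _)).
  by congr (_, _) => /=; rewrite /GRing.scale/= mulr0 add0r.
by apply: DeriveDef; rewrite /derivable /derive/= -?E.
Qed.

Lemma is_derive_snd f (x y : R) : differentiable f (x, y) ->
  is_derive y 1 (fun t => f (x, t)) ('D_(0, 1) f (x, y)).
Proof.
move=> df; have dv : derivable f (x, y) (0, 1) by exact: diff_derivable.
have E : (fun h : R => h^-1 *: ((f \o shift (x, y)) (h *: (0, 1)) - f (x, y))) =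
    (fun h : R => h^-1 *: (((fun t => f (x, t)) \o shift y) (h *: 1) - f (x, y))).
  apply/funext => h; congr (_ *: (f _ - _)).
  by congr (_, _) => /=; rewrite /GRing.scale/= mulr0 add0r.
by apply: DeriveDef; rewrite /derivable /derive/= -?E.
Qed.

Lemma derive_zero_on_open f (U : set (R * R)) v : open U ->
  (forall z, U z -> f z = 0) -> forall z, U z -> 'D_v f z = 0.
Proof.
move=> oU f0 z Uz.
rewrite (@near_eq_derive _ _ _ f (cst 0) z v); first exact: derive_cst.
by near=> t; apply: f0; near: t; apply: open_nbhs_nbhs.
Unshelve. all: by end_near. Qed.

Lemma C2_partials_twice_cont_diff f : twice_cont_diff f -> compactly_supported f ->
  exists B, C2_partials f ('D_(1, 0) f) ('D_(0, 1) f)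
    ('D_(1, 0) ('D_(1, 0) f)) ('D_(0, 1) ('D_(0, 1) f)) B.
Proof.
move=> [[df cDf] C2f] cK.
pose K := closure [set x | f x != 0]; rewrite /compactly_supported -/K in cK.
have [M [_ hM]] := compact_bounded cK.
pose U := ~` K.
have oU : open U by apply: closed_openC; exact: closed_closure.
have f0 z : U z -> f z = 0.
  move=> Uz; apply/eqP; apply/negPn/negP => fz; apply: Uz.
  exact: subset_closure.
have D0 v := @derive_zero_on_open f U v oU f0.
have DD0 v w := @derive_zero_on_open ('D_v f) U w oU (D0 v).
(* Points of [K] have norm at most [|M| + 1], so those of norm at least [|M| + 2] lie in the open
   complement of [K], where all derivatives of [f] vanish too. *)
exists (`|M| + 2); split.
- by rewrite ltr_wpDl.
- by move=> x y; exact: is_derive_fst.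
- by move=> x y; apply: is_derive_fst; exact: (C2f _).1.
- by move=> x y; exact: is_derive_snd.
- by move=> x y; apply: is_derive_snd; exact: (C2f _).1.
- by move=> z; apply: differentiable_continuous.
- exact: (C2f _).2.
- exact: (C2f _).2.
- move=> z zB; have Uz : U z.
    move=> Kz; have := hM (`|M| + 1); rewrite ltr_pwDr ?ler_norm//.
    by move=> /(_ isT z Kz) h; have := le_trans zB h; rewrite lerD2l; lra.
  by split; [exact: f0|exact: D0|exact: D0|exact: DD0|exact: DD0].
Qed.

End twice_differentiable.

(** * Critical points and the logarithmic derivative *)

Section critical_point_formula.
Context {R : realType}.
Implicit Types (x : nat -> R[i]) (z w : R[i]).
Notation normc := (@Normc.normc R).

Lemma normc_ge0 z : 0 <= normc z.
Proof. by case: z => a b; exact: sqrtr_ge0. Qed.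

Lemma normc_gt0 z : z != 0 -> 0 < normc z.
Proof.
move=> z0; rewrite lt_neqAle normc_ge0 andbT eq_sym.
by apply: contra z0 => /eqP/Normc.eq0_normc ->.
Qed.

Lemma normc_natr n : normc n%:R = n%:R.
Proof.
have -> : (n%:R : R[i]) = Complex n%:R 0.
  by rewrite -(rmorph_nat (@real_complex R)).
by rewrite /= expr0n/= addr0 sqrtr_sqr ger0_norm.
Qed.

Lemma normc_sum (I : Type) (r : seq I) (F : I -> R[i]) :
  normc (\sum_(i <- r) F i) <= \sum_(i <- r) normc (F i).
Proof.
elim: r => [|a r IH]; first by rewrite !big_nil Normc.normc0.
by rewrite !big_cons (le_trans (le_normcD _ _))// lerD2l.
Qed.

Lemma ln_normc_prod (s : seq R[i]) z : z \notin s ->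
  ln (normc (\prod_(w <- s) (z - w))) = \sum_(w <- s) ln (normc (z - w)).
Proof.
elim: s => [|a s IH]; first by rewrite !big_nil Normc.normc1 ln1.
rewrite inE negb_or => /andP[za zs]; rewrite !big_cons Normc.normcM lnM ?IH//.
  by rewrite posrE normc_gt0// subr_eq0.
rewrite posrE normc_gt0//; apply/negP; rewrite prodf_seq_eq0 => /hasP[w ws /=].
by rewrite subr_eq0 => /eqP zw; rewrite zw ws in zs.
Qed.

Lemma horner_root_poly x n z : (root_poly x n).[z] = \prod_(i < n) (z - x i).
Proof. by rewrite horner_prod; apply: eq_bigr => i _; rewrite hornerXsubC. Qed.

Lemma horner_deriv_root_poly x n z : (forall i, (i < n)%N -> z != x i) ->
  (root_poly x n)^`().[z] = (root_poly x n).[z] * \sum_(i < n) (z - x i)^-1.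
Proof.
elim: n => [|n IH] zx; first by rewrite /root_poly !big_ord0 derivC horner0 mulr0.
have zn : z - x n != 0 by rewrite subr_eq0 zx.
have E : root_poly x n.+1 = root_poly x n * ('X - (x n)%:P).
  by rewrite /root_poly big_ord_recr.
rewrite E derivM derivXsubC mulr1 hornerD !hornerM IH; last first.
  by move=> i ni; apply: zx; rewrite ltnS ltnW.
by rewrite hornerXsubC big_ord_recr/= [RHS]mulrDr mulfK// mulrAC.
Qed.

(** In characteristic zero the top coefficient [n] of the derivative does not vanish, so it is the
    leading one. *)
Lemma deriv_root_polyE x n : (0 < n)%N -> (root_poly x n)^`() =
  n%:R *: \prod_(w <- critical_points x n) ('X - w%:P).
Proof.
case: n => // n _; set p := root_poly x n.+1.
have pm : p \is monic by exact: monic_prod_XsubC.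
have sp : size p = n.+2.
  by rewrite /p /root_poly size_prod_XsubC /index_enum -enumT size_enum_ord.
have cn : p^`()`_n = n.+1%:R.
  by rewrite coef_deriv; move/monicP : pm; rewrite /lead_coef sp/= => ->.
have s1 : (size p^`() <= n.+1)%N by rewrite -ltnS -sp lt_size_deriv// monic_neq0.
have s2 : (n < size p^`())%N.
  rewrite ltnNge; apply/negP => /(nth_default 0); rewrite cn => /eqP.
  by rewrite pnatr_eq0.
have sE : size p^`() = n.+1 by apply/eqP; rewrite eqn_leq s1 s2.
have lE : lead_coef p^`() = n.+1%:R by rewrite /lead_coef sE.
rewrite -lE; exact: (svalP (closed_field_poly_normal p^`())).
Qed.

Lemma ln_normc_deriv_root_poly x n z : (0 < n)%N -> z \notin critical_points x n ->
  ln (normc ((root_poly x n)^`().[z] / n%:R)) =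
  \sum_(w <- critical_points x n) ln (normc (z - w)).
Proof.
move=> n0 zs; rewrite deriv_root_polyE// hornerZ mulrC mulKf ?pnatr_eq0 -?lt0n//.
rewrite horner_prod -ln_normc_prod//; congr (ln (normc _)).
by apply: eq_bigr => w _; rewrite hornerXsubC.
Qed.

(** This is [p' = p * \sum (z - x_i)^-1] in logarithms; dividing by [n] makes [p'] monic, so that
    its logarithm is a sum over the critical points alone. The sum of inverses is nonzero because
    [p'] does not vanish at [z]. *)
Lemma log_derivative_formula x n z : (0 < n)%N ->
  (forall i, (i < n)%N -> z != x i) -> z \notin critical_points x n ->
  \sum_(i < n) (z - x i)^-1 != 0 /\
  \sum_(w <- critical_points x n) ln (normc (z - w)) -
    \sum_(i < n) ln (normc (z - x i)) =
  ln (normc (\sum_(i < n) (z - x i)^-1) / n%:R).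
Proof.
move=> n0 zx zs; have n0' : (0 : R) < n%:R by rewrite ltr0n.
have p0 : (root_poly x n).[z] != 0.
  by rewrite horner_root_poly; apply/prodf_neq0 => i _; rewrite subr_eq0 zx.
have q0 : \sum_(i < n) (z - x i)^-1 != 0.
  apply/negP => /eqP q0; have := horner_deriv_root_poly zx.
  rewrite q0 mulr0 deriv_root_polyE// hornerZ => /eqP.
  rewrite mulf_eq0 pnatr_eq0 (gtn_eqF n0)/= horner_prod prodf_seq_eq0.
  move=> /hasP[w ws /=]; rewrite hornerXsubC subr_eq0 => /eqP zw.
  by rewrite zw ws in zs.
split => //.
have <- : ln (normc ((root_poly x n)^`().[z] / n%:R)) =
    \sum_(w <- critical_points x n) ln (normc (z - w)).
  exact: ln_normc_deriv_root_poly.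
have <- : ln (normc (root_poly x n).[z]) = \sum_(i < n) ln (normc (z - x i)).
  rewrite horner_root_poly -(big_map (fun i : 'I_n => x i) xpredT (fun w => z - w)).
  rewrite ln_normc_prod ?big_map//.
  by apply/mapP => -[i _ zi]; have := zx i (ltn_ord i); rewrite zi eqxx.
rewrite horner_deriv_root_poly// -mulrA Normc.normcM lnM ?posrE ?normc_gt0//; last first.
  by rewrite mulf_neq0// invr_eq0 pnatr_eq0 -lt0n.
by rewrite addrAC subrr add0r Normc.normcM Normc.normcV normc_natr.
Qed.

(* If [1 + w * z] is not small, [ln] is bounded below there; otherwise [w] has
   size at least [1 / (2 * normc z)] and [1 + w * z = w * (z + w^-1)]. *)
Lemma ln_normc_inv_add z w : z != 0 -> z^-1 + w != 0 ->
  - ln (normc (z^-1 + w)) <= 1 + 3 * normc z + (normc (z + w^-1))^-1.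
Proof.
move=> z0 zw0.
have lnle (t : R) : 0 < t -> ln t <= t by move=> t0; exact/ltW/ln_sublinear.
have nz := normc_gt0 z0.
have zwE : z^-1 + w = (1 + w * z) / z by rewrite mulrDl mul1r mulfK.
have zw1 : 1 + w * z != 0.
  by apply: contra zw0 => /eqP h; rewrite zwE h mul0r.
have n1 := normc_gt0 zw1.
rewrite zwE Normc.normcM Normc.normcV lnM ?posrE ?invr_gt0// lnV ?posrE//.
have l1 := lnle _ nz.
have i0 : 0 <= (normc (z + w^-1))^-1 by rewrite invr_ge0 normc_ge0.
suff : - ln (normc (1 + w * z)) <= 1 + 2 * normc z + (normc (z + w^-1))^-1 by lra.
have [big|small] := leP (2^-1) (normc (1 + w * z)).
  have : ln (2^-1) <= ln (normc (1 + w * z)) by rewrite ler_ln ?posrE.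
  rewrite lnV ?posrE//; have : ln 2 <= 1 :> R.
    by have := @le_ln1Dx R 1; rewrite -[1 + 1]/(2 : R); apply; lra.
  have := ltW nz; lra.
have w0 : w != 0.
  apply/eqP => w0; move: small; rewrite w0 mul0r addr0 Normc.normc1; lra.
have nw := normc_gt0 w0.
have E : 1 + w * z = w * (z + w^-1) by rewrite mulrDr divff// addrC.
have zw2 : z + w^-1 != 0 by apply: contra zw1 => /eqP h; rewrite E h mulr0.
have n2 := normc_gt0 zw2.
rewrite E Normc.normcM lnM ?posrE//.
have l2 : - ln (normc (z + w^-1)) <= (normc (z + w^-1))^-1.
  by rewrite -lnV ?posrE//; apply: lnle; rewrite invr_gt0.
have : 1 <= normc (1 + w * z) + normc w * normc z.
  rewrite -Normc.normcM -{1}Normc.normc1 -(normcN (w * z)).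
  by apply: le_trans (le_normcD _ _); rewrite addrK.
move=> h; have hw : 2^-1 <= normc w * normc z by lra.
have : - ln (normc w) <= ln (2 * normc z).
  rewrite -lnV ?posrE// ler_ln ?posrE ?invr_gt0 ?mulr_gt0//.
  by rewrite -[leLHS]mul1r ler_pdivrMr//; lra.
have := lnle (2 * normc z) (mulr_gt0 (ltr0Sn R 1) nz).
by lra.
Qed.

End critical_point_formula.

(** * Independence and expectation *)

Section independence.
Context d d' (T : measurableType d) (T' : measurableType d') (R : realType).
Context (P : probability T R) (X : nat -> {RV P >-> T'}).
Hypothesis indX : mutually_independent X.
Variable n : nat.

(** A pi-system generating the sigma-algebra of the variables of index below [n]. The space [T] with
    that sigma-algebra, rather than a product of [n] copies of [T'], serves as the space of the
    past. *)
Definition past_cylinders : set (set T) := [set C | exists A : nat -> set T',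
  (forall i, measurable (A i)) /\ C = \bigcap_(i in `I_n) (X i @^-1` A i)].

Notation past := (g_sigma_algebraType past_cylinders).

Let mX i (A : set T') : measurable A -> measurable (X i @^-1` A).
Proof. by move=> mA; rewrite -[X in measurable X]setTI; exact: measurable_funPT. Qed.

Lemma past_cylinders_measurable : past_cylinders `<=` @measurable d T.
Proof.
move=> _ [A [mA ->]]; apply: bigcap_measurableType => i _.
exact: mX.
Qed.

Lemma past_measurable (B : set T) : @measurable _ past B -> @measurable d T B.
Proof. exact: (smallest_sub (@sigma_algebra_measurable _ T) past_cylinders_measurable). Qed.

Lemma measurable_past_id : measurable_fun [set: T] (idfun : T -> past).
Proof. by move=> _ B mB; rewrite setTI preimage_id; exact: past_measurable. Qed.

Lemma measurable_past i : (i < n)%N -> measurable_fun [set: past] (X i : past -> T').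
Proof.
move=> ltin _ B mB; rewrite setTI; apply: sub_sigma_algebra.
exists (fun j => if j == i then B else setT); split.
  by move=> j; case: ifP.
apply/seteqP; split => w /=.
  by move=> Bw j _ /=; case: eqP => // ->.
by move=> /(_ i ltin) /=; rewrite eqxx.
Qed.

Lemma setI_closed_past : setI_closed past_cylinders.
Proof.
move=> _ _ [A [mA ->]] [B [mB ->]]; exists (fun i => A i `&` B i); split.
  by move=> i; exact: measurableI.
by rewrite -bigcapI; apply: eq_bigcapr => i _; rewrite preimage_setI.
Qed.

Lemma indep_cylinder (A : nat -> set T') : (forall i, measurable (A i)) ->
  forall k, P (\bigcap_(i in `I_k) (X i @^-1` A i)) =
    (\prod_(0 <= i < k) P (X i @^-1` A i))%E.
Proof.
move=> mA k; have := @indX [fset i | i in iota 0 k]%fset A (fun i _ => mA i).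
have -> : [set` [fset i | i in iota 0 k]%fset] = `I_k.
  by apply/seteqP; split => i /=; rewrite !inE/= mem_iota add0n.
move=> ->; apply: perm_big; rewrite /index_iota subn0.
apply: uniq_perm; [exact: fset_uniq|exact: iota_uniq|].
by move=> i; rewrite !inE.
Qed.

(** For fixed [A] both sides are finite measures in [B]. They agree on the cylinders, which are
    stable under intersection and include the whole space. *)
Lemma indep_past (B : set T) (A : set T') : @measurable _ past B -> measurable A ->
  P (B `&` X n @^-1` A) = (P B * P (X n @^-1` A))%E.
Proof.
move=> mB mA.
have mXA := mX n mA.
pose r : {nonneg R} := NngNum (fine_ge0 (measure_ge0 P (X n @^-1` A))).
have rE : (r%:num%:E = P (X n @^-1` A))%E by rewrite /= fineK// fin_num_measure.
rewrite muleC -rE -[RHS]/(mscale r P B) -[LHS]/(mrestr P mXA B).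
apply: (@g_sigma_algebra_measure_unique _ _ _ past_cylinders
  past_cylinders_measurable (fun=> setT)) => //.
- move=> _; exists (fun=> setT); split => //.
  by apply/seteqP; split => w //= _ i _.
- by rewrite bigcup_const.
- exact: setI_closed_past.
- move=> _ [C [mC ->]].
  rewrite -[RHS]/(r%:num%:E * P _)%E rE muleC -[LHS]/(P (_ `&` X n @^-1` A)).
  pose C' i := if i == n then A else C i.
  have mC' i : measurable (C' i) by rewrite /C'; case: ifP.
  have -> : \bigcap_(i in `I_n) (X i @^-1` C i) = \bigcap_(i in `I_n) (X i @^-1` C' i).
    by apply: eq_bigcapr => i /= lin; rewrite /C' ltn_eqF.
  have -> : (\bigcap_(i in `I_n) (X i @^-1` C' i)) `&` X n @^-1` A =
      \bigcap_(i in `I_n.+1) (X i @^-1` C' i).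
    have C'n : C' n = A by rewrite /C' eqxx.
    apply/seteqP; split => w /=.
      move=> [Cw Aw] i /=; rewrite ltnS leq_eqVlt => /orP[/eqP ->|]; last exact: Cw.
      by rewrite C'n.
    move=> h; split; last by rewrite -C'n; exact: (h n (ltnSn n)).
    by move=> i /= lin; exact: (h i (ltnW lin)).
  by rewrite !indep_cylinder// big_nat_recr//= /C' eqxx.
- move=> k; rewrite -[ltLHS]/(P ([set: T] `&` X n @^-1` A)) setTI.
  by rewrite (le_lt_trans (probability_le1 P mXA))// ltry.
Qed.

Let id_mixin := isMeasurableFun.Build _ _ _ _ _ measurable_past_id.
Let id_past : {RV P >-> past} := HB.pack (idfun : T -> past) id_mixin.

Let pair_past_fun (w : T) : past * T' := (w, X n w).
Let mpair : measurable_fun [set: T] pair_past_fun.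
Proof. by apply: measurable_fun_pair; [exact: measurable_past_id|]. Qed.
Let pair_mixin := isMeasurableFun.Build _ _ _ _ _ mpair.
Let pair_past : {RV P >-> (past * T')%type} := HB.pack pair_past_fun pair_mixin.

Let Ppast : probability past R := distribution P id_past.
Let law : probability T' R := distribution P (X n).

Let joint (C : set (past * T')) : measurable C ->
  ((Ppast \x law) C = distribution P pair_past C)%E.
Proof.
apply: (@product_measure_unique _ _ _ _ _ Ppast law (distribution P pair_past)).
by move=> B A mB mA; exact: indep_past.
Qed.

Lemma indep_measurable (F : past * T' -> \bar R) :
  measurable_fun [set: past * T'] F -> (forall z, 0 <= F z)%E ->
  measurable_fun [set: T] (fun w => \int[P]_w' F (w, X n w'))%E.
Proof.
move=> mF F0.
have mG : measurable_fun [set: past] (fubini_F law F).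
  exact: measurable_fun_fubini_tonelli_F.
have := measurableT_comp mG measurable_past_id.
congr measurable_fun; apply/funext => w.
rewrite /= /fubini_F/= ge0_integral_distribution//.
exact: measurableT_comp.
Qed.

(** The past and [X n] jointly have a product law, so Tonelli freezes the past at [w] while [X n] is
    integrated out through a second sample point [w']. *)
Lemma indep_integral (F : past * T' -> \bar R) :
  measurable_fun [set: past * T'] F -> (forall z, 0 <= F z)%E ->
  (\int[P]_w F (w, X n w) = \int[P]_w \int[P]_w' F (w, X n w'))%E.
Proof.
move=> mF F0.
transitivity (\int[distribution P pair_past]_z F z)%E.
  by rewrite ge0_integral_distribution.
transitivity (\int[(Ppast \x law)]_z F z)%E.
  by apply: eq_measure_integral => C mC _; exact/esym/joint.
rewrite fubini_tonelli1//.
have mG : measurable_fun [set: past] (fubini_F law F).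
  exact: measurable_fun_fubini_tonelli_F.
rewrite (ge0_integral_distribution id_past mG); last first.
  by move=> w; exact: integral_ge0.
apply: eq_integral => w _.
rewrite /fubini_F/= ge0_integral_distribution//.
exact: measurableT_comp.
Qed.

End independence.

Section expectation.
Context d (T : measurableType d) (R : realType) (P : probability T R).
Implicit Types f g h : T -> R.

Definition Ex f : R := (\int[P]_x f x)%R.
Definition itg f : Prop := P.-integrable [set: T] (EFin \o f).

Lemma itg_measurable f : itg f -> measurable_fun [set: T] f.
Proof. by move=> /measurable_int /measurable_EFinP. Qed.

Lemma itgD f g : itg f -> itg g -> itg (fun x => f x + g x).
Proof. by move=> If Ig; exact: (integrableD measurableT If Ig). Qed.

Lemma itgZ k f : itg f -> itg (fun x => k * f x).
Proof. by move=> If; exact: (integrableZl measurableT k If). Qed.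

Lemma itgB f g : itg f -> itg g -> itg (fun x => f x - g x).
Proof. by move=> If Ig; exact: (integrableB measurableT If Ig). Qed.

Lemma itg_le f g : measurable_fun [set: T] f -> (forall x, `|f x| <= g x) ->
  itg g -> itg f.
Proof.
move=> mf fg Ig; apply: (le_integrable measurableT _ _ Ig); first exact/measurable_EFinP.
by move=> x _; rewrite lee_fin (le_trans (fg x))// ler_norm.
Qed.

Lemma itg_cst k : itg (fun=> k).
Proof. exact: finite_measure_integrable_cst. Qed.

Lemma itg_bounded f M : measurable_fun [set: T] f -> (forall x, `|f x| <= M) -> itg f.
Proof. by move=> mf fM; apply: (itg_le mf fM); exact: itg_cst. Qed.

Lemma ExD f g : itg f -> itg g -> Ex (fun x => f x + g x) = Ex f + Ex g.
Proof. by move=> If Ig; rewrite /Ex RintegralD. Qed.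

Lemma ExB f g : itg f -> itg g -> Ex (fun x => f x - g x) = Ex f - Ex g.
Proof. by move=> If Ig; rewrite /Ex RintegralB. Qed.

Lemma ExZ k f : itg f -> Ex (fun x => k * f x) = k * Ex f.
Proof. by move=> If; rewrite /Ex RintegralZl. Qed.

Lemma Ex_cst k : Ex (fun=> k) = k.
Proof.
rewrite /Ex Rintegral_cst// [X in fine X](_ : _ = 1%E) ?mulr1//.
exact: probability_setT.
Qed.

Lemma le_Ex f g : itg f -> itg g -> (forall x, f x <= g x) -> Ex f <= Ex g.
Proof. by move=> If Ig fg; apply: le_Rintegral. Qed.

Lemma abs_Ex f g : itg f -> itg g -> (forall x, `|f x| <= g x) -> `|Ex f| <= Ex g.
Proof.
move=> If Ig fg; apply: (le_trans (le_normr_Rintegral measurableT If)).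
apply: le_Rintegral => //.
by apply: (itg_le _ _ Ig) => [|x]; [exact/measurableT_comp/itg_measurable|rewrite normr_id].
Qed.

Lemma abs_Ex_le f M : measurable_fun [set: T] f -> (forall x, `|f x| <= M) -> `|Ex f| <= M.
Proof.
move=> mf fM; rewrite -[leRHS](Ex_cst M); apply: abs_Ex => //.
- exact: itg_bounded fM.
- exact: itg_cst.
Qed.

Lemma ExE f : itg f -> (\int[P]_x (f x)%:E = (Ex f)%:E)%E.
Proof.
by move=> If; rewrite /Ex /Rintegral fineK//; exact: integrable_fin_num.
Qed.

End expectation.

(** * Functions with a uniform Taylor expansion and their averages *)

Section taylor_class.
Context {R : realType}.
Implicit Types f g : R -> R.

Definition lipschitz_with (C : R) g := forall x t : R, `|g (x + t) - g x| <= C * `|t|.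

(* Bounded functions with a uniform second order Taylor expansion; unlike C^3
   regularity, this is visibly stable under averaging of translates. *)
Record taylor_class (C : R) g g1 g2 : Prop := TaylorClass {
  taylor_bound : forall x, [/\ `|g x| <= C, `|g1 x| <= C & `|g2 x| <= C] ;
  taylor_lip : [/\ lipschitz_with C g, lipschitz_with C g1 & lipschitz_with C g2] ;
  taylor_exp : forall x t,
    `|g (x + t) - g x - g1 x * t - g2 x * (t ^+ 2 / 2)| <= C * `|t| ^+ 3 }.

Lemma lipschitz_with_continuous C g : lipschitz_with C g -> continuous g.
Proof.
move=> lg x; apply/cvgrPdist_lt => e e0; near=> y.
have := lg x (y - x); rewrite addrCA subrr addr0 distrC => h.
apply: (le_lt_trans h); apply: (@le_lt_trans _ _ ((`|C| + 1) * `|y - x|)).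
  by rewrite ler_wpM2r// (le_trans (ler_norm _))// lerDl.
rewrite mulrC -ltr_pdivlMr ?ltr_wpDl// distrC.
near: y; apply/nbhs_ballP; exists (e / (`|C| + 1)); last by [].
by rewrite /= divr_gt0// ltr_wpDl.
Unshelve. all: by end_near. Qed.

Lemma lipschitz_with_measurable C g : lipschitz_with C g -> measurable_fun [set: R] g.
Proof. by move=> /lipschitz_with_continuous; exact: continuous_measurable_fun. Qed.

Context d (T : measurableType d) (P : probability T R) (Z : T -> R).
Hypothesis mZ : measurable_fun [set: T] Z.

Definition average g (x : R) : R := Ex P (fun w => g (x + Z w)).

Lemma measurable_translate C g x : lipschitz_with C g ->
  measurable_fun [set: T] (fun w => g (x + Z w)).
Proof.
move=> /lipschitz_with_measurable mg; apply: (measurableT_comp mg).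
exact: measurable_funD.
Qed.

Lemma itg_translate C g x : lipschitz_with C g -> (forall x, `|g x| <= C) ->
  itg P (fun w => g (x + Z w)).
Proof.
by move=> lg bg; apply: (@itg_bounded _ _ _ _ _ C) => //; exact: measurable_translate lg.
Qed.

Lemma average_bound C g : lipschitz_with C g -> (forall x, `|g x| <= C) ->
  forall x, `|average g x| <= C.
Proof. by move=> lg bg x; apply: abs_Ex_le => //; exact: measurable_translate lg. Qed.

Lemma average_lipschitz C g : lipschitz_with C g -> (forall x, `|g x| <= C) ->
  lipschitz_with C (average g).
Proof.
move=> lg bg x t; rewrite /average -ExB; [|exact: itg_translate..].
apply: abs_Ex_le; first by apply: measurable_funB; exact: measurable_translate lg.
by move=> w; rewrite addrAC.
Qed.

(** All the inequalities hold for each translate by [Z w] and survive integration in [w]. The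
    constant [C] does not grow, so averaging can be iterated. *)
Lemma average_taylor C g g1 g2 : taylor_class C g g1 g2 ->
  taylor_class C (average g) (average g1) (average g2).
Proof.
move=> [b [l l1 l2] e].
have b0 x : `|g x| <= C by case: (b x).
have b1 x : `|g1 x| <= C by case: (b x).
have b2 x : `|g2 x| <= C by case: (b x).
split.
- by move=> x; split; apply: average_bound.
- by split; apply: average_lipschitz.
move=> x t; rewrite /average.
rewrite -ExB; [|exact: itg_translate..].
rewrite !(mulrC (Ex _ _)) -ExZ; last exact: itg_translate.
rewrite -ExB; [|by apply: itgB; exact: itg_translate|by apply: itgZ; exact: itg_translate].
rewrite -ExZ; last exact: itg_translate.
rewrite -ExB; last 2 first.
- by apply: itgB; [apply: itgB|apply: itgZ]; exact: itg_translate.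
- by apply: itgZ; exact: itg_translate.
apply: abs_Ex_le.
  apply: measurable_funB; last first.
    by apply: measurable_funM => //; exact: measurable_translate l2.
  apply: measurable_funB; last first.
    by apply: measurable_funM => //; exact: measurable_translate l1.
  by apply: measurable_funB; exact: measurable_translate l.
move=> w; have := e (x + Z w) t.
by rewrite [x + t + Z w]addrAC [t * g1 _]mulrC [t ^+ 2 / 2 * _]mulrC.
Qed.

(** Up to third moments, the average sees only the mean and variance of [Z]: two centred variables
    of equal variance have nearly the same averages. *)
Lemma average_expansion C g g1 g2 (v2 K : R) x : taylor_class C g g1 g2 ->
  itg P (fun w => Z w ^+ 2) -> itg P (fun w => `|Z w| ^+ 3) ->
  Ex P Z = 0 -> Ex P (fun w => Z w ^+ 2) = v2 -> Ex P (fun w => `|Z w| ^+ 3) <= K ->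
  `|average g x - g x - g2 x * (v2 / 2)| <= C * K.
Proof.
move=> [b [l l1 l2] e] I2 I3 E1 E2 E3.
have b0 y : `|g y| <= C by case: (b y).
have C0 : 0 <= C by exact: le_trans (normr_ge0 _) (b0 0).
have I1 : itg P Z.
  apply: (@itg_le _ _ _ _ _ (fun w => 1 + Z w ^+ 2)) => //; last first.
    by apply: itgD => //; exact: itg_cst.
  move=> w; rewrite -[Z w ^+ 2]real_normK ?num_real//.
  by have := normr_ge0 (Z w); nra.
have Ig := itg_translate x l b0.
have Ic := itg_cst P (g x).
have J1 : itg P (fun w => g1 x * Z w) by exact: itgZ.
have J2 : itg P (fun w => (g2 x / 2) * Z w ^+ 2) by exact: itgZ.
have -> : average g x - g x - g2 x * (v2 / 2) =
    Ex P (fun w => g (x + Z w) - g x - g1 x * Z w - (g2 x / 2) * Z w ^+ 2).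
  rewrite ExB; [|by apply: itgB => //; apply: itgB|by []].
  rewrite ExB; [|by apply: itgB|by []].
  rewrite ExB// Ex_cst ExZ// ExZ// E1 E2 /average; ring.
apply: (@le_trans _ _ (Ex P (fun w => C * `|Z w| ^+ 3))).
  apply: abs_Ex.
  - by apply: itgB => //; apply: itgB => //; apply: itgB.
  - exact: itgZ.
  move=> w; apply: le_trans (e x (Z w)); rewrite le_eqVlt; apply/orP; left.
  by apply/eqP; congr (`|_|); field.
by rewrite ExZ// ler_wpM2l.
Qed.

End taylor_class.

(** * Gaussian laws and Lindeberg replacement *)

Lemma ge0_integral_affine (R : realType) (e : R) (e0 : 0 < e) (a : R)
    (F : R -> \bar R) : measurable_fun [set: R] F -> (forall x, (0 <= F x)%E) ->
  (\int[lebesgue_measure]_x F x =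
   e%:E * \int[lebesgue_measure]_x F (a + e * x)%R)%E.
Proof.
move=> mF F0.
pose h : measurableTypeR R -> measurableTypeR R := fun x => a + e * x.
have mh : measurable_fun [set: measurableTypeR R] h.
  by apply: measurable_funD => //; exact: mulrl_measurable.
pose en : {nonneg R} := NngNum (ltW e0).
transitivity (\int[mscale en (pushforward_measure lebesgue_measure mh)]_x F x)%E.
  by apply: eq_measure_integral => A mA _; exact: (lebesgue_measure_affine e0 a mA).
rewrite (@ge0_integral_mscale _ _ R (pushforward_measure lebesgue_measure mh) _
  measurableT en F mF (fun z _ => F0 z)).
exact: (congr1 (fun t => e%:E * t)%E
  (@ge0_integral_pushforward _ _ _ _ _ _ mh lebesgue_measure _ F measurableT mF
    (fun z _ => F0 z))).
Qed.

Section density.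
Context d (T : measurableType d) (R : realType) (mu nu : {measure set T -> \bar R}).
Variable (p : T -> R).
Hypotheses (mp : measurable_fun [set: T] p) (p0 : forall x, 0 <= p x).
Hypothesis nuE : forall A, measurable A -> nu A = (\int[mu]_(x in A) (p x)%:E)%E.

Import HBNNSimple.

Let sfun_density (g : {nnsfun T >-> R}) :
  (\int[nu]_x (g x)%:E = \int[mu]_x ((g x)%:E * (p x)%:E))%E.
Proof.
have E x : (g x)%:E = (\sum_(r \in range g) (r * \1_(g @^-1` [set r]) x)%:E)%E.
  by rewrite fsumEFin// -fimfunE.
have ge (r : R) x : 0 <= r * \1_(g @^-1` [set r]) x.
  rewrite indicE; have [|_] := boolP (x \in _); last by rewrite mulr0.
  by rewrite inE/= mulr1 => <-.
transitivity (\sum_(r \in range g) r%:E * nu (g @^-1` [set r]))%E.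
  under eq_integral do rewrite E.
  rewrite ge0_integral_fsum//.
  - apply: eq_fsbigr => r _.
    rewrite (integralZl_indic _ (fun r => g @^-1` [set r]))//.
      by rewrite integral_indic// setIT.
    by move=> r0; rewrite preimage_nnfun0.
  - by move=> r; apply/measurable_EFinP; apply: measurable_funM.
  - by move=> r x _; rewrite lee_fin.
have Ep x : ((g x)%:E * (p x)%:E =
    \sum_(r \in range g) (r * \1_(g @^-1` [set r]) x)%:E * (p x)%:E)%E.
  by rewrite E ge0_mule_fsuml// => r; rewrite lee_fin.
under [RHS]eq_integral do rewrite Ep.
rewrite ge0_integral_fsum//; last 2 first.
- move=> r; apply: emeasurable_funM; last exact/measurable_EFinP.
  by apply/measurable_EFinP; apply: measurable_funM.
- by move=> r x _; rewrite mule_ge0// lee_fin.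
apply: eq_fsbigr => r /set_mem[y _ gy].
have r0 : 0 <= r by rewrite -gy.
have mr : measurable (g @^-1` [set r]) by exact: measurable_funPTI.
under [RHS]eq_integral do rewrite EFinM -muleA.
rewrite ge0_integralZl//; last 2 first.
- by apply: emeasurable_funM; apply/measurable_EFinP.
- by move=> x _; rewrite mule_ge0// lee_fin.
congr (_ * _)%E; rewrite nuE// integral_mkcond; apply: eq_integral => x _.
by rewrite patchE indicE; case: ifP => _; rewrite ?mul1e ?mul0e.
Qed.

Lemma ge0_integral_density (f : T -> \bar R) : measurable_fun [set: T] f ->
  (forall x, (0 <= f x)%E) ->
  (\int[nu]_x f x = \int[mu]_x (f x * (p x)%:E))%E.
Proof.
move=> mf f0; pose f_ := nnsfun_approx measurableT mf.
transitivity (limn (fun n => \int[nu]_x (f_ n x)%:E))%E.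
  rewrite -monotone_convergence//.
  - apply: eq_integral => x _; apply/esym/cvg_lim => //.
    by apply: cvg_nnsfun_approx.
  - by move=> n; exact/measurable_EFinP.
  - by move=> n x _; rewrite lee_fin.
  - by move=> x _ m n mn; rewrite lee_fin; exact/lefP/nd_nnsfun_approx.
under eq_fun do rewrite sfun_density.
rewrite -monotone_convergence//.
- apply: eq_integral => x _; apply/cvg_lim => //.
  apply: cvgeZr; first by [].
  by apply: cvg_nnsfun_approx.
- by move=> n; apply: emeasurable_funM; exact/measurable_EFinP.
- by move=> n x _; rewrite mule_ge0// lee_fin.
- move=> x _ m n mn; rewrite lee_wpmul2r ?lee_fin//.
  exact/lefP/nd_nnsfun_approx.
Qed.

End density.

Section standard_gaussian.
Context {R : realType}.
Notation mu := (@lebesgue_measure R).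
Notation TR := (measurableTypeR R).

(* Limit laws are written as images of [gauss] under [z |-> v * z], which
   includes the degenerate case [v = 0]. *)
Definition gauss : probability (measurableTypeR R) R := normal_prob 0 1.
Notation n := (@normal_pdf R 0 1).

Let mn : measurable_fun [set: TR] n. Proof. exact: measurable_normal_pdf. Qed.
Let n0 x : 0 <= n x. Proof. exact: normal_pdf_ge0. Qed.

Lemma ge0_integral_gauss (f : TR -> \bar R) : measurable_fun [set: TR] f ->
  (forall x, (0 <= f x)%E) ->
  (\int[gauss]_x f x = \int[mu]_x (f x * (n x)%:E))%E.
Proof. by move=> mf f0; exact: (ge0_integral_density mn n0). Qed.

Lemma normal_pdf_expR (m s x : R) : s != 0 ->
  normal_pdf m s x = normal_peak s * expR (- (x - m) ^+ 2 / (s ^+ 2 *+ 2)).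
Proof. by move=> s0; rewrite normal_pdfE. Qed.

Let nE x : n x = normal_peak 1 * expR (- x ^+ 2 / 2).
Proof. by rewrite normal_pdf_expR ?oner_neq0// subr0 expr1n. Qed.

Let dn (x : R) : is_derive x 1 n (- x * n x).
Proof.
have -> : n = fun x => normal_peak 1 * expR (- x ^+ 2 / 2) by apply/funext.
pose q (x : R) := - x ^+ 2 / 2.
have dq : is_derive x 1 q (- x).
  by apply: is_derive_eq; rewrite /GRing.scale/=; field.
have de := is_derive1_comp (is_derive_expR (q x)) dq.
apply: (is_derive_eq (is_deriveZ (normal_peak 1) de)).
by rewrite /q /GRing.scale/=; ring.
Qed.

(** Squaring [1 + x^2 / 8 <= exp (x^2 / 8)] gives [x^4 <= 64 exp (x^2 / 4)]; one more multiple of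
    the exponential covers the 1. *)
Lemma pow4_le_expR (x : R) : 1 + x ^+ 4 <= 65 * expR (x ^+ 2 / 4).
Proof.
have h : 1 + x ^+ 2 / 8 <= expR (x ^+ 2 / 8) by exact: expR_ge1Dx.
have -> : x ^+ 2 / 4 = x ^+ 2 / 8 + x ^+ 2 / 8 by field.
rewrite expRD; have x20 := sqr_ge0 x.
have -> : x ^+ 4 = x ^+ 2 * x ^+ 2 by rewrite -exprD.
have h2 : (1 + x ^+ 2 / 8) * (1 + x ^+ 2 / 8) <= expR (x ^+ 2 / 8) * expR (x ^+ 2 / 8).
  by apply: ler_pM => //; lra.
by nra.
Qed.

Lemma integrable_normal_pdf_pow4 : mu.-integrable [set: TR]
  (EFin \o (fun x => (1 + x ^+ 4) * n x)).
Proof.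
have s2 : Num.sqrt 2 != 0 :> R by rewrite gt_eqF// sqrtr_gt0.
(* Half of the Gaussian exponent absorbs the polynomial; what remains is proportional to the density
   of variance 2. *)
pose c : R := 65 * normal_peak 1 / normal_peak (Num.sqrt 2).
apply: (@le_integrable _ _ _ mu _ measurableT _
  (fun x => c%:E * (normal_pdf 0 (Num.sqrt 2) x)%:E)%E).
- apply/measurable_EFinP; apply: measurable_funM => //.
  by apply: measurable_funD => //; exact: exprn_measurable.
- move=> x _; rewrite -EFinM /= lee_fin.
  have p1 : 0 < normal_peak 1 :> R by rewrite normal_peak_gt0// oner_neq0.
  have p2 : 0 < normal_peak (Num.sqrt 2) :> R by rewrite normal_peak_gt0.
  have x4 : 0 <= 1 + x ^+ 4 by rewrite addr_ge0// exprn_even_ge0.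
  rewrite ger0_norm ?mulr_ge0//.
  rewrite ger0_norm ?mulr_ge0 ?normal_pdf_ge0 ?invr_ge0//; try exact: ltW.
  rewrite nE (normal_pdf_expR _ _ s2) sqr_sqrtr// subr0 /c.
  have -> : 65 * normal_peak 1 / normal_peak (Num.sqrt 2) *
      (normal_peak (Num.sqrt 2) * expR (- x ^+ 2 / (2 *+ 2))) =
      normal_peak 1 * (65 * expR (x ^+ 2 / 4) * expR (- x ^+ 2 / 2)).
    rewrite -[X in _ = _ * X]mulrA -expRD.
    have -> : x ^+ 2 / 4 + - x ^+ 2 / 2 = - x ^+ 2 / (2 *+ 2).
      by rewrite mulr2n; field.
    by field; exact: lt0r_neq0.
  rewrite [leLHS]mulrCA ler_wpM2l ?(ltW p1)//.
  by rewrite ler_wpM2r ?expR_ge0//; exact: pow4_le_expR.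
- by apply: integrableZl => //; exact: integrable_normal_pdf.
Qed.

Lemma itg_gauss (f : TR -> R) (K : R) : measurable_fun [set: TR] f ->
  (forall x, `|f x| <= K * (1 + x ^+ 4)) -> itg gauss f.
Proof.
move=> mf fK.
have K0 : 0 <= K by have := le_trans (normr_ge0 _) (fK 0); rewrite expr0n/= addr0 mulr1.
apply: (itg_le mf fK); apply: itgZ.
apply/integrableP; split.
  by apply/measurable_EFinP; apply: measurable_funD => //; exact: exprn_measurable.
rewrite (ge0_integral_gauss (f := fun x => `|(1 + x ^+ 4)%:E|%E))//; last first.
  apply/measurable_EFinP; apply: measurableT_comp => //.
  by apply: measurable_funD => //; exact: exprn_measurable.
have /integrableP[_] := integrable_normal_pdf_pow4.
congr (_ < _)%E; apply: eq_integral => x _.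
by rewrite /= -EFinM normrM (ger0_norm (n0 x)).
Qed.

(** Dominated convergence along symmetric intervals. Asking only for the limit of the symmetric
    difference of [F] lets parity simplify the boundary terms. *)
Lemma integral_FTC_limit (f F : R -> R) (l : R) :
  mu.-integrable [set: R] (EFin \o f) -> continuous f ->
  (forall x : R, is_derive x 1 F (f x)) ->
  (F k.+1%:R - F (- k.+1%:R)) @[k --> \oo] --> l ->
  (\int[mu]_x (f x)%:E = l%:E)%E.
Proof.
move=> If cf dF Fl.
have mf : measurable_fun [set: TR] (EFin \o f).
  by apply/measurable_EFinP; exact: continuous_measurable_fun.
pose I k : set R := `[- k.+1%:R, k.+1%:R]%classic.
pose u k : R -> \bar R := (EFin \o f) \_ (I k).
have mu_ k : measurable_fun [set: TR] (u k).
  apply/(measurable_restrictT _ _).1; first exact: measurable_itv.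
  exact: measurable_funTS.
have uf : {ae mu, forall x, [set: R] x -> u k x @[k --> \oo] --> (EFin \o f) x}.
  apply: aeW => x _; apply: cvg_near_cst; near=> k.
  rewrite /u patchE ifT// inE /I/= in_itv/= -ler_norml.
  apply: (@le_trans _ _ k%:R); last by rewrite ler_nat.
  by near: k; exact: nbhs_infty_ger.
have ub : {ae mu, forall x k, [set: R] x -> (`|u k x| <= `|(EFin \o f) x|)%E}.
  by apply: aeW => x k _; rewrite /u patchE; case: ifP => // _; rewrite abse0.
have Ia : mu.-integrable [set: R] (fun x => `|(EFin \o f) x|%E).
  exact: integrable_abse.
have [_ _] := dominated_convergence measurableT mu_ mf uf Ia ub.
move=> cu; apply: (cvg_unique _ cu) => //.
have -> : [sequence (\int[mu]_x u k x)%E]_k = EFin \o (fun k => F k.+1%:R - F (- k.+1%:R)).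
  apply/funext => k /=; rewrite /u -integral_mkcond.
  rewrite (@continuous_FTC2 _ _ F).
  - by rewrite EFinB.
  - have : (0 : R) < k.+1%:R by []. lra.
  - exact: continuous_subspaceT.
  - have cF := is_derive_continuous dF; split.
    + by move=> x _; exact: (@ex_derive _ _ _ _ _ _ _ (dF x)).
    + by apply: cvg_at_right_filter; exact: cF.
    + by apply: cvg_at_left_filter; exact: cF.
  - by move=> x _; rewrite derive1E; exact: (@derive_val _ _ _ _ _ _ _ (dF x)).
apply: cvg_EFin; [exact: nearW|exact: Fl].
Unshelve. all: by end_near. Qed.

Let n_sym x : n (- x) = n x. Proof. by rewrite !nE sqrrN. Qed.

Lemma integrable_mul_normal_pdf (f : R -> R) (K : R) : measurable_fun [set: TR] f ->
  (forall x, `|f x| <= K * (1 + x ^+ 4)) ->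
  mu.-integrable [set: TR] (EFin \o (fun x => f x * n x)).
Proof.
move=> mf fK.
have K0 : 0 <= K by have := le_trans (normr_ge0 _) (fK 0); rewrite expr0n/= addr0 mulr1.
apply: (@le_integrable _ _ _ mu _ measurableT _
  (fun x => K%:E * ((1 + x ^+ 4) * n x)%:E)%E).
- by apply/measurable_EFinP; exact: measurable_funM.
- move=> x _; rewrite -EFinM /= lee_fin mulrA normrM (ger0_norm (n0 x)).
  by rewrite (le_trans (ler_wpM2r (n0 x) (fK x)))// ler_norm.
- exact: (integrableZl measurableT K integrable_normal_pdf_pow4).
Qed.

Let pow_bound (x : R) : [/\ `|x| <= 1 + x ^+ 4, x ^+ 2 <= 1 + x ^+ 4 &
  `|x| ^+ 3 <= 1 + x ^+ 4].
Proof.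
have -> : x ^+ 4 = `|x| ^+ 4 by rewrite -normrX ger0_norm// exprn_even_ge0.
have -> : x ^+ 2 = `|x| ^+ 2 by rewrite real_normK ?num_real.
have t0 := normr_ge0 x; set t := `|x| in t0 *.
have t4 : t ^+ 4 = t ^+ 2 * t ^+ 2 by rewrite -exprD.
have t3 : t ^+ 3 = t ^+ 2 * t by rewrite exprSr.
have := sqr_ge0 (t ^+ 2 - 1); have := sqr_ge0 (t - 1); have := sqr_ge0 (t ^+ 2 - t).
rewrite t4 t3 !sqrrB !mulr1 !expr1n.
by split; nra.
Qed.

(** From [1 + x^2 / 2 <= exp (x^2 / 2)] the boundary term is [O(1 / x)]. *)
Let cvg_tail : (- (2 * k.+1%:R * n k.+1%:R)) @[k --> \oo] --> (0 : R).
Proof.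
have p0 : 0 <= normal_peak 1 :> R by exact: normal_peak_ge0.
suff : (2 * k.+1%:R * n k.+1%:R) @[k --> \oo] --> (0 : R).
  by move=> /cvgN; rewrite oppr0.
apply: (@squeeze_cvgr _ _ _ _ (fun=> 0) (fun k => (4 * normal_peak 1) * k.+1%:R^-1)).
- near=> k; rewrite !mulr_ge0// nE /=.
  have k0 : (0 : R) < k.+1%:R by [].
  set x : R := k.+1%:R in k0 *.
  have h : 1 + x ^+ 2 / 2 <= expR (x ^+ 2 / 2) by exact: expR_ge1Dx.
  rewrite mulNr expRN.
  have e0 := expR_gt0 (x ^+ 2 / 2).
  rewrite mulrA ler_pdivrMr// [leRHS]mulrAC ler_pdivlMr//.
  have : 2 * x * normal_peak 1 * x <= 4 * normal_peak 1 * (1 + x ^+ 2 / 2).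
    by rewrite expr2; nra.
  move=> /le_trans; apply; rewrite ler_wpM2l// mulr_ge0//.
- exact: cvg_cst.
- rewrite -[X in _ --> X](mulr0 (4 * normal_peak 1)).
  by apply: cvgMr; exact: cvg_harmonic.
Unshelve. all: by end_near. Qed.

(** The shift delivers both moments from nonnegative integrands: [a = 0] gives the variance, and
    expanding the square at [a = 1] then gives the mean. *)
Lemma integral_gauss_sqr (a : R) :
  (\int[gauss]_y ((a + y) ^+ 2)%:E = (a ^+ 2 + 1)%:E)%E.
Proof.
have maf : measurable_fun [set: TR] (fun y : TR => (a + y) ^+ 2).
  by apply: measurable_funX; exact: measurable_funD.
rewrite ge0_integral_gauss//; last 2 first.
- exact/measurable_EFinP.
- by move=> y; rewrite lee_fin sqr_ge0.
pose f y := ((a + y) ^+ 2 - (a ^+ 2 + 1)) * n y.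
have iN : mu.-integrable [set: TR] (EFin \o (fun y => (a ^+ 2 + 1) * n y)).
  apply: (@integrable_mul_normal_pdf (fun=> a ^+ 2 + 1) (a ^+ 2 + 1)) => // x.
  have := sqr_ge0 a => a2; rewrite ger0_norm ?addr_ge0// ler_peMr ?addr_ge0// lerDl.
  by rewrite exprn_even_ge0.
have iS : mu.-integrable [set: TR] (EFin \o (fun y => (a + y) ^+ 2 * n y)).
  apply: (@integrable_mul_normal_pdf (fun y => (a + y) ^+ 2) (2 * a ^+ 2 + 2)) => // x.
  have [_ h _] := pow_bound x; rewrite ger0_norm ?sqr_ge0//.
  have := sqr_ge0 (a - x); have := sqr_ge0 a; have : 0 <= x ^+ 4 by rewrite exprn_even_ge0.
  by rewrite sqrrB sqrrD; nra.
have E0 : (\int[mu]_y (f y)%:E = 0%:E)%E.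
  (* Since [n' = - y n], this is a primitive of [f]; as [n] is even, the terms in [a] cancel between
     opposite end points. *)
  apply: (@integral_FTC_limit f (fun y => - (y + 2 * a) * n y)).
  - have -> : EFin \o f = (fun y => ((a + y) ^+ 2 * n y)%:E - ((a ^+ 2 + 1) * n y)%:E)%E.
      by apply/funext => y /=; rewrite -EFinB -mulrBl.
    exact: integrableB.
  - have cn : continuous n by apply: continuous_normal_pdf; rewrite oner_neq0.
    move=> x; apply: cvgM; last exact: cn.
    apply: cvgB; last exact: cvg_cst.
    apply: (cvg_comp (fun t => a + t) (fun t => t ^+ 2)); last exact: sqr_continuous.
    by apply: cvgD; [exact: cvg_cst|exact: cvg_id].
  - move=> x; have dl : is_derive x 1 (fun y : R => - (y + 2 * a)) (-1).
      by apply: is_derive_eq; rewrite /GRing.scale/=; ring.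
    apply: (is_derive_eq (is_deriveM dl (dn x))).
    by rewrite /f /GRing.scale/=; ring.
  - under eq_fun => k.
      rewrite n_sym (_ : _ - _ = - (2 * k.+1%:R * n k.+1%:R)); last by ring.
      over.
    exact: cvg_tail.
have -> : (\int[mu]_x (((a + x) ^+ 2)%:E * (n x)%:E) =
    \int[mu]_x ((f x)%:E + ((a ^+ 2 + 1) * n x)%:E))%E.
  by apply: eq_integral => x _; rewrite -EFinM -EFinD /f -mulrDl subrK.
rewrite integralD//=; last first.
  have -> : (fun x => (f x)%:E) = (fun y => ((a + y) ^+ 2 * n y)%:E - ((a ^+ 2 + 1) * n y)%:E)%E.
    by apply/funext => y /=; rewrite -EFinB -mulrBl.
  exact: integrableB.
rewrite E0 add0e; under eq_integral do rewrite EFinM.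
rewrite integralZl//; last exact: integrable_normal_pdf.
by rewrite integral_normal_pdf mule1.
Qed.

Lemma itg_gauss_id : itg gauss idfun.
Proof.
apply: (@itg_gauss _ 1) => [|x]; first exact: measurable_id.
by rewrite mul1r; case: (pow_bound x).
Qed.

Lemma itg_gauss_sqr : itg gauss (fun x => x ^+ 2).
Proof.
apply: (@itg_gauss _ 1) => [|x]; first exact: exprn_measurable.
by rewrite mul1r ger0_norm ?sqr_ge0//; case: (pow_bound x).
Qed.

Lemma itg_gauss_cube : itg gauss (fun x => `|x| ^+ 3).
Proof.
apply: (@itg_gauss _ 1) => [|x].
  by apply: measurable_funX; exact: normr_measurable.
by rewrite mul1r ger0_norm ?exprn_ge0//; case: (pow_bound x).
Qed.

Lemma Ex_gauss_sqr : Ex gauss (fun x => x ^+ 2) = 1.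
Proof.
have := integral_gauss_sqr 0; under eq_integral do rewrite add0r.
by rewrite (ExE itg_gauss_sqr) expr0n/= add0r => -[].
Qed.

Lemma Ex_gauss_id : Ex gauss idfun = 0.
Proof.
have i1 := itg_gauss_id; have i2 := itg_gauss_sqr.
have ic := itg_cst gauss (1 : R).
have E : (fun y : TR => (1 + y) ^+ 2) = (fun y => (1 + 2 * idfun y) + y ^+ 2).
  by apply/funext => y; rewrite sqrrD expr1n mul1r mulr_natl.
have i12 : itg gauss (fun y => 1 + 2 * idfun y) by apply: itgD => //; exact: itgZ.
have I : itg gauss (fun y : TR => (1 + y) ^+ 2).
  by rewrite E; exact: itgD.
have := integral_gauss_sqr 1; rewrite (ExE I) E ExD// ExD//; last exact: itgZ.
by rewrite Ex_cst ExZ// Ex_gauss_sqr expr1n => -[]; lra.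
Qed.

End standard_gaussian.

(** * Stability of the Gaussian law under convolution *)

Section gaussian_convolution.
Context {R : realType}.
Notation mu := (@lebesgue_measure R).
Notation TR := (measurableTypeR R).
Notation n := (@normal_pdf R 0 1).

Let n0 x : 0 <= n x. Proof. exact: normal_pdf_ge0. Qed.
Let mn : measurable_fun [set: TR] n. Proof. exact: measurable_normal_pdf. Qed.

Lemma normal_peak_scale (s : R) : 0 < s -> normal_peak s = s^-1 * normal_peak 1.
Proof.
move=> s0; rewrite /normal_peak expr1n mul1r -mulrnAr sqrtrM ?sqr_ge0//.
by rewrite sqrtr_sqr gtr0_norm// invfM.
Qed.

Lemma normal_pdf_scale (s x : R) : 0 < s -> s * normal_pdf 0 s (s * x) = n x.
Proof.
move=> s0; have s0' := lt0r_neq0 s0.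
rewrite !normal_pdf_expR ?oner_neq0// !subr0 (normal_peak_scale s0) mulrA mulrA divff// mul1r.
congr (_ * expR _); rewrite exprMn expr1n !mulr2n; field.
by rewrite -mulr2n mulrn_eq0/= expf_neq0.
Qed.

(** Completing the square in [z]: the joint density of [y = u - b z] and [z] factors into the
    density of [u], of variance [1 + b^2], and the conditional density of [z] given [u]. *)
Lemma normal_pdf_mul (b u z : R) : let c := Num.sqrt (1 + b ^+ 2) in
  n z * n (u - b * z) = normal_pdf 0 c u * normal_pdf (b * u / c ^+ 2) c^-1 z.
Proof.
move=> c; have b0 : 0 < 1 + b ^+ 2 by rewrite ltr_pwDl// sqr_ge0.
have c0 : 0 < c by rewrite sqrtr_gt0.
have c0' := lt0r_neq0 c0.
have cE : c ^+ 2 = 1 + b ^+ 2 by rewrite sqr_sqrtr// ltW.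
have ci0 : 0 < c^-1 by rewrite invr_gt0.
rewrite !normal_pdf_expR ?oner_neq0 ?invr_eq0// (normal_peak_scale c0) (normal_peak_scale ci0).
rewrite invrK !subr0 expr1n.
rewrite mulrACA -expRD [RHS]mulrACA -expRD; congr (_ * expR _).
  by rewrite mulrACA mulVf// mul1r.
rewrite !mulr2n exprVn cE; field.
by rewrite -mulr2n mulrn_eq0/= lt0r_neq0.
Qed.

(** After the substitution [u = y + b z] and an exchange of integrals, the inner integral is that of
    a conditional density in [z], which has mass 1. *)
Lemma gauss_convolution (F : R -> \bar R) (b : R) : measurable_fun [set: TR] F ->
  (forall x, (0 <= F x)%E) ->
  (\int[gauss]_y \int[gauss]_z F (y + b * z)%R =
   \int[gauss]_z F (Num.sqrt (1 + b ^+ 2) * z)%R)%E.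
Proof.
move=> mF F0; pose c := Num.sqrt (1 + b ^+ 2).
have c0 : 0 < c by rewrite sqrtr_gt0 ltr_pwDl// sqr_ge0.
have mlin : measurable_fun [set: TR * TR] (fun yz : TR * TR => yz.1 + b * yz.2 : TR).
  by apply: measurable_funD => //; exact: measurable_funM.
have mFl : measurable_fun [set: TR * TR] (fun yz : TR * TR => F (yz.1 + b * yz.2)).
  exact: (measurableT_comp mF mlin).
have mFly y : measurable_fun [set: TR] (fun z : TR => F (y + b * z)).
  by apply: (measurableT_comp mF); apply: measurable_funD => //; exact: measurable_funM.
have mn1 : measurable_fun [set: TR * TR] (fun yz : TR * TR => n yz.1).
  exact: (measurableT_comp mn measurable_fst).
have mn2 : measurable_fun [set: TR * TR] (fun yz : TR * TR => n yz.2).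
  exact: (measurableT_comp mn measurable_snd).
rewrite ge0_integral_gauss; last 2 first.
- exact: (@measurable_fun_fubini_tonelli_F _ _ TR TR R (@gauss R)
    (fun yz => F (yz.1 + b * yz.2)) mFl (fun yz => F0 _)).
- by move=> y; exact: integral_ge0.
pose G (y z : TR) : \bar R := (F (y + b * z)%R * (n z * n y)%:E)%E.
have G0 y z : (0 <= G y z)%E by rewrite mule_ge0// lee_fin mulr_ge0.
have mG : measurable_fun [set: TR * TR] (fun yz : TR * TR => G yz.1 yz.2).
  apply: emeasurable_funM => //; apply/measurable_EFinP.
  exact: measurable_funM.
transitivity (\int[mu]_y \int[mu]_z G y z)%E.
  apply: eq_integral => y _; rewrite ge0_integral_gauss//.
  rewrite -ge0_integralZr//; last 3 first.
  - by apply: emeasurable_funM => //; exact/measurable_EFinP.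
  - by move=> z _; rewrite mule_ge0// lee_fin.
  - by rewrite lee_fin.
  by apply: eq_integral => z _; rewrite /G EFinM muleA.
have tonelli (H : TR -> TR -> \bar R) :
    measurable_fun [set: TR * TR] (fun yz : TR * TR => H yz.1 yz.2) ->
    (forall y z, (0 <= H y z)%E) ->
    (\int[mu]_y \int[mu]_z H y z = \int[mu]_z \int[mu]_y H y z)%E.
  move=> mH H0.
  exact: (@fubini_tonelli _ _ TR TR R mu mu (fun yz => H yz.1 yz.2) mH (fun yz => H0 _ _)).
rewrite (tonelli _ mG G0).
pose K (u z : TR) : \bar R := (F u * (n z * n (u - b * z))%:E)%E.
have K0 u z : (0 <= K u z)%E by rewrite mule_ge0// lee_fin mulr_ge0.
have mlin' : measurable_fun [set: TR * TR] (fun yz : TR * TR => yz.1 - b * yz.2 : TR).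
  by apply: measurable_funB => //; exact: measurable_funM.
have mK : measurable_fun [set: TR * TR] (fun yz : TR * TR => K yz.1 yz.2).
  apply: emeasurable_funM; first exact: (measurableT_comp mF measurable_fst).
  apply/measurable_EFinP; apply: measurable_funM => //.
  exact: (measurableT_comp mn mlin').
transitivity (\int[mu]_z \int[mu]_u K u z)%E.
  apply: eq_integral => z _.
  have mGz : measurable_fun [set: TR] (G ^~ z).
    apply: emeasurable_funM; last first.
      by apply/measurable_EFinP; apply: measurable_funM.
    by apply: (measurableT_comp mF); exact: measurable_funD.
  rewrite (ge0_integral_affine (ltr01 : (0 : R) < 1) (- (b * z)) mGz)// mul1e.
  apply: eq_integral => u _; rewrite /G /K mul1r (addrC _ u) addrNK.
  by rewrite [u - _]addrC.
rewrite -(tonelli _ mK K0).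
transitivity (\int[mu]_u (F u * (normal_pdf 0 c u)%:E))%E.
  apply: eq_integral => u _; rewrite /K.
  rewrite ge0_integralZl//; last 2 first.
  - apply/measurable_EFinP; apply: measurable_funM => //.
    by apply: (measurableT_comp mn); apply: measurable_funB => //; exact: measurable_funM.
  - by move=> z _; rewrite lee_fin mulr_ge0.
  congr (_ * _)%E; under eq_integral do rewrite normal_pdf_mul -/c EFinM.
  rewrite integralZl//; last exact: integrable_normal_pdf.
  by rewrite integral_normal_pdf mule1.
have mFc : measurable_fun [set: TR] (fun u => F u * (normal_pdf 0 c u)%:E)%E.
  by apply: emeasurable_funM => //; apply/measurable_EFinP; exact: measurable_normal_pdf.
rewrite (ge0_integral_affine c0 0 mFc); last first.
  by move=> x; rewrite mule_ge0// lee_fin normal_pdf_ge0.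
have mFs : measurable_fun [set: TR] (fun z : TR => F (c * z)).
  by apply: (measurableT_comp mF); exact: measurable_funM.
rewrite [RHS]ge0_integral_gauss// -ge0_integralZl//; last 3 first.
- apply: emeasurable_funM.
    by apply: (measurableT_comp mF); apply: measurable_funD => //; exact: measurable_funM.
  apply/measurable_EFinP; apply: (measurableT_comp (measurable_normal_pdf 0 c)).
  by apply: measurable_funD => //; exact: measurable_funM.
- by move=> x _; rewrite mule_ge0// lee_fin normal_pdf_ge0.
- by rewrite lee_fin ltW.
apply: eq_integral => x _; rewrite add0r muleCA -EFinM.
by rewrite (normal_pdf_scale _ c0).
Qed.

End gaussian_convolution.

Section iid_expectations.
Context d d' (T : measurableType d) (T' : measurableType d') (R : realType).
Context (P : probability T R) (X : nat -> {RV P >-> T'}).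

Lemma ident_Ex (idX : identically_distributed X) (f : T' -> R) (M : R) i j :
  measurable_fun [set: T'] f -> (forall x, `|f x| <= M) ->
  Ex P (fun w => f (X i w)) = Ex P (fun w => f (X j w)).
Proof.
move=> mf fM; rewrite /Ex /Rintegral; congr fine.
have I k : P.-integrable [set: T] ((EFin \o f) \o X k).
  by apply: (@itg_bounded _ _ _ _ (fun w => f (X k w)) M) => //; exact: measurableT_comp.
have mfE : measurable_fun [set: T'] (EFin \o f) by exact/measurable_EFinP.
rewrite -[LHS](integral_distribution mfE (I i)) -[RHS](integral_distribution mfE (I j)).
by apply: eq_measure_integral => A mA _; exact: idX.
Qed.

Lemma ge0_ident_integral (idX : identically_distributed X) (f : T' -> \bar R) i j :
  measurable_fun [set: T'] f -> (forall x, (0 <= f x)%E) ->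
  (\int[P]_w f (X i w) = \int[P]_w f (X j w))%E.
Proof.
move=> mf f0.
rewrite -[LHS](ge0_integral_distribution (X i) mf f0).
rewrite -[RHS](ge0_integral_distribution (X j) mf f0).
by apply: eq_measure_integral => A mA _; exact: idX.
Qed.

Lemma indep_Ex (indX : mutually_independent X) n
    (F : g_sigma_algebraType (past_cylinders X n) * T' -> R) (C : R) :
  measurable_fun [set: g_sigma_algebraType (past_cylinders X n) * T'] F ->
  (forall z, `|F z| <= C) ->
  measurable_fun [set: T] (fun w => F (w, X n w)) ->
  (forall w, measurable_fun [set: T] (fun w' => F (w, X n w'))) ->
  measurable_fun [set: T] (fun w => Ex P (fun w' => F (w, X n w'))) ->
  Ex P (fun w => F (w, X n w)) = Ex P (fun w => Ex P (fun w' => F (w, X n w'))).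
Proof.
move=> mF FC m1 m2 m3.
have I1 : itg P (fun w => F (w, X n w)) by exact: itg_bounded.
have I2 w : itg P (fun w' => F (w, X n w')) by exact: itg_bounded.
have I3 : itg P (fun w => Ex P (fun w' => F (w, X n w'))).
  by apply: (@itg_bounded _ _ _ _ _ C) => // w; exact: abs_Ex_le.
have IC := itg_cst P C.
(* Tonelli is used for nonnegative integrands; adding [C] ensures the sign, and it cancels at the
   end. *)
have G0 z : (0 <= (F z + C)%:E)%E.
  by rewrite lee_fin; have := FC z; rewrite ler_norml; lra.
have mG : measurable_fun
    [set: g_sigma_algebraType (past_cylinders X n) * T'] (fun z => (F z + C)%:E).
  by apply/measurable_EFinP; exact: measurable_funD.
have := indep_integral indX mG G0.
rewrite (ExE (itgD I1 IC)) ExD// Ex_cst.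
under eq_integral do rewrite (ExE (itgD (I2 _) IC)) ExD// Ex_cst.
by rewrite (ExE (itgD I3 IC)) ExD// Ex_cst => -[] /addIr.
Qed.

End iid_expectations.

(** * Lindeberg replacement of the summands by Gaussian ones *)

Section lindeberg.
Context d d' (T : measurableType d) (T' : measurableType d') (R : realType).
Context (P : probability T R) (X : nat -> {RV P >-> T'}).
Hypotheses (indX : mutually_independent X) (idX : identically_distributed X).
Variables (eta : T' -> R) (M s r : R).
Hypothesis meta : measurable_fun [set: T'] eta.
Hypothesis etaM : forall x, `|eta x| <= M.
Hypothesis eta1 : Ex P (fun w => eta (X 0%N w)) = 0.
Hypothesis eta2 : Ex P (fun w => eta (X 0%N w) ^+ 2) = s ^+ 2.
Hypotheses (s0 : 0 <= s) (r0 : 0 <= r).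

Let Z (w : T) := r * eta (X 0%N w).
Let Y (y : measurableTypeR R) := r * s * y.

Let W k (w : T) := \sum_(i < k) r * eta (X i w).

Let metaX i : measurable_fun [set: T] (fun w => eta (X i w)).
Proof. exact: measurableT_comp. Qed.

Let mZ : measurable_fun [set: T] Z. Proof. exact: measurable_funM. Qed.
Let mY : measurable_fun [set: measurableTypeR R] Y.
Proof. exact: mulrl_measurable. Qed.

Let mW k : measurable_fun [set: T] (W k).
Proof. by apply: measurable_sum => i; exact: measurable_funM. Qed.

Let M0 : 0 <= M. Proof. exact: le_trans (normr_ge0 _) (etaM point). Qed.

(** Bounds the sum of the third absolute moments of a summand and of its Gaussian replacement,
    without the factor [r ^+ 3]. *)
Definition lindeberg_moment : R := M ^+ 3 + s ^+ 3 * Ex gauss (fun y => `|y| ^+ 3).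

(** [Z] and [Y] are centred with the same variance [(r * s) ^+ 2], so the two second order
    expansions cancel and only third moments remain. *)
Lemma lindeberg_step (C : R) g g1 g2 x : taylor_class C g g1 g2 ->
  `|average P Z g x - average gauss Y g x| <= C * (r ^+ 3 * lindeberg_moment).
Proof.
move=> gC.
have Zb w : `|Z w| <= r * M by rewrite normrM (ger0_norm r0) ler_wpM2l.
have aP : `|average P Z g x - g x - g2 x * ((r * s) ^+ 2 / 2)| <= C * (r ^+ 3 * M ^+ 3).
  apply: (average_expansion mZ x gC).
  - apply: (@itg_bounded _ _ _ _ _ ((r * M) ^+ 2)); first exact: measurable_funX.
    by move=> w; rewrite normrX lerXn2r ?nnegrE// mulr_ge0.
  - apply: (@itg_bounded _ _ _ _ _ ((r * M) ^+ 3)).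
      by apply: measurable_funX; exact: measurableT_comp.
    by move=> w; rewrite normrX normr_id lerXn2r ?nnegrE// mulr_ge0.
  - rewrite /Z ExZ ?eta1 ?mulr0//; exact: (@itg_bounded _ _ _ _ _ M).
  - have -> : (fun w => Z w ^+ 2) = (fun w => r ^+ 2 * eta (X 0%N w) ^+ 2).
      by apply/funext => w; rewrite /Z exprMn.
    rewrite ExZ ?eta2 ?exprMn//; apply: (@itg_bounded _ _ _ _ _ (M ^+ 2)).
      exact: measurable_funX.
    by move=> w; rewrite normrX lerXn2r ?nnegrE.
  - rewrite -exprMn; apply: (le_trans (ler_norm _)); apply: abs_Ex_le.
      by apply: measurable_funX; exact: measurableT_comp.
    by move=> w; rewrite normrX normr_id lerXn2r ?nnegrE// mulr_ge0.
have aG : `|average gauss Y g x - g x - g2 x * ((r * s) ^+ 2 / 2)| <=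
    C * (r ^+ 3 * (s ^+ 3 * Ex gauss (fun y => `|y| ^+ 3))).
  have E2 : (fun y => Y y ^+ 2) = (fun y => (r * s) ^+ 2 * y ^+ 2).
    by apply/funext => y; rewrite /Y exprMn.
  have E3 : (fun y => `|Y y| ^+ 3) = (fun y => (r * s) ^+ 3 * `|y| ^+ 3).
    by apply/funext => y; rewrite /Y normrM ger0_norm ?mulr_ge0// exprMn.
  apply: (average_expansion mY x gC).
  - by rewrite E2; apply: itgZ; exact: itg_gauss_sqr.
  - by rewrite E3; apply: itgZ; exact: itg_gauss_cube.
  - by rewrite /Y (ExZ _ (itg_gauss_id)) Ex_gauss_id mulr0.
  - by rewrite E2 (ExZ _ itg_gauss_sqr) Ex_gauss_sqr mulr1.
  - by rewrite E3 (ExZ _ itg_gauss_cube) mulrA exprMn.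
rewrite /lindeberg_moment; move: aP aG; rewrite !ler_norml.
set a := average P Z g x; set b := average gauss Y g x; set u := g x; set v := g2 x * _.
by move=> /andP[p1 p2] /andP[q1 q2]; apply/andP; split; lra.
Qed.

(** The last summand is independent of the others and, up to relabelling by equality of laws,
    distributed as [Z]; it is integrated out first. *)
Lemma Ex_partial_sumS (C : R) g k : lipschitz_with C g -> (forall x, `|g x| <= C) ->
  Ex P (fun w => g (W k.+1 w)) = Ex P (fun w => average P Z g (W k w)).
Proof.
move=> gl gb; have mg := lipschitz_with_measurable gl.
have agE x : average P Z g x = Ex P (fun w' => g (x + r * eta (X k w'))).
  rewrite /average /Z.
  apply: (ident_Ex idX (f := fun t => g (x + r * eta t)) (M := C)) => //.
  apply: (measurableT_comp mg); apply: measurable_funD => //.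
  exact: measurable_funM.
pose past := g_sigma_algebraType (past_cylinders X k).
pose F (z : past * T') : R := g (W k z.1 + r * eta z.2).
have WS w : W k.+1 w = W k w + r * eta (X k w) by rewrite /W big_ord_recr.
under [in LHS]eq_fun do rewrite WS.
under [in RHS]eq_fun do rewrite agE.
have mag : measurable_fun [set: R] (average P Z g).
  have al : lipschitz_with C (average P Z g) by exact: average_lipschitz.
  exact: lipschitz_with_measurable al.
have magE : average P Z g = (fun x => Ex P (fun w' => g (x + r * eta (X k w')))).
  by apply/funext => x; rewrite agE.
rewrite magE in mag.
apply: (indep_Ex indX (F := F) (C := C)) => //.
- apply: (measurableT_comp mg); apply: measurable_funD.
    apply: (@measurableT_comp _ _ _ _ _ _ (fun w : past => W k w) _ fst) => //.
    apply: measurable_sum => i; apply: measurable_funM => //.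
    by apply: (measurableT_comp meta); apply: measurable_past.
  by apply: measurable_funM => //; exact: measurableT_comp.
- by move=> z; exact: gb.
- rewrite /F/=; apply: (measurableT_comp mg); apply: measurable_funD => //.
  exact: measurable_funM.
- move=> w; rewrite /F/=; apply: (measurableT_comp mg); apply: measurable_funD => //.
  exact: measurable_funM.
- exact: (measurableT_comp mag (mW k)).
Qed.

(** Summands are replaced one at a time, starting with the last. The induction ranges over all [g]
    because its hypothesis is applied to the Gaussian average of [g], which is in the class with the
    same [C]. *)
Lemma lindeberg_telescope (C : R) k : forall g g1 g2, taylor_class C g g1 g2 ->
  `|Ex P (fun w => g (W k w)) - iter k (average gauss Y) g 0| <=
    k%:R * (C * (r ^+ 3 * lindeberg_moment)).
Proof.
elim: k => [|k IH] g g1 g2 gC.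
  rewrite /W; under eq_fun do rewrite big_ord0.
  by rewrite Ex_cst subrr normr0 mul0r.
have [gb [gl _ _] _] := gC.
have b0 x : `|g x| <= C by case: (gb x).
have agC := average_taylor gauss mY gC.
have [agb [agl _ _] _] := agC.
have ab0 x : `|average gauss Y g x| <= C by case: (agb x).
rewrite (Ex_partial_sumS k gl b0) iterSr.
have := IH _ _ _ agC.
have mP : measurable_fun [set: T] (fun w => average P Z g (W k w)).
  have al : lipschitz_with C (average P Z g) by exact: average_lipschitz.
  exact: measurableT_comp (lipschitz_with_measurable al) (mW k).
have mG : measurable_fun [set: T] (fun w => average gauss Y g (W k w)).
  exact: measurableT_comp (lipschitz_with_measurable agl) (mW k).
have I1 : itg P (fun w => average P Z g (W k w)).
  by apply: (@itg_bounded _ _ _ _ _ C mP) => w; exact: average_bound.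
have I2 : itg P (fun w => average gauss Y g (W k w)) by exact: (@itg_bounded _ _ _ _ _ C mG).
have : `|Ex P (fun w => average P Z g (W k w)) - Ex P (fun w => average gauss Y g (W k w))|
    <= C * (r ^+ 3 * lindeberg_moment).
  rewrite -ExB//; apply: abs_Ex_le; first exact: measurable_funB.
  by move=> w; exact: lindeberg_step gC.
rewrite -[k.+1]addn1 natrD mulrDl mul1r !ler_norml.
set a := Ex P _; set b := Ex P _; set e := C * _; set f := k%:R * e; set h := iter _ _ _ _.
by move=> /andP[p1 p2] /andP[q1 q2]; apply/andP; split; lra.
Qed.

(** Variances add: one more Gaussian step turns the factor [sqrt k] into [sqrt (1 + k)] by
    [gauss_convolution], applied to [f + C] to have a nonnegative integrand. *)
Lemma iter_average_gauss (C : R) f k x : lipschitz_with C f -> (forall x, `|f x| <= C) ->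
  iter k (average gauss Y) f x = Ex gauss (fun z => f (x + r * s * Num.sqrt k%:R * z)).
Proof.
move=> fl fb; have mf := lipschitz_with_measurable fl.
elim: k x => [|k IH] x.
  rewrite /= -[LHS](Ex_cst gauss); congr (Ex gauss _); apply/funext => z.
  by rewrite sqrtr0 mulr0 mul0r addr0.
rewrite iterS /average.
under eq_fun do rewrite IH.
have mff (a b : R) : measurable_fun [set: measurableTypeR R] (fun z => f (a + b * z)).
  by apply: (measurableT_comp mf); apply: measurable_funD => //; exact: mulrl_measurable.
pose F (t : R) : \bar R := (f (x + r * s * t) + C)%:E.
have F0 t : (0 <= F t)%E.
  by rewrite lee_fin; have := fb (x + r * s * t); rewrite ler_norml; lra.
have mF : measurable_fun [set: measurableTypeR R] F.
  by apply/measurable_EFinP; apply: measurable_funD => //; exact: mff.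
have I (a b : R) : itg gauss (fun z => f (a + b * z)) by exact: (@itg_bounded _ _ _ _ _ C (mff a b)).
have IC := itg_cst gauss C.
have E y z : F (y + Num.sqrt k%:R * z) = (f ((x + Y y) + r * s * Num.sqrt k%:R * z) + C)%:E.
  by rewrite /F /Y mulrDr addrA mulrA.
have := gauss_convolution (Num.sqrt k%:R) mF F0.
under eq_integral => y _.
  under eq_integral do rewrite E.
  rewrite (ExE (itgD (I _ _) IC)) ExD; [|exact: I|exact: IC].
  rewrite Ex_cst.
  over.
have I3 : itg gauss (fun y => Ex gauss (fun z => f (x + Y y + r * s * Num.sqrt k%:R * z))).
  pose Yk (z : measurableTypeR R) := r * s * Num.sqrt k%:R * z.
  have mYk : measurable_fun [set: measurableTypeR R] Yk by exact: mulrl_measurable.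
  apply: (@itg_bounded _ _ _ _ _ C); last by move=> y; apply: abs_Ex_le => //; exact: mff.
  have al : lipschitz_with C (average gauss Yk f) by exact: average_lipschitz.
  have := lipschitz_with_measurable al.
  move=> ma; apply: (measurableT_comp ma).
  by apply: measurable_funD => //; exact: mulrl_measurable.
rewrite (ExE (itgD I3 IC)) ExD// Ex_cst sqr_sqrtr//.
have E' z : F (Num.sqrt (1 + k%:R) * z) = (f (x + r * s * Num.sqrt k.+1%:R * z) + C)%:E.
  by rewrite /F mulrA -natr1 addrC addrC [1 + _]addrC.
under eq_integral do rewrite E'.
by rewrite (ExE (itgD (I _ _) IC)) ExD ?Ex_cst// => -[] /addIr.
Qed.

Lemma lindeberg (C : R) k f f1 f2 : taylor_class C f f1 f2 ->
  `|Ex P (fun w => f (W k w)) - Ex gauss (fun z => f (r * s * Num.sqrt k%:R * z))| <=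
    k%:R * (C * (r ^+ 3 * lindeberg_moment)).
Proof.
move=> fC; have [fb [fl _ _] _] := fC.
have := lindeberg_telescope k fC.
rewrite (@iter_average_gauss C)//; last by move=> x; case: (fb x).
by under [X in `|_ - Ex _ X|]eq_fun do rewrite add0r.
Qed.

End lindeberg.

(** * A smoothing criterion for convergence in distribution *)

Section smooth_step.
Context {R : realType}.
Implicit Types x t : R.

Definition pos_part t : R := Num.max t 0.

(* The distribution function of a sum of three independent uniform variables on
   [0, 1], together with its first two derivatives. *)
Definition step x : R := (pos_part x ^+ 3 - 3 * pos_part (x - 1) ^+ 3 +
  3 * pos_part (x - 2) ^+ 3 - pos_part (x - 3) ^+ 3) / 6.
Definition step1 x : R := (pos_part x ^+ 2 - 3 * pos_part (x - 1) ^+ 2 +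
  3 * pos_part (x - 2) ^+ 2 - pos_part (x - 3) ^+ 2) / 2.
Definition step2 x : R := pos_part x - 3 * pos_part (x - 1) +
  3 * pos_part (x - 2) - pos_part (x - 3).

Lemma pos_partP t : (0 <= t /\ pos_part t = t) \/ (t <= 0 /\ pos_part t = 0).
Proof.
by rewrite /pos_part; have [t0|t0] := leP t 0; [right|left; split => //; exact: ltW].
Qed.

(** If [x] and [x + t] have the same sign, the remainder is [t ^+ 3] or 0. If the signs differ, then
    [|x + t| <= |t|], which controls the extra cube. *)
Lemma pos_part_cube x t :
  `|pos_part (x + t) ^+ 3 - pos_part x ^+ 3 - 3 * pos_part x ^+ 2 * t -
    3 * pos_part x * t ^+ 2| <= `|t| ^+ 3.
Proof.
rewrite -normrX ler_norml.
have [[h1 ->]|[h1 ->]] := pos_partP (x + t); have [[h2 ->]|[h2 ->]] := pos_partP x.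
- have -> : (x + t) ^+ 3 - x ^+ 3 - 3 * x ^+ 2 * t - 3 * x * t ^+ 2 = t ^+ 3 by ring.
  by rewrite ler_norm -normrN lerNl ler_norm.
- have t0 : 0 <= t by lra.
  rewrite !expr0n/= !mulr0 !mul0r !subr0 (ger0_norm (exprn_ge0 _ t0)).
  apply/andP; split; last by rewrite lerXn2r ?nnegrE//; lra.
  by rewrite (@le_trans _ _ 0) ?oppr_le0 ?exprn_ge0.
- have t0 : t <= 0 by lra.
  have -> : `|t ^+ 3| = - t ^+ 3.
    by rewrite ler0_norm// exprSr mulr_ge0_le0// sqr_ge0.
  have -> : 0 ^+ 3 - x ^+ 3 - 3 * x ^+ 2 * t - 3 * x * t ^+ 2 = t ^+ 3 - (x + t) ^+ 3.
    by ring.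
  have y3 : (x + t) ^+ 3 <= 0 by rewrite exprSr mulr_ge0_le0// sqr_ge0.
  have t3 : t ^+ 3 <= 0 by rewrite exprSr mulr_ge0_le0// sqr_ge0.
  have : (- (x + t)) ^+ 3 <= (- t) ^+ 3 by rewrite lerXn2r ?nnegrE//; lra.
  have -> : (- (x + t)) ^+ 3 = - (x + t) ^+ 3 by ring.
  have -> : (- t) ^+ 3 = - t ^+ 3 by ring.
  by move=> h; apply/andP; split; lra.
- by rewrite !expr0n/= !mulr0 !mul0r !subr0 oppr_le0 normr_ge0.
Qed.

Lemma pos_part_sqr x t :
  `|pos_part (x + t) ^+ 2 - pos_part x ^+ 2 - 2 * pos_part x * t| <= t ^+ 2.
Proof.
rewrite ler_norml.
have [[h1 ->]|[h1 ->]] := pos_partP (x + t); have [[h2 ->]|[h2 ->]] := pos_partP x;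
  rewrite ?expr0n/= !expr2; apply/andP; split; nra.
Qed.

Lemma pos_part_lip x t : `|pos_part (x + t) - pos_part x| <= `|t|.
Proof.
have [[h1 ->]|[h1 ->]] := pos_partP (x + t); have [[h2 ->]|[h2 ->]] := pos_partP x;
  by have := ler_norm t; have := ler_norm (- t); rewrite normrN ler_norml => p q;
  apply/andP; split; lra.
Qed.

Lemma step_cases x :
  x <= 0 \/ [\/ 0 <= x <= 1, 1 <= x <= 2, 2 <= x <= 3 | 3 <= x].
Proof.
have [|h0] := leP x 0; first by left.
right.
have [h1|h1] := leP x 1; first by constructor 1; rewrite ltW.
have [h2|h2] := leP x 2; first by constructor 2; rewrite ltW.
have [h3|h3] := leP x 3; first by constructor 3; rewrite ltW.
by constructor 4; rewrite ltW.
Qed.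

Lemma pos_part_ge t : 0 <= t -> pos_part t = t.
Proof. by move=> t0; rewrite /pos_part max_l. Qed.

Lemma pos_part_le t : t <= 0 -> pos_part t = 0.
Proof. by move=> t0; rewrite /pos_part max_r. Qed.

Lemma step_le0 x : x <= 0 -> step x = 0.
Proof.
move=> h; rewrite /step !pos_part_le; [|lra..].
by rewrite !expr0n/= !mulr0 !subr0 addr0 mul0r.
Qed.

Lemma step_ge3 x : 3 <= x -> step x = 1.
Proof. by move=> h; rewrite /step !pos_part_ge; [field|lra..]. Qed.

Lemma step_bound x : 0 <= step x <= 1.
Proof.
have [h|[/andP[h h']|/andP[h h']|/andP[h h']|h]] := step_cases x.
- by rewrite step_le0// lexx ler01.
- rewrite /step (@pos_part_ge x)// !pos_part_le; [|lra..].
  rewrite !expr0n/= !mulr0 !subr0 addr0.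
  have := exprn_ge0 3 h; have := exprn_ile1 3 h h'.
  by move=> a b; apply/andP; split; lra.
- rewrite /step (@pos_part_ge x) ?(@pos_part_ge (x - 1)) ?pos_part_le; [|lra..].
  rewrite !expr0n/= !mulr0 !subr0 addr0.
  have y0 : 0 <= x - 1 by lra.
  have y1 : x - 1 <= 1 by lra.
  have q0 := exprn_ge0 2 y0; have q1 := exprn_ile1 2 y0 y1.
  have -> : (x ^+ 3 - 3 * (x - 1) ^+ 3) / 6 =
    (1 + 3 * (x - 1) + 3 * (x - 1) ^+ 2 - 2 * ((x - 1) ^+ 2 * (x - 1))) / 6 by field.
  have c0 : 0 <= (x - 1) ^+ 2 * (1 - (x - 1)) by rewrite mulr_ge0//; lra.
  have c1 : 0 <= (1 - (x - 1) ^+ 2) * (1 - (x - 1)) by rewrite mulr_ge0//; lra.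
  by move: c0 c1 q0 q1; rewrite mulrBl !mulrBr !mul1r !mulr1 => c0 c1 q0 q1;
    apply/andP; split; lra.
- rewrite /step (@pos_part_ge x) ?(@pos_part_ge (x - 1)) ?(@pos_part_ge (x - 2)) ?pos_part_le; [|lra..].
  (* The symmetry [step x = 1 - step (3 - x)] brings this case back to the first piece. *)
  have -> : (x ^+ 3 - 3 * (x - 1) ^+ 3 + 3 * (x - 2) ^+ 3 - 0 ^+ 3) / 6 =
    1 - (3 - x) ^+ 3 / 6 by field.
  have y0 : 0 <= 3 - x by lra.
  have y1 : 3 - x <= 1 by lra.
  have := exprn_ge0 3 y0; have := exprn_ile1 3 y0 y1.
  by move=> a b; apply/andP; split; lra.
- by rewrite step_ge3// ler01 lexx.
Qed.

Lemma step1_bound x : `|step1 x| <= 2.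
Proof.
rewrite ler_norml /step1.
have [h|[/andP[h h']|/andP[h h']|/andP[h h']|h]] := step_cases x.
- rewrite !pos_part_le; [|lra..]; rewrite !expr0n/=; lra.
- rewrite (@pos_part_ge x)// !pos_part_le; [|lra..]; rewrite !expr0n/= !expr2.
  by apply/andP; split; nra.
- rewrite (@pos_part_ge x) ?(@pos_part_ge (x - 1)) ?pos_part_le; [|lra..].
  by rewrite !expr0n/= !expr2; apply/andP; split; nra.
- rewrite (@pos_part_ge x) ?(@pos_part_ge (x - 1)) ?(@pos_part_ge (x - 2)) ?pos_part_le; [|lra..].
  by rewrite !expr0n/= !expr2; apply/andP; split; nra.
- rewrite !pos_part_ge; [|lra..].
  by rewrite !expr2; apply/andP; split; lra.
Qed.

Lemma step2_bound x : `|step2 x| <= 2.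
Proof.
rewrite ler_norml /step2.
have [h|[/andP[h h']|/andP[h h']|/andP[h h']|h]] := step_cases x.
- by rewrite !pos_part_le; [|lra..]; apply/andP; split; lra.
- by rewrite (@pos_part_ge x)// !pos_part_le; [|lra..]; apply/andP; split; lra.
- by rewrite (@pos_part_ge x) ?(@pos_part_ge (x - 1)) ?pos_part_le; [|lra..]; apply/andP; split; lra.
- by rewrite (@pos_part_ge x) ?(@pos_part_ge (x - 1)) ?(@pos_part_ge (x - 2)) ?pos_part_le; [|lra..]; apply/andP; split; lra.
- by rewrite !pos_part_ge; [|lra..]; apply/andP; split; lra.
Qed.

Lemma step_taylor x t : `|step (x + t) - step x - step1 x * t - step2 x * (t ^+ 2 / 2)| <=
  2 * `|t| ^+ 3.
Proof.
have h0 := pos_part_cube x t; have h1 := pos_part_cube (x - 1) t.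
have h2 := pos_part_cube (x - 2) t; have h3 := pos_part_cube (x - 3) t.
have E a : x + t - a = x - a + t by ring.
rewrite /step /step1 /step2 !E; move: h0 h1 h2 h3; rewrite !ler_norml.
have : 0 <= `|t| ^+ 3 by rewrite exprn_ge0.
set T := `|t| ^+ 3.
move=> T0 /andP[a1 a2] /andP[b1 b2] /andP[c1 c2] /andP[d1 d2].
by apply/andP; split; lra.
Qed.

Lemma step1_taylor x t : `|step1 (x + t) - step1 x - step2 x * t| <= 4 * t ^+ 2.
Proof.
have h0 := pos_part_sqr x t; have h1 := pos_part_sqr (x - 1) t.
have h2 := pos_part_sqr (x - 2) t; have h3 := pos_part_sqr (x - 3) t.
have E a : x + t - a = x - a + t by ring.
rewrite /step1 /step2 !E; move: h0 h1 h2 h3; rewrite !ler_norml.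
have := sqr_ge0 t.
move=> T0 /andP[a1 a2] /andP[b1 b2] /andP[c1 c2] /andP[d1 d2].
by apply/andP; split; lra.
Qed.

(** The constant 8 is the Lipschitz bound of [step2], whose coefficients 1, 3, 3, 1 sum to 8. The
    Lipschitz bounds of [step] and [step1] come from the Taylor estimates for [|t| <= 1] and from
    boundedness otherwise. *)
Lemma taylor_class_step : taylor_class 8 step step1 step2.
Proof.
have sb x : `|step x| <= 1.
  by have /andP[a b] := step_bound x; rewrite ler_norml; apply/andP; split; lra.
split.
- move=> x; split; [have := sb x|have := step1_bound x|have := step2_bound x]; lra.
- split=> x t.
  + have [t1|t1] := leP `|t| 1.
      have := step_taylor x t; have := step1_bound x; have := step2_bound x.
      set A := step (x + t) - step x => b2 b1 h.
      have t0 := normr_ge0 t.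
      have -> : A = (A - step1 x * t - step2 x * (t ^+ 2 / 2)) +
        (step1 x * t + step2 x * (t ^+ 2 / 2)) by ring.
      apply: (le_trans (ler_normD _ _)).
      have : `|step1 x * t + step2 x * (t ^+ 2 / 2)| <= 2 * `|t| + 2 * (`|t| ^+ 2 / 2).
        apply: (le_trans (ler_normD _ _)); rewrite (normrM (step1 x)) (normrM (step2 x)) (normrM (t ^+ 2)) normfV normrX.
        rewrite (@ger0_norm _ 2)//.
        by apply: lerD; apply: ler_wpM2r.
      have : `|t| ^+ 3 <= `|t| by rewrite ler_iXnr.
      have : `|t| ^+ 2 <= `|t| by rewrite ler_iXnr.
      by lra.
    have := ler_normB (step (x + t)) (step x); have := sb x; have := sb (x + t); lra.
  + have [t1|t1] := leP `|t| 1.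
      have := step1_taylor x t; have := step2_bound x.
      set A := step1 (x + t) - step1 x => b2 h.
      have t0 := normr_ge0 t.
      have -> : A = (A - step2 x * t) + step2 x * t by ring.
      apply: (le_trans (ler_normD _ _)).
      have : `|step2 x * t| <= 2 * `|t| by rewrite normrM ler_wpM2r.
      have : t ^+ 2 <= `|t| by rewrite -real_normK ?num_real// ler_iXnr.
      by lra.
    have := ler_normB (step1 (x + t)) (step1 x); have := step1_bound x.
    by have := step1_bound (x + t); lra.
  + have h0 := pos_part_lip x t; have h1 := pos_part_lip (x - 1) t.
    have h2 := pos_part_lip (x - 2) t; have h3 := pos_part_lip (x - 3) t.
    have E a : x + t - a = x - a + t by ring.
    rewrite /step2 !E; move: h0 h1 h2 h3; rewrite !ler_norml.
    move=> /andP[a1 a2] /andP[b1 b2] /andP[c1 c2] /andP[d1 d2].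
    by apply/andP; split; lra.
- move=> x t; apply: (le_trans (step_taylor x t)); rewrite ler_wpM2r ?exprn_ge0//; lra.
Qed.

Lemma taylor_class_affine (C a b : R) g g1 g2 : taylor_class C g g1 g2 ->
  exists C', taylor_class C' (fun x => g (a * x + b)) (fun x => a * g1 (a * x + b))
    (fun x => a ^+ 2 * g2 (a * x + b)).
Proof.
move=> [gb [l l1 l2] ge].
have C0 : 0 <= C by have [h _ _] := gb 0; exact: le_trans (normr_ge0 _) h.
(* Bounds, Lipschitz constants and remainder pick up powers of [|a|] of exponent at most 3; [K]
   dominates them all. *)
pose K := 1 + `|a| + `|a| ^+ 2 + `|a| ^+ 3.
have a0 := normr_ge0 a.
have a2 : 0 <= `|a| ^+ 2 by rewrite exprn_ge0.
have a3 : 0 <= `|a| ^+ 3 by rewrite exprn_ge0.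
have E x t : a * (x + t) + b = a * x + b + a * t by ring.
have leK (u v : R) : u <= K -> 0 <= v -> u * v <= K * v by move=> uK v0; rewrite ler_wpM2r.
have K1 : 1 <= K by rewrite /K; lra.
have Ka : `|a| <= K by rewrite /K; lra.
have Ka2 : `|a| ^+ 2 <= K by rewrite /K; lra.
have Ka3 : `|a| ^+ 3 <= K by rewrite /K; lra.
exists (K * C); split.
- move=> x; have [h h1 h2] := gb (a * x + b); split.
  + by have := leK 1 C K1 C0; lra.
  + rewrite normrM; apply: le_trans (leK _ C Ka C0); exact: ler_wpM2l.
  + rewrite normrM normrX; apply: le_trans (leK _ C Ka2 C0); exact: ler_wpM2l.
- split=> x t; rewrite E.
  + apply: (le_trans (l _ _)); rewrite normrM mulrCA -[leRHS]mulrA.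
    by apply: leK => //; rewrite mulr_ge0.
  + rewrite -mulrBr normrM; apply: (le_trans (ler_wpM2l a0 (l1 _ _))).
    rewrite normrM [leLHS](_ : _ = `|a| ^+ 2 * (C * `|t|)); last by ring.
    by rewrite -[leRHS]mulrA; apply: leK => //; rewrite mulr_ge0.
  + rewrite -mulrBr normrM normrX; apply: (le_trans (ler_wpM2l a2 (l2 _ _))).
    rewrite normrM [leLHS](_ : _ = `|a| ^+ 3 * (C * `|t|)); last by ring.
    by rewrite -[leRHS]mulrA; apply: leK => //; rewrite mulr_ge0.
- move=> x t; rewrite E.
  have := ge (a * x + b) (a * t); rewrite normrM (exprMn 3 `|a|).
  set A := _ - _ - _ - _; set A' := _ - _ - _ - _.
  have -> : A' = A by rewrite /A /A'; field.
  move=> /le_trans; apply; rewrite mulrCA -[leRHS]mulrA.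
  by apply: leK => //; rewrite mulr_ge0// exprn_ge0.
Qed.

End smooth_step.

Section weak_convergence.
Context d (T : measurableType d) (R : realType) (P : probability T R).

Lemma Ex_indic (A : set T) : measurable A -> Ex P (fun w => \1_A w) = fine (P A).
Proof. by move=> mA; rewrite /Ex /Rintegral integral_indic// setIT. Qed.

Lemma itg_indic (A : set T) : measurable A -> itg P (fun w => \1_A w).
Proof.
move=> mA; apply: (@itg_bounded _ _ _ _ _ 1); first exact: measurable_indic.
by move=> w; rewrite indicE; case: (_ \in _); rewrite ?normr1 ?normr0.
Qed.

End weak_convergence.

Section normal_limit.
Context {R : realType}.
Notation TR := (measurableTypeR R).
Notation mu := (@lebesgue_measure R).

Lemma measurable_scaled_le (v t : R) : measurable [set z : TR | v * z <= t].
Proof.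
rewrite -[X in measurable X]setTI.
have -> : [set z : TR | v * z <= t] = (fun z => v * z) @^-1` `]-oo, t].
  by apply/seteqP; split => z /=; rewrite in_itv.
by apply: mulrl_measurable.
Qed.

(** For [v = 0] the event is everything or nothing according to the sign of [t], as for the point
    mass; otherwise the substitution [x = v * z] turns one density into the other. *)
Lemma normal_law_gauss (v t : R) : 0 <= v ->
  normal_law v `]-oo, t]%classic = gauss [set z : TR | v * z <= t].
Proof.
move=> v0; rewrite /normal_law; case: eqVneq => [->|vn0].
  rewrite /= /dirac indicE; have [t0|t0] := leP 0 t.
    have -> : [set z : TR | 0 * z <= t] = setT.
      by apply/seteqP; split => z //= _; rewrite mul0r.
    by rewrite probability_setT mem_set//= in_itv.
  have -> : [set z : TR | 0 * z <= t] = set0.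
    by apply/seteqP; split => z //=; rewrite mul0r leNgt t0.
  by rewrite measure0 memNset//= in_itv/= leNgt t0.
have vgt0 : 0 < v by rewrite lt_neqAle eq_sym vn0.
rewrite /gauss /= /normal_prob integral_mkcond [RHS]integral_mkcond.
have mp (s : R) (A : set TR) : measurable A ->
    measurable_fun [set: TR] ((fun x => (normal_pdf 0 s x)%:E) \_ A).
  move=> mA; apply/(measurable_restrictT _ mA).
  by apply: measurable_funTS; apply/measurable_EFinP; exact: measurable_normal_pdf.
have p0 (s : R) (A : set TR) x : (0 <= ((fun x => (normal_pdf 0 s x)%:E) \_ A) x)%E.
  by rewrite patchE; case: ifP => // _; rewrite lee_fin normal_pdf_ge0.
rewrite (ge0_integral_affine vgt0 0)//; last first.
  by apply: mp; exact: measurable_itv.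
rewrite -ge0_integralZl//; last first.
  have := mp v `]-oo, t]%classic (measurable_itv _) => m.
  have ml : measurable_fun [set: TR] (fun x : TR => 0 + v * x : TR).
    by apply: measurable_funD => //; exact: mulrl_measurable.
  exact: (measurableT_comp m ml).
apply: eq_integral => z _; rewrite add0r !patchE.
have -> : (v * z \in `]-oo, t]%classic) = (z \in [set z : TR | v * z <= t]).
  by apply/idP/idP => /set_mem /=; rewrite ?in_itv/= => vz; apply/mem_set;
    rewrite /= ?in_itv.
by case: ifP => _; rewrite ?mule0// -EFinM normal_pdf_scale.
Qed.

End normal_limit.

Section convergence_criterion.
Context d (T : measurableType d) (R : realType) (P : probability T R).
Notation TR := (measurableTypeR R).
Variables (Y : nat -> T -> R) (v : R).
Hypothesis mY : forall n, measurable_fun [set: T] (Y n).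
Hypothesis v0 : 0 <= v.
Hypothesis Ycvg : forall C f f1 f2, taylor_class C f f1 f2 ->
  Ex P (fun w => f (Y n w)) @[n --> \oo] --> Ex gauss (fun z => f (v * z)).

Let G (t : R) : R := fine (normal_law v `]-oo, t]%classic).

Let GE t : normal_law v `]-oo, t]%classic = (G t)%:E.
Proof. by rewrite /G fineK// fin_num_measure. Qed.

Let F n (x : R) : R := fine (P [set w | Y n w <= x]).

Let mYle n x : measurable [set w | Y n w <= x].
Proof.
rewrite -[X in measurable X]setTI.
have -> : [set w | Y n w <= x] = Y n @^-1` `]-oo, x].
  by apply/seteqP; split => w /=; rewrite in_itv.
by apply: mY.
Qed.

(** A smoothed indicator of []-oo, x]]: it falls from 1 to 0 on [[x - 3 * del, x]], because [step]
    climbs from 0 to 1 on [[0, 3]]. *)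
Let h (x del y : R) := step ((- del^-1) * y + del^-1 * x).

Let hC (x del : R) : exists C f1 f2, taylor_class C (h x del) f1 f2.
Proof.
have [C' h'] := taylor_class_affine (- del^-1) (del^-1 * x) (@taylor_class_step R).
by exists C'; do 2 eexists; exact: h'.
Qed.

Let h_bound (x del y : R) : 0 <= h x del y <= 1. Proof. exact: step_bound. Qed.

Let hE (x del y : R) : (- del^-1) * y + del^-1 * x = (x - y) / del.
Proof. ring. Qed.

Let h_le (x del y : R) : 0 < del -> h x del y <= (y <= x)%R%:R.
Proof.
move=> d0; have [yx|xy] := leP y x; first by have /andP[] := h_bound x del y.
by rewrite /h hE step_le0// pmulr_lle0 ?invr_gt0// subr_le0 ltW.
Qed.

Let h_ge (x del y : R) : 0 < del -> (y <= x - 3 * del)%R%:R <= h x del y.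
Proof.
move=> d0; have [yx|xy] := leP y _; last by have /andP[] := h_bound x del y.
by rewrite /h hE step_ge3// ler_pdivlMr//; lra.
Qed.

Let mh (x del : R) : measurable_fun [set: R] (h x del).
Proof.
have [C [f1 [f2 [_ [l _ _] _]]]] := hC x del.
exact: lipschitz_with_measurable l.
Qed.

Let itg_h d' (T' : measurableType d') (Q : probability T' R) (Z : T' -> R) (x del : R) :
  measurable_fun [set: T'] Z -> itg Q (fun w => h x del (Z w)).
Proof.
move=> mZ; apply: (@itg_bounded _ _ _ _ _ 1); first exact: (measurableT_comp (mh x del)).
by move=> w; have /andP[a b] := h_bound x del (Z w); rewrite ger0_norm.
Qed.

Let FE n x : F n x = Ex P (fun w => (Y n w <= x)%R%:R).
Proof.
rewrite /F -Ex_indic//; congr (Ex P _); apply/funext => w; rewrite indicE.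
by congr (_%:R); congr nat_of_bool; apply/idP/idP; rewrite inE.
Qed.

Let GEx t : G t = Ex gauss (fun z => (v * z <= t)%R%:R).
Proof.
rewrite /G normal_law_gauss// -Ex_indic; last exact: measurable_scaled_le.
congr (Ex gauss _); apply/funext => w; rewrite indicE.
by congr (_%:R); congr nat_of_bool; apply/idP/idP; rewrite inE.
Qed.

Let itgF n x : itg P (fun w => (Y n w <= x)%R%:R).
Proof.
have := itg_indic P (mYle n x); congr (itg P _); apply/funext => w; rewrite indicE.
by congr (_%:R); congr nat_of_bool; apply/idP/idP; rewrite inE.
Qed.

Let itgG t : itg gauss (fun z : TR => (v * z <= t)%R%:R).
Proof.
have := itg_indic gauss (measurable_scaled_le v t); congr (itg gauss _).
apply/funext => w; rewrite indicE.
by congr (_%:R); congr nat_of_bool; apply/idP/idP; rewrite inE.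
Qed.

Lemma cvg_in_distribution_taylor : cvg_in_distribution P Y (normal_law v).
Proof.
split => // x cx.
have cG : G y @[y --> x] --> G x.
  have cx' : (fun y => normal_law v `]-oo, y]%classic) y @[y --> x] -->
    normal_law v `]-oo, x]%classic by exact: cx.
  by rewrite GE in cx'; exact: fine_cvg cx'.
have -> : (fun n => P [set w | Y n w <= x]) = EFin \o (F ^~ x).
  by apply/funext => n; rewrite /= /F fineK// fin_num_measure.
rewrite GE; apply: cvg_EFin; first exact: nearW.
apply/cvgrPdist_lt => e e0.
have e20 : 0 < e / 2 by rewrite divr_gt0.
move/cvgrPdist_lt : cG => /(_ _ e20) /nbhs_ballP[del /= del0 hdel].
(* The transition has width [3 * s = del / 2], which keeps [x - 3 * s] and [x + 3 * s] within the
   radius of continuity. *)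
pose s := del / 6.
have s0 : 0 < s by rewrite divr_gt0.
have mv : measurable_fun [set: TR] (fun z : TR => v * z) by exact: mulrl_measurable.
have [C [f1 [f2 hT]]] := hC (x + 3 * s) s.
have [C' [f1' [f2' hT']]] := hC x s.
have c1 := Ycvg hT; have c2 := Ycvg hT'.
have G1 : Ex gauss (fun z => h (x + 3 * s) s (v * z)) <= G (x + 3 * s).
  by rewrite GEx; apply: le_Ex => [||z]; [exact: itg_h|exact: itgG|exact: h_le].
have G2 : G (x - 3 * s) <= Ex gauss (fun z => h x s (v * z)).
  by rewrite GEx; apply: le_Ex => [||z]; [exact: itgG|exact: itg_h|exact: h_ge].
have F1 n : F n x <= Ex P (fun w => h (x + 3 * s) s (Y n w)).
  rewrite FE; apply: le_Ex => [||z]; [exact: itgF|exact: itg_h|].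
  by have := h_ge (x + 3 * s) (Y n z) s0; rewrite addrK.
have F2 n : Ex P (fun w => h x s (Y n w)) <= F n x.
  by rewrite FE; apply: le_Ex => [||z]; [exact: itg_h|exact: itgF|exact: h_le].
have d1 : `|G x - G (x + 3 * s)| < e / 2.
  by apply: hdel; rewrite /ball/= opprD addrA subrr sub0r normrN gtr0_norm /s; lra.
have d2 : `|G x - G (x - 3 * s)| < e / 2.
  by apply: hdel; rewrite /ball/= opprB addrCA subrr addr0 gtr0_norm /s; lra.
move/cvgrPdist_lt : c1 => /(_ _ e20) c1.
move/cvgrPdist_lt : c2 => /(_ _ e20) c2.
near=> n.
have q1 : `|Ex gauss (fun z => h (x + 3 * s) s (v * z)) -
    Ex P (fun w => h (x + 3 * s) s (Y n w))| < e / 2 by near: n.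
have q2 : `|Ex gauss (fun z => h x s (v * z)) -
    Ex P (fun w => h x s (Y n w))| < e / 2 by near: n.
have := F1 n; have := F2 n; move: q1 q2 d1 d2; rewrite !ltr_norml.
move=> /andP[a1 a2] /andP[b1 b2] /andP[g1 g2] /andP[k1 k2] m1 m2.
by apply/andP; split; lra.
Unshelve. all: by end_near. Qed.

End convergence_criterion.

(** * The discrepancy between critical points and zeros *)

Section complex_measurability.
Context {R : realType}.
Notation TR := (measurableTypeR R).
Notation normc := (@Normc.normc R).

Definition coords (z : R[i]) : R * R := (complex.Re z, complex.Im z).

Lemma coordsK : cancel coords (@cplx R).
Proof. by case. Qed.

Lemma cplxK : cancel (@cplx R) coords.
Proof. by case. Qed.

Lemma measurable_coords : measurable_fun [set: R[i]] (coords : R[i] -> TR * TR).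
Proof.
move=> _ A mA; rewrite setTI.
suff : measurable (@cplx R @^-1` (coords @^-1` A)) by [].
by rewrite -comp_preimage (_ : _ \o _ = id) ?preimage_id//; apply/funext; exact: cplxK.
Qed.

Lemma measurable_complexP d (T : measurableType d) (f : T -> R[i]) :
  measurable_fun [set: T] (fun w => complex.Re (f w)) ->
  measurable_fun [set: T] (fun w => complex.Im (f w)) ->
  measurable_fun [set: T] f.
Proof.
move=> mr mi; have -> : f = @cplx R \o (fun w => (complex.Re (f w), complex.Im (f w))).
  by apply/funext => w /=; rewrite -[LHS]coordsK.
by apply: (measurableT_comp (@measurable_cplx R)); exact: measurable_fun_pair.
Qed.

Lemma measurable_Re : measurable_fun [set: R[i]] (@complex.Re R).
Proof. exact: (measurableT_comp (@measurable_fst _ _ TR TR) measurable_coords). Qed.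

Lemma measurable_Im : measurable_fun [set: R[i]] (@complex.Im R).
Proof. exact: (measurableT_comp (@measurable_snd _ _ TR TR) measurable_coords). Qed.

Lemma Re_add (z w : R[i]) : complex.Re (z + w) = complex.Re z + complex.Re w.
Proof. by case: z; case: w. Qed.
Lemma Im_add (z w : R[i]) : complex.Im (z + w) = complex.Im z + complex.Im w.
Proof. by case: z; case: w. Qed.

Context d (T : measurableType d).
Implicit Types f g : T -> R[i].

Let mRe f : measurable_fun [set: T] f -> measurable_fun [set: T] (fun w => complex.Re (f w)).
Proof. by move=> mf; exact: (measurableT_comp measurable_Re mf). Qed.
Let mIm f : measurable_fun [set: T] f -> measurable_fun [set: T] (fun w => complex.Im (f w)).
Proof. by move=> mf; exact: (measurableT_comp measurable_Im mf). Qed.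

Lemma measurable_addc f g : measurable_fun [set: T] f -> measurable_fun [set: T] g ->
  measurable_fun [set: T] (fun w => f w + g w).
Proof.
move=> mf mg; apply: measurable_complexP.
- under eq_fun do rewrite Re_add; apply: measurable_funD; exact: mRe.
- under eq_fun do rewrite Im_add; apply: measurable_funD; exact: mIm.
Qed.

Lemma measurable_oppc f : measurable_fun [set: T] f ->
  measurable_fun [set: T] (fun w => - f w).
Proof.
move=> mf; apply: measurable_complexP.
- have -> : (fun w => complex.Re (- f w)) = (fun w => - complex.Re (f w)).
    by apply/funext => w; case: (f w).
  by apply: measurable_funN; exact: mRe.
- have -> : (fun w => complex.Im (- f w)) = (fun w => - complex.Im (f w)).
    by apply/funext => w; case: (f w).
  by apply: measurable_funN; exact: mIm.
Qed.

Lemma measurable_subc f g : measurable_fun [set: T] f -> measurable_fun [set: T] g ->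
  measurable_fun [set: T] (fun w => f w - g w).
Proof. by move=> mf mg; apply: measurable_addc => //; exact: measurable_oppc. Qed.

Lemma measurable_mulc f g : measurable_fun [set: T] f -> measurable_fun [set: T] g ->
  measurable_fun [set: T] (fun w => f w * g w).
Proof.
move=> mf mg; apply: measurable_complexP.
- have -> : (fun w => complex.Re (f w * g w)) = (fun w =>
      complex.Re (f w) * complex.Re (g w) - complex.Im (f w) * complex.Im (g w)).
    by apply/funext => w; case: (f w); case: (g w).
  by apply: measurable_funB; apply: measurable_funM; (exact: mRe || exact: mIm).
- have -> : (fun w => complex.Im (f w * g w)) = (fun w =>
      complex.Re (f w) * complex.Im (g w) + complex.Im (f w) * complex.Re (g w)).
    by apply/funext => w; case: (f w); case: (g w).
  by apply: measurable_funD; apply: measurable_funM; (exact: mRe || exact: mIm).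
Qed.

Lemma measurable_invc f : measurable_fun [set: T] f ->
  measurable_fun [set: T] (fun w => (f w)^-1).
Proof.
move=> mf.
have mN : measurable_fun [set: T]
    (fun w => (complex.Re (f w) ^+ 2 + complex.Im (f w) ^+ 2)^-1).
  apply: measurable_funV; apply: measurable_funD; apply: measurable_funX.
    exact: mRe.
  exact: mIm.
apply: measurable_complexP.
- have -> : (fun w => complex.Re (f w)^-1) = (fun w =>
      complex.Re (f w) * (complex.Re (f w) ^+ 2 + complex.Im (f w) ^+ 2)^-1).
    by apply/funext => w; case: (f w).
  by apply: measurable_funM => //; exact: mRe.
- have -> : (fun w => complex.Im (f w)^-1) = (fun w =>
      - (complex.Im (f w) * (complex.Re (f w) ^+ 2 + complex.Im (f w) ^+ 2)^-1)).
    by apply/funext => w; case: (f w).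
  by apply: measurable_funN; apply: measurable_funM => //; exact: mIm.
Qed.

Lemma measurable_sumc (I : Type) (r : seq I) (F : I -> T -> R[i]) :
  (forall i, measurable_fun [set: T] (F i)) ->
  measurable_fun [set: T] (fun w => \sum_(i <- r) F i w).
Proof.
move=> mF; elim: r => [|a r IH].
  under eq_fun do rewrite big_nil.
  exact: measurable_cst.
under eq_fun do rewrite big_cons.
exact: measurable_addc.
Qed.

Lemma measurable_normc f : measurable_fun [set: T] f ->
  measurable_fun [set: T] (fun w => normc (f w)).
Proof.
move=> mf.
have -> : (fun w => normc (f w)) =
    (fun w => (complex.Re (f w) ^+ 2 + complex.Im (f w) ^+ 2) `^ (2^-1)).
  by apply/funext => w; rewrite powR12_sqrt ?addr_ge0 ?sqr_ge0//; case: (f w).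
apply: (measurableT_comp (measurable_powR _)).
by apply: measurable_funD; apply: measurable_funX; [exact: mRe|exact: mIm].
Qed.

Lemma measurable_root_poly (X : nat -> T -> R[i]) (Z : T -> R[i]) n :
  (forall i, measurable_fun [set: T] (X i)) -> measurable_fun [set: T] Z ->
  measurable_fun [set: T] (fun w => (root_poly (fun i => X i w) n).[Z w]) /\
  measurable_fun [set: T] (fun w => (root_poly (fun i => X i w) n)^`().[Z w]).
Proof.
move=> mX mZ; have S x k : root_poly x k.+1 = root_poly x k * ('X - (x k)%:P) :> {poly R[i]}.
  by rewrite /root_poly big_ord_recr.
elim: n => [|n [IH IH']].
  split.
    under eq_fun do rewrite /root_poly big_ord0 hornerC.
    exact: measurable_cst.
  under eq_fun do rewrite /root_poly big_ord0 derivC hornerC.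
  exact: measurable_cst.
have mn : measurable_fun [set: T] (fun w => Z w - X n w) by exact: measurable_subc.
split.
  under eq_fun do rewrite S hornerM hornerXsubC.
  exact: measurable_mulc.
under eq_fun do rewrite S derivM derivXsubC mulr1 hornerD hornerM hornerXsubC.
by apply: measurable_addc => //; exact: measurable_mulc.
Qed.

End complex_measurability.

Section normc_coords.
Context {R : realType}.
Notation normc := (@Normc.normc R).

Lemma sqnorm_coords (z : R[i]) : sqnorm (coords z) = normc z ^+ 2.
Proof.
by case: z => a b; rewrite /= sqr_sqrtr// addr_ge0 ?sqr_ge0.
Qed.

Lemma coordsB (z w : R[i]) : coords (z - w) = coords z - coords w.
Proof. by case: z; case: w. Qed.

Lemma ln_sqnorm (z : R * R) (w : R[i]) :
  ln (sqnorm (z - coords w)) = 2 * ln (normc (cplx z - w)).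
Proof.
rewrite -{1}[z]cplxK -coordsB sqnorm_coords; set u := _ - w.
have [->|u0] := eqVneq u 0; first by rewrite Normc.normc0 expr0n/= ln0// mulr0.
by rewrite lnXn ?normc_gt0// mulr2n; ring.
Qed.

Lemma norm_coords_le (z : R[i]) : `|coords z| <= normc z.
Proof.
case: z => a b; rewrite prod_normE/= ge_max; apply/andP; split.
  by rewrite -[leLHS]sqrtr_sqr ler_wsqrtr// lerDl sqr_ge0.
by rewrite -[leLHS]sqrtr_sqr ler_wsqrtr// lerDr sqr_ge0.
Qed.

Lemma invr_normc_le (z c : R[i]) : (normc (c - z))^-1 <=
  1 + (if `|coords z - coords c| < 1 then `|coords z - coords c|^-1 else 0).
Proof.
rewrite -normcN opprB -coordsB; set u := z - c.
have [->|u0] := eqVneq u 0.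
  by rewrite Normc.normc0 invr0; case: ifP => _; rewrite ?addr0// addr_ge0 ?invr_ge0.
have nu := normc_gt0 u0.
have cu : 0 < `|coords u|.
  by rewrite normr_gt0; apply: contra u0 => /eqP h; rewrite -[u]coordsK h.
apply: (@le_trans _ _ (`|coords u|^-1)).
  by rewrite lef_pV2 ?posrE// norm_coords_le.
case: ifPn => [_|]; first by rewrite lerDr.
by rewrite -leNgt addr0 => h; rewrite invf_le1.
Qed.

End normc_coords.

Section error_term.
Context {R : realType}.
Notation normc := (@Normc.normc R).
Notation TR := (measurableTypeR R).

(* The last summand isolates the point [x n.-1], which for random points is
   independent of the sum over the others; when that sum vanishes, [0^-1 = 0]
   turns the summand into [(normc (z - x n.-1))^-1]. *)
Definition error_term (x : nat -> R[i]) (n : nat) (z : R[i]) : R :=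
  (\sum_(i < n) (normc (z - x i))^-1) / n%:R + ln n%:R + 1 +
  3 * normc (z - x n.-1) +
  (normc (z - x n.-1 + (\sum_(i < n.-1) (z - x i)^-1)^-1))^-1.

Lemma error_term_ge0 x n z : (0 < n)%N -> 0 <= error_term x n z.
Proof.
move=> n0; have nc := @normc_ge0 R.
have l0 : 0 <= ln (n%:R : R) by rewrite ln_ge0// ler1n.
have s0 : 0 <= \sum_(i < n) (normc (z - x i))^-1.
  by apply: sumr_ge0 => i _; rewrite invr_ge0.
rewrite /error_term !addr_ge0// ?mulr_ge0// ?invr_ge0//.
Qed.

(** The upper bound is [ln t <= t] with the triangle inequality. The lower bound is
    [ln_normc_inv_add] with the last point singled out. Each uses some of the nonnegative terms of
    [error_term]. *)
Lemma ln_normc_sum_inv_le x n z : (0 < n)%N ->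
  (forall i, (i < n)%N -> z != x i) -> \sum_(i < n) (z - x i)^-1 != 0 ->
  `|ln (normc (\sum_(i < n) (z - x i)^-1) / n%:R)| <= error_term x n z.
Proof.
case: n => // m _ zx q0; have nc := @normc_ge0 R.
set q := \sum_(i < m.+1) _ in q0 *.
have n0 : (0 : R) < m.+1%:R by rewrite ltr0n.
have l0 : 0 <= ln (m.+1%:R : R) by rewrite ln_ge0// ler1n.
have s0 : 0 <= \sum_(i < m.+1) (normc (z - x i))^-1.
  by apply: sumr_ge0 => i _; rewrite invr_ge0.
have sn0 : 0 <= (\sum_(i < m.+1) (normc (z - x i))^-1) / m.+1%:R by rewrite divr_ge0// ltW.
have qn := normc_gt0 q0.
have i0 : 0 <= (normc (z - x m + (\sum_(i < m) (z - x i)^-1)^-1))^-1 by rewrite invr_ge0.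
have c0 := nc (z - x m).
pose S := (\sum_(i < m.+1) (normc (z - x i))^-1) / m.+1%:R.
pose L := ln (m.+1%:R : R).
pose N := normc (z - x m).
pose I := (normc (z - x m + (\sum_(i < m) (z - x i)^-1)^-1))^-1.
have eE : error_term x m.+1 z = S + L + 1 + 3 * N + I by [].
rewrite -/S in sn0; rewrite -/L in l0; rewrite -/N in c0; rewrite -/I in i0.
rewrite eE ler_norml; apply/andP; split; last first.
  have h1 : ln (normc q / m.+1%:R) <= normc q / m.+1%:R.
    by apply/ltW/ln_sublinear; rewrite divr_gt0.
  have h2 : normc q / m.+1%:R <= (\sum_(i < m.+1) (normc (z - x i))^-1) / m.+1%:R.
    rewrite ler_wpM2r ?invr_ge0 ?(ltW n0)//; apply: (le_trans (normc_sum _ _)).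
    by apply: ler_sum => i _; rewrite Normc.normcV.
  apply: (le_trans h1); apply: (le_trans h2); rewrite -/S.
  by lra.
have zm : z - x m != 0 by rewrite subr_eq0 zx.
have qE : q = (z - x m)^-1 + \sum_(i < m) (z - x i)^-1.
  by rewrite /q big_ord_recr/= addrC.
have := ln_normc_inv_add zm; rewrite qE in q0 qn *.
move=> /(_ _ q0); rewrite -/N -/I => h.
by rewrite ln_div ?posrE// -/L; lra.
Qed.

Lemma measurable_error_term d (S : measurableType d) (x : nat -> S -> R[i])
    (z : S -> R[i]) n : (forall i, measurable_fun [set: S] (x i)) ->
  measurable_fun [set: S] z ->
  measurable_fun [set: S] (fun w => error_term (fun i => x i w) n (z w)).
Proof.
move=> mx mz.
have mzx i : measurable_fun [set: S] (fun w => z w - x i w) by exact: measurable_subc.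
apply: measurable_funD; last first.
  apply: measurable_funV; apply: measurable_normc; apply: measurable_addc => //.
  by apply: measurable_invc; apply: measurable_sumc => i; exact: measurable_invc.
apply: measurable_funD; last by apply: measurable_funM => //; exact: measurable_normc.
apply: measurable_funD => //; apply: measurable_funD => //.
apply: measurable_funM => //; apply: measurable_sum => i.
by apply: measurable_funV; exact: measurable_normc.
Qed.

End error_term.

Section error_expectation.
Context (R : realType) (d : measure_display) (T : measurableType d).
Context (P : probability T R) (X : nat -> {RV P >-> R[i]}).
Notation normc := (@Normc.normc R).
Notation TR := (measurableTypeR R).
Hypotheses (indX : mutually_independent X) (idX : identically_distributed X).
Context (f : R[i] -> R) (M : R).
Hypothesis densX : has_density (@complex_lebesgue R) (X 0%N) f.
Hypothesis fM : forall z, f z <= M.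
Hypothesis momX : ('E_P[fun w => Normc.normc (X 0%N w)] < +oo)%E.

Let mX i : measurable_fun [set: T] (X i : T -> R[i]). Proof. by []. Qed.

Let M0 : 0 <= M.
Proof. by have [_ f0 _] := densX; exact: le_trans (f0 0) (fM 0). Qed.

Let int_cst (k : R) : (\int[P]_w k%:E = k%:E)%E.
Proof. by rewrite (ExE (itg_cst P k)) Ex_cst. Qed.

Let U (w : T) : TR * TR := coords (X 0%N w).
Let mU : measurable_fun [set: T] U.
Proof. exact: (measurableT_comp (@measurable_coords R)). Qed.

(** The max-norm ball is a square of area [4 * r ^+ 2], on which the density is at most [M]. *)
Lemma law_ball_le (c : R * R) (r : R) : 0 < r ->
  (pushforward_measure P mU [set z | (`|z - c| < r)%R] <= (4 * M * r ^+ 2)%:E)%E.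
Proof.
move=> r0; have [mf f0 densE] := densX.
pose A : set R[i] := [set z | `|coords z - c| < r].
have mA : measurable A.
  rewrite -[X in measurable X]setTI.
  exact: (@measurable_coords R measurableT _ (measurable_prod_ball c r)).
have -> : pushforward_measure P mU [set z | (`|z - c| < r)%R] = distribution P (X 0%N) A by [].
rewrite densE//.
apply: (@le_trans _ _ (\int[@complex_lebesgue R]_(x in A) (cst M%:E) x)%E).
  apply: ge0_le_integral => //.
  - by move=> x _; rewrite lee_fin.
  - by apply/measurable_EFinP; exact: measurable_funTS.
  - by move=> x _; rewrite lee_fin.
rewrite integral_cst// -[X in (_ * X)%E]/((lebesgue_measure \x lebesgue_measure)%E
  [set z : TR * TR | `|coords (cplx z) - c| < r]).
have -> : [set z : TR * TR | `|coords (cplx z) - c| < r] = [set z : TR * TR | `|z - c| < r].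
  by apply/seteqP; split => z /=; rewrite cplxK.
rewrite le_eqVlt; apply/orP; left; apply/eqP.
rewrite (_ : (_ * _)%E = M%:E * (4 * r ^+ 2)%:E)%E.
  by rewrite -EFinM; congr (_%:E); ring.
by congr (_ * _)%E; exact: lebesgue_measure_prod_ball.
Qed.

(** The 1 accounts for points at distance at least 1; [4 * (4 * M)] is [integral_inverse_dist] with
    the ball constant [4 * M]. *)
Definition inverse_moment : R := 1 + 4 * (4 * M).

Lemma inverse_moment_le (i : nat) (c : R[i]) :
  (\int[P]_w ((normc (c - X i w))^-1)%:E <= inverse_moment%:E)%E.
Proof.
have mg : measurable_fun [set: R[i]] (fun x : R[i] => ((normc (c - x))^-1)%:E).
  apply/measurable_EFinP; apply: measurable_funV; apply: measurable_normc.
  by apply: measurable_subc => //; exact: measurable_id.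
have g0 (x : R[i]) : (0 <= ((normc (c - x))^-1)%:E)%E.
  by rewrite lee_fin invr_ge0 normc_ge0.
rewrite (ge0_ident_integral idX i 0%N mg g0).
pose I (u : TR * TR) : R := if `|u - coords c| < 1 then `|u - coords c|^-1 else 0.
have I0 u : 0 <= I u by rewrite /I; case: ifP => // _; rewrite invr_ge0.
have mI : measurable_fun [set: TR * TR] I.
  apply: measurable_fun_ifT => //.
    by apply: measurable_fun_ltr => //; exact: measurable_prod_dist.
  by apply: measurable_funV; exact: measurable_prod_dist.
have mIU : measurable_fun [set: T] (fun w => (I (U w))%:E).
  by apply/measurable_EFinP; exact: measurableT_comp.
apply: (@le_trans _ _ (\int[P]_w (1%:E + (I (U w))%:E))%E).
  apply: ge0_le_integral => //.
  - exact: (measurableT_comp mg).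
  - exact: (emeasurable_funD (measurable_cst _) mIU).
  - by move=> w _; rewrite -EFinD lee_fin; exact: invr_normc_le.
rewrite ge0_integralD//; last by move=> w _; rewrite lee_fin.
rewrite int_cst /inverse_moment EFinD leeD2l//.
have A0 : 0 <= 4 * M by rewrite mulr_ge0.
have mIE : measurable_fun [set: TR * TR] (fun u => (I u)%:E) by exact/measurable_EFinP.
have IE0 (u : TR * TR) : (0 <= (I u)%:E)%E by rewrite lee_fin.
apply: le_trans (integral_inverse_dist A0 law_ball_le (coords c)).
by rewrite -[leRHS]/(\int[pushforward P U]_u (I u)%:E)%E (ge0_integral_pushforward mU).
Qed.

Definition first_moment : R := fine 'E_P[fun w => normc (X 0%N w)].

Lemma first_momentE i : (\int[P]_w (normc (X i w))%:E = first_moment%:E)%E.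
Proof.
have mn : measurable_fun [set: R[i]] (fun x : R[i] => (normc x)%:E).
  by apply/measurable_EFinP; apply: measurable_normc; exact: measurable_id.
rewrite (ge0_ident_integral idX i 0%N mn); last by move=> x; rewrite lee_fin normc_ge0.
rewrite /first_moment; move: momX; rewrite unlock => h.
rewrite fineK// ge0_fin_numE//; apply: integral_ge0 => w _.
by rewrite lee_fin normc_ge0.
Qed.

(** One [inverse_moment] pays for the mean of the inverse distances, the other for the last
    summand. *)
Lemma error_term_expectation (n : nat) (z : R[i]) : (0 < n)%N ->
  (\int[P]_w (error_term (fun i => X i w) n z)%:E <=
   (2 * inverse_moment + ln n%:R + 1 + 3 * (normc z + first_moment))%:E)%E.
Proof.
case: n => // m _; set n := m.+1.
have n0 : (0 : R) < n%:R by rewrite ltr0n.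
have l0 : 0 <= ln (n%:R : R) by rewrite ln_ge0// ler1n.
have nc := @normc_ge0 R.
have mzx i : measurable_fun [set: T] (fun w => z - X i w) by exact: measurable_subc.
have mi i : measurable_fun [set: T] (fun w => ((normc (z - X i w))^-1)%:E).
  by apply/measurable_EFinP; apply: measurable_funV; exact: measurable_normc.
pose t1 w := (\sum_(i < n) ((normc (z - X i w))^-1)%:E)%E.
pose t4 w := (normc (z - X m w))%:E.
pose t5 w := ((normc (z - X m w + (\sum_(i < m) (z - X i w)^-1)^-1))^-1)%:E.
have mt1 : measurable_fun [set: T] t1 by apply: emeasurable_sum => i.
have mt4 : measurable_fun [set: T] t4 by apply/measurable_EFinP; exact: measurable_normc.
have mt5 : measurable_fun [set: T] t5.
  apply/measurable_EFinP; apply: measurable_funV; apply: measurable_normc.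
  apply: measurable_addc => //; apply: measurable_invc; apply: measurable_sumc => i.
  exact: measurable_invc.
have p1 w : (0 <= t1 w)%E by apply: sume_ge0 => i _; rewrite lee_fin invr_ge0.
have p4 w : (0 <= t4 w)%E by rewrite lee_fin.
have p5 w : (0 <= t5 w)%E by rewrite lee_fin invr_ge0.
have -> : (fun w => (error_term (fun i => X i w) n z)%:E) = (fun w =>
    ((n%:R^-1)%:E * t1 w + (ln n%:R + 1)%:E + 3%:E * t4 w + t5 w)%E).
  apply/funext => w; rewrite /error_term /t1 /t4 /t5 /= sumEFin -!EFinM -!EFinD.
  by congr (_%:E); ring.
have ni0 : 0 <= n%:R^-1 :> R by rewrite invr_ge0 ltW.
have mm1 : measurable_fun [set: T] (fun w => (n%:R^-1)%:E * t1 w)%E.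
  by apply: emeasurable_funM.
have mm4 : measurable_fun [set: T] (fun w => 3%:E * t4 w)%E by apply: emeasurable_funM.
have l1 : (0 <= (ln n%:R + 1 : R)%:E)%E by rewrite lee_fin addr_ge0.
have q1 w : (0 <= (n%:R^-1)%:E * t1 w)%E by rewrite mule_ge0.
have q4 w : (0 <= 3%:E * t4 w)%E by rewrite mule_ge0.
have qa w : (0 <= (n%:R^-1)%:E * t1 w + (ln n%:R + 1)%:E)%E by rewrite adde_ge0.
have ma : measurable_fun [set: T] (fun w => (n%:R^-1)%:E * t1 w + (ln n%:R + 1)%:E)%E.
  by apply: emeasurable_funD.
have qb w : (0 <= (n%:R^-1)%:E * t1 w + (ln n%:R + 1)%:E + 3%:E * t4 w)%E.
  by rewrite adde_ge0.
have mb : measurable_fun [set: T]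
    (fun w => (n%:R^-1)%:E * t1 w + (ln n%:R + 1)%:E + 3%:E * t4 w)%E.
  by apply: emeasurable_funD.
rewrite (ge0_integralD P measurableT (fun w _ => qb w) mb (fun w _ => p5 w) mt5).
rewrite (ge0_integralD P measurableT (fun w _ => qa w) ma (fun w _ => q4 w) mm4).
rewrite (ge0_integralD P measurableT (fun w _ => q1 w) mm1 (fun w _ => l1)
  (measurable_cst _)) int_cst.
rewrite ge0_integralZl// ge0_integralZl//.
have b1 : (\int[P]_w t1 w <= n%:R%:E * inverse_moment%:E)%E.
  rewrite ge0_integral_sum//; last by move=> i w _; rewrite lee_fin invr_ge0.
  apply: (@le_trans _ _ (\sum_(i < n) inverse_moment%:E)%E).
    by apply: lee_sum => i _; exact: inverse_moment_le.
  by rewrite sumEFin sumr_const card_ord -EFinM mulr_natl.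
have b4 : (\int[P]_w t4 w <= (normc z + first_moment)%:E)%E.
  apply: (@le_trans _ _ (\int[P]_w ((normc z)%:E + (normc (X m w))%:E))%E).
    apply: ge0_le_integral => //.
    - by apply: emeasurable_funD => //; apply/measurable_EFinP; exact: measurable_normc.
    - move=> w _; rewrite -EFinD lee_fin; apply: (le_trans (le_normcD _ _)).
      by rewrite normcN.
  have mXm : measurable_fun [set: T] (fun w => (normc (X m w))%:E).
    by apply/measurable_EFinP; exact: measurable_normc.
  have cz0 : (0 <= (normc z)%:E :> \bar R)%E by rewrite lee_fin.
  have cX0 w : (0 <= (normc (X m w))%:E :> \bar R)%E by rewrite lee_fin.
  rewrite (ge0_integralD P measurableT (fun w _ => cz0) (measurable_cst _)
    (fun w _ => cX0 w) mXm).
  by rewrite int_cst first_momentE EFinD.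
(* Given the past, the inverted sum is a constant that merely shifts the centre, and
   [inverse_moment_le] is uniform in the centre. *)
have b5 : (\int[P]_w t5 w <= inverse_moment%:E)%E.
  pose past := g_sigma_algebraType (past_cylinders X m).
  pose F (p : past * R[i]) : \bar R :=
    ((normc (z - p.2 + (\sum_(i < m) (z - X i p.1)^-1)^-1))^-1)%:E.
  have mF : measurable_fun [set: past * R[i]] F.
    apply/measurable_EFinP; apply: measurable_funV; apply: measurable_normc.
    apply: measurable_addc; first by apply: measurable_subc.
    apply: measurable_invc; apply: measurable_sumc => i.
    apply: measurable_invc; apply: measurable_subc => //.
    have mp : measurable_fun [set: past] (X i : past -> R[i]) by exact: measurable_past.
    exact: (measurableT_comp mp measurable_fst).
  have F0 p : (0 <= F p)%E by rewrite lee_fin invr_ge0.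
  have -> : (\int[P]_w t5 w = \int[P]_w F (w, X m w))%E by [].
  rewrite (indep_integral indX mF F0).
  apply: (@le_trans _ _ (\int[P]_w (cst inverse_moment%:E w))%E); last first.
    by rewrite int_cst.
  have mFm := indep_measurable mF F0.
  apply: ge0_le_integral => //.
  - by move=> w _; exact: integral_ge0.
  - move=> w _; rewrite /F/=.
    under eq_integral do rewrite addrAC.
    exact: inverse_moment_le.
have E : (2 * inverse_moment + ln n%:R + 1 + 3 * (normc z + first_moment))%:E =
  (inverse_moment%:E + (ln n%:R + 1)%:E + 3%:E * (normc z + first_moment)%:E + inverse_moment%:E)%E.
  by rewrite -!EFinM -!EFinD; congr (_%:E); ring.
rewrite E; apply: leeD => //; apply: leeD; last by apply: lee_wpmul2l.
apply: leeD => //; apply: (le_trans (lee_wpmul2l _ b1)) => //.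
by rewrite -!EFinM mulKf// lt0r_neq0.
Qed.

End error_expectation.

Section plane_lebesgue.
Context (R : realType).
Notation TR := (measurableTypeR R).

(* An alias because the canonical sigma-finite structure of a product measure
   only applies to products of probabilities. *)
Definition lebesgue2 : set (TR * TR) -> \bar R :=
  (@lebesgue_measure R \x @lebesgue_measure R)%E.

HB.instance Definition _ := Measure.on lebesgue2.

Let lebesgue2_sigma_finite : sigma_finite setT lebesgue2.
Proof.
exists (fun n => @square R n.+1%:R).
  apply/esym/seteqP; split => // z _.
  have [n hn] : exists n : nat, `|z| < n%:R.
    exists (Num.truncn `|z|).+1; exact: truncnS_gt.
  exists n => //; apply: contrapT => /notin_square; apply/negP; rewrite -ltNge.
  by rewrite (lt_le_trans hn)// ler_nat.
by move=> n; split; [exact: measurable_square|exact: square_finite].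
Qed.

HB.instance Definition _ :=
  Measure_isSigmaFinite.Build _ _ _ lebesgue2 lebesgue2_sigma_finite.

End plane_lebesgue.

Section linear_statistic.
Context {R : realType}.
Notation normc := (@Normc.normc R).
Notation TR := (measurableTypeR R).
Notation mu := (@lebesgue_measure R).
Notation mu2 := (mu \x mu)%E.
Context (phi : R[i] -> R) (fx fy fxx fyy : R * R -> R) (B : R).
Hypothesis phiC2 : C2_partials (phi \o @cplx R) fx fy fxx fyy B.

Let lap z := fxx z + fyy z.
Let C0 := @potential_constant R.
Let C0_gt0 : 0 < C0. Proof. exact: potential_constant_gt0. Qed.

Let clap : continuous lap.
Proof. by move=> z; apply: cvgD; [exact: (C2_cxx phiC2)|exact: (C2_cyy phiC2)]. Qed.
Let lap0 z : B <= `|z| -> lap z = 0.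
Proof. by move=> /(C2_supp phiC2)[_ _ _ + +]; rewrite /lap => -> ->; rewrite addr0. Qed.
Let mlap : measurable_fun [set: TR * TR] lap.
Proof. exact: continuous_measurable_prod. Qed.

Lemma measurable_test_function : measurable_fun [set: R[i]] phi.
Proof.
have -> : phi = (phi \o @cplx R) \o coords by apply/funext => z /=; rewrite coordsK.
have mg : measurable_fun [set: TR * TR] (phi \o @cplx R).
  by apply: continuous_measurable_prod; exact: (C2_cf phiC2).
exact: (measurableT_comp mg (@measurable_coords R)).
Qed.

Lemma test_function_bounded : exists M, forall z, `|phi z| <= M.
Proof.
have f0 z : B <= `|z| -> (phi \o @cplx R) z = 0 by case/(C2_supp phiC2).
have [M hM] := continuous_support_bounded (C2_cf phiC2) f0.
by exists M => z; rewrite -(coordsK z); exact: hM.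
Qed.

Lemma log_potential_sum (s : seq R[i]) :
  mu2.-integrable [set: TR * TR]
    (EFin \o (fun z => lap z * \sum_(w <- s) (2 * ln (normc (cplx z - w))))) /\
  (\int[mu2]_z (lap z * \sum_(w <- s) (2 * ln (normc (cplx z - w))))%:E =
   (C0 * \sum_(w <- s) phi w)%:E)%E.
Proof.
elim: s => [|a s [IHi IHe]].
  have E : (fun z : TR * TR => (lap z * \sum_(w <- [::]) (2 * ln (normc (cplx z - w))))%:E) =
      cst 0%E.
    by apply/funext => z; rewrite big_nil mulr0.
  rewrite big_nil mulr0; split; last by rewrite E integral_cst// mul0e.
  rewrite /comp E; exact: integrable0.
have [ia ea] := logarithmic_potential phiC2 (coords a).
have ia' : mu2.-integrable [set: TR * TR]
    (EFin \o (fun z => lap z * (2 * ln (normc (cplx z - a))))).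
  move: ia; rewrite -/lap; congr (_.-integrable _ _); apply/funext => z /=.
  by rewrite ln_sqnorm.
have ea' : (\int[mu2]_z (lap z * (2 * ln (normc (cplx z - a))))%:E = (C0 * phi a)%:E)%E.
  move: ea; rewrite /= coordsK => <-; apply: eq_integral => z _.
  by rewrite ln_sqnorm.
have E : (fun z : TR * TR => (lap z * \sum_(w <- a :: s) (2 * ln (normc (cplx z - w))))%:E) =
    (fun z => ((lap z * (2 * ln (normc (cplx z - a))))%:E +
      (lap z * \sum_(w <- s) (2 * ln (normc (cplx z - w))))%:E)%E).
  by apply/funext => z; rewrite big_cons mulrDr EFinD.
split; first by rewrite /comp E; exact: integrableD.
by rewrite E integralD//= ea' IHe big_cons mulrDr.
Qed.

Lemma ae_notin_seq (s : seq R[i]) : {ae mu2, forall z : TR * TR, cplx z \notin s}.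
Proof.
elim: s => [|a s IH]; first exact: aeW.
apply: filterS2 IH (negligible_point (coords a)) => z zs za.
rewrite inE negb_or zs andbT; apply: contra za => /eqP <-.
by rewrite cplxK.
Qed.

Definition discrepancy (x : nat -> R[i]) n : R :=
  \sum_(w <- critical_points x n) phi w - \sum_(i < n) phi (x i).

(** Lists the zeros as a sequence, so that [log_potential_sum] serves zeros and critical points
    alike. *)
Let ptmap (x : nat -> R[i]) n : seq R[i] := map (fun i : 'I_n => x i) (index_enum 'I_n).

Let measurable_cplxT : measurable_fun [set: TR * TR] (@cplx R).
Proof. exact: measurable_cplx. Qed.

Let measurable_err x n : measurable_fun [set: TR * TR]
  (fun z => `|lap z| * (2 * error_term x n (cplx z))).
Proof.
apply: measurable_funM; first exact: measurableT_comp.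
apply: measurable_funM => //; exact: measurable_error_term.
Qed.

(** Subtract the two potential formulas: for almost every [z], neither a zero nor a critical point,
    the integrand is [lap z] times twice the logarithm of [log_derivative_formula]. *)
Lemma discrepancy_le x n : (0 < n)%N ->
  ((C0 * `|discrepancy x n|)%:E <=
   \int[mu2]_z (`|lap z| * (2 * error_term x n (cplx z)))%:E)%E.
Proof.
move=> n0.
have [i1 e1] := log_potential_sum (critical_points x n).
have [i2 e2] := log_potential_sum (ptmap x n).
pose h (z : TR * TR) : R := lap z * \sum_(w <- critical_points x n) (2 * ln (normc (cplx z - w))) -
  lap z * \sum_(w <- ptmap x n) (2 * ln (normc (cplx z - w))).
have ih : mu2.-integrable [set: TR * TR] (EFin \o h) by exact: (integrableB measurableT i1 i2).
have eh : (\int[mu2]_z (h z)%:E = (C0 * discrepancy x n)%:E)%E.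
  under eq_integral do rewrite /h EFinB.
  by rewrite (integralB measurableT i1 i2) e1 e2 -EFinB -mulrBr /ptmap big_map.
have -> : ((C0 * `|discrepancy x n|)%:E = `|\int[mu2]_z (h z)%:E|)%E.
  by rewrite eh /= normrM gtr0_norm.
apply: (le_trans (le_abse_integral _ measurableT _)).
  exact: (measurable_int _ ih).
apply: ae_ge0_le_integral => //.
- by apply: measurableT_comp => //; exact: (measurable_int _ ih).
- by move=> z _; rewrite lee_fin !mulr_ge0// error_term_ge0.
- exact/measurable_EFinP.
apply: filterS2 (ae_notin_seq (critical_points x n)) (ae_notin_seq (ptmap x n)) => z zc zx _.
rewrite /= lee_fin /h -mulrBr normrM ler_wpM2l//.
have zx' i : (i < n)%N -> cplx z != x i.
  move=> lin; apply: contra zx => /eqP ->.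
  by apply/mapP; exists (Ordinal lin) => //; rewrite mem_index_enum.
have [q0 E] := log_derivative_formula n0 zx' zc.
rewrite -!mulr_sumr -mulrBr /ptmap big_map E normrM ger0_norm// ler_wpM2l//.
exact: ln_normc_sum_inv_le.
Qed.

Section random.
Context (d : measure_display) (T : measurableType d).
Context (P : probability T R) (X : nat -> {RV P >-> R[i]}).

Let S n (w : T) : R := \sum_(z <- critical_points (fun i => X i w) n) phi z.

Let mX i : measurable_fun [set: T] (X i : T -> R[i]). Proof. by []. Qed.

(* The roots come in an unspecified order, so measurability is read off the
   representation of their linear statistic by a logarithmic potential. *)
Lemma measurable_linear_statistic n : measurable_fun [set: T] (S n).
Proof.
case: n => [|n].
  (* For [n = 0] the polynomial is 1, and the statistic is constant in [w] whatever the root list of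
     the zero polynomial is. *)
  rewrite /S /critical_points.
  have -> : (fun w : T => \sum_(z <- roots_of (root_poly (fun i => X i w) 0)^`()) phi z) =
      cst (\sum_(z <- roots_of (1 : {poly R[i]})^`()) phi z).
    by apply/funext => w; rewrite /root_poly big_ord0.
  exact: measurable_cst.
set m := n.+1; have m0 : (0 < m)%N by [].
(* The derivative at a point is jointly measurable in the point and the sample, and involves no
   choice of roots. *)
pose V (p : (TR * TR) * T) : R :=
  lap p.1 * (2 * ln (normc ((root_poly (fun i => X i p.2) m)^`().[cplx p.1] / m%:R))).
have mV : measurable_fun [set: (TR * TR) * T] V.
  apply: measurable_funM; first exact: (measurableT_comp mlap measurable_fst).
  apply: measurable_funM => //; apply: (measurableT_comp (@measurable_ln R)).
  apply: measurable_normc; apply: measurable_mulc; last exact: measurable_cst.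
  have mXp i : measurable_fun [set: (TR * TR) * T] (fun p => X i p.2).
    exact: (measurableT_comp (mX i) measurable_snd).
  have mZp : measurable_fun [set: (TR * TR) * T] (fun p => cplx p.1).
    exact: (measurableT_comp measurable_cplxT measurable_fst).
  by have [_] := measurable_root_poly m mXp mZp.
have mVw w : measurable_fun [set: TR * TR] (fun z => V (z, w)).
  exact: (measurableT_comp mV (measurable_pair2 w)).
have EV w : (\int[mu2]_z (V (z, w))%:E = (C0 * S m w)%:E)%E.
  have [i1 <-] := log_potential_sum (critical_points (fun i => X i w) m).
  apply: ae_eq_integral => //.
  - exact/measurable_EFinP.
  - exact: (measurable_int _ i1).
  apply: filterS (ae_notin_seq (critical_points (fun i => X i w) m)) => z zc _.
  by rewrite /V/= ln_normc_deriv_root_poly// mulr_sumr.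
have mVE : measurable_fun [set: (TR * TR) * T] (EFin \o V) by exact/measurable_EFinP.
have mI : measurable_fun [set: T] (fun w => \int[mu2]_z (V (z, w))%:E)%E.
  (* Measurability of a parameter integral comes from Tonelli, for nonnegative integrands, hence the
     two parts. *)
  have -> : (fun w => \int[mu2]_z (V (z, w))%:E)%E =
      (fun w => (\int[mu2]_z ((EFin \o V)^\+ (z, w))) - (\int[mu2]_z ((EFin \o V)^\- (z, w))))%E.
    apply/funext => w; rewrite [LHS]integralE.
    by congr (_ - _)%E; apply: eq_integral => z _; rewrite ?funeposE ?funenegE.
  apply: emeasurable_funB.
  - exact: (@measurable_fun_fubini_tonelli_G _ _ (TR * TR)%type T R (@lebesgue2 R)
      (EFin \o V)^\+%E (measurable_funepos mVE) (fun p => funepos_ge0 _ p)).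
  - exact: (@measurable_fun_fubini_tonelli_G _ _ (TR * TR)%type T R (@lebesgue2 R)
      (EFin \o V)^\-%E (measurable_funeneg mVE) (fun p => funeneg_ge0 _ p)).
have -> : S m = (fun w => C0^-1 * fine (\int[mu2]_z (V (z, w))%:E)%E).
  by apply/funext => w; rewrite EV/= mulKf// lt0r_neq0.
apply: measurable_funM => //; apply: measurableT_comp mI; exact: fine_measurable.
Qed.

Let D n (w : T) : R := discrepancy (fun i => X i w) n.

Lemma measurable_discrepancy n : measurable_fun [set: T] (D n).
Proof.
apply: measurable_funB; first exact: measurable_linear_statistic.
by apply: measurable_sum => i; apply: measurableT_comp (mX i); exact: measurable_test_function.
Qed.

Hypotheses (indX : mutually_independent X) (idX : identically_distributed X).
Context (f : R[i] -> R) (M : R).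
Hypothesis densX : has_density (@complex_lebesgue R) (X 0%N) f.
Hypothesis fM : forall z, f z <= M.
Hypothesis momX : ('E_P[fun w => Normc.normc (X 0%N w)] < +oo)%E.

(** Tonelli lets the expected error be taken at fixed [z]; its growth in [z] is harmless because
    [lap] has compact support. *)
Lemma discrepancy_expectation : exists2 A : R, 0 <= A & forall n, (0 < n)%N ->
  (\int[P]_w (`|D n w|)%:E <= (A * (1 + ln n%:R))%:E)%E.
Proof.
(* The part of the expected error free of [n] and [z], once [normc z] is replaced by the larger
   [1 + sqnorm z]; the remaining [3 * sqnorm z] goes into [I2]. *)
pose k := 2 * inverse_moment M + 1 + 3 * (1 + first_moment X).
have cs (h : R * R -> R) : continuous h ->
    mu2.-integrable [set: TR * TR] (EFin \o (fun z => `|lap z| * h z)).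
  move=> ch; apply: (@integrable_continuous_support _ _ B).
    by move=> z; apply: cvgM; [apply: cvg_norm; exact: clap|exact: ch].
  by move=> z /lap0 ->; rewrite normr0 mul0r.
pose I1 := fine (\int[mu2]_z (`|lap z| * 2)%:E)%E.
pose I2 := fine (\int[mu2]_z (`|lap z| * (6 * sqnorm z))%:E)%E.
have c2 : continuous (fun _ : R * R => 2 : R) by move=> z; exact: cvg_cst.
have c6 : continuous (fun z : R * R => 6 * sqnorm z : R).
  by move=> z; apply: cvgM; [exact: cvg_cst|exact: continuous_sqnorm].
have I1E : (\int[mu2]_z (`|lap z| * 2)%:E = I1%:E)%E.
  apply/esym/fineK; have := cs _ c2; exact: (@integrable_fin_num _ _ _ mu2 _ measurableT).
have I2E : (\int[mu2]_z (`|lap z| * (6 * sqnorm z))%:E = I2%:E)%E.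
  apply/esym/fineK; have := cs _ c6; exact: (@integrable_fin_num _ _ _ mu2 _ measurableT).
have I10 : 0 <= I1 by apply/fine_ge0/integral_ge0 => z _; rewrite lee_fin mulr_ge0.
have I20 : 0 <= I2.
  by apply/fine_ge0/integral_ge0 => z _; rewrite lee_fin !mulr_ge0// sqnorm_ge0.
exists (((1 + `|k|) * I1 + I2) / C0).
  by rewrite divr_ge0 ?(ltW C0_gt0)// addr_ge0// mulr_ge0.
move=> n n0.
have l0 : 0 <= ln (n%:R : R) by rewrite ln_ge0// ler1n.
pose F (p : T * (TR * TR)) : \bar R :=
  (`|lap p.2| * (2 * error_term (fun i => X i p.1) n (cplx p.2)))%:E.
have mF : measurable_fun [set: T * (TR * TR)] F.
  apply/measurable_EFinP; apply: measurable_funM.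
    by apply: measurableT_comp => //; exact: (measurableT_comp mlap measurable_snd).
  apply: measurable_funM => //; apply: measurable_error_term.
    by move=> i; exact: (measurableT_comp (mX i) measurable_fst).
  exact: (measurableT_comp measurable_cplxT measurable_snd).
have F0 p : (0 <= F p)%E by rewrite lee_fin !mulr_ge0// error_term_ge0.
have mD : measurable_fun [set: T] (fun w => (`|D n w|)%:E).
  by apply/measurable_EFinP; apply: measurableT_comp => //; exact: measurable_discrepancy.
have D0 w : (0 <= (`|D n w|)%:E :> \bar R)%E by rewrite lee_fin.
have step1 : (C0%:E * \int[P]_w (`|D n w|)%:E <= \int[P]_w \int[mu2]_z F (w, z))%E.
  rewrite -ge0_integralZl//; last by rewrite lee_fin ltW.
  apply: ge0_le_integral => //.
  - by move=> w _; rewrite mule_ge0// lee_fin ltW.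
  - exact: emeasurable_funM.
  - exact: (@measurable_fun_fubini_tonelli_F _ _ T (TR * TR)%type R (@lebesgue2 R) F mF F0).
  - by move=> w _; rewrite -EFinM; exact: discrepancy_le.
have step2 : (\int[P]_w \int[mu2]_z F (w, z) = \int[mu2]_z \int[P]_w F (w, z))%E.
  exact: (@fubini_tonelli _ _ T (TR * TR)%type R P (@lebesgue2 R) F mF F0).
have sz z : normc (cplx z) <= 1 + sqnorm z.
  have s0 := sqnorm_ge0 z.
  rewrite -[z in sqnorm z]cplxK sqnorm_coords; have := normc_ge0 (cplx z).
  by have := sqr_ge0 (normc (cplx z) - 2^-1); rewrite sqrrB; nra.
have k0 : 0 <= `|k| by [].
have step3 : (\int[mu2]_z \int[P]_w F (w, z) <=
    \int[mu2]_z ((`|k| + ln n%:R)%:E * (`|lap z| * 2)%:E + (`|lap z| * (6 * sqnorm z))%:E))%E.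
  apply: ge0_le_integral => //.
  - by move=> z _; exact: integral_ge0.
  - exact: (@measurable_fun_fubini_tonelli_G _ _ T (TR * TR)%type R P F mF F0).
  - apply: emeasurable_funD; last exact: (measurable_int _ (cs _ c6)).
    by apply: emeasurable_funM => //; exact: (measurable_int _ (cs _ c2)).
  - move=> z _; rewrite /F/=.
    under eq_integral do rewrite mulrA EFinM.
    have me : measurable_fun [set: T]
        (fun w => (error_term (fun i => X i w) n (cplx z))%:E).
      by apply/measurable_EFinP; apply: measurable_error_term => //; exact: measurable_cst.
    rewrite (ge0_integralZl P measurableT me)//; last first.
      by move=> w _; rewrite lee_fin error_term_ge0.
    have l0' : (0 <= (`|lap z| * 2)%:E :> \bar R)%E by rewrite lee_fin mulr_ge0.
    have := error_term_expectation indX idX densX fM momX (cplx z) n0.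
    move=> /(lee_wpmul2l l0') h; apply: (le_trans h).
    rewrite -!EFinM -EFinD lee_fin.
    have -> : (`|k| + ln n%:R) * (`|lap z| * 2) + `|lap z| * (6 * sqnorm z) =
      `|lap z| * 2 * (`|k| + ln n%:R + 3 * sqnorm z) by ring.
    rewrite ler_wpM2l ?mulr_ge0//; have := sz z; have := ler_norm k.
    rewrite {1}/k; lra.
have step4 : (\int[mu2]_z ((`|k| + ln n%:R)%:E * (`|lap z| * 2)%:E + (`|lap z| * (6 * sqnorm z))%:E)
    = ((`|k| + ln n%:R) * I1 + I2)%:E)%E.
  rewrite integralD//; last 2 first.
  - by apply: integrableZl => //; exact: cs.
  - exact: cs.
  by rewrite integralZl//= ?I1E ?I2E -?EFinM -?EFinD//; exact: cs.
have : (C0%:E * \int[P]_w (`|D n w|)%:E <= ((`|k| + ln n%:R) * I1 + I2)%:E)%E.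
  by rewrite (le_trans step1)// step2 (le_trans step3)// step4.
have iC0 : (0 <= C0^-1%:E :> \bar R)%E by rewrite lee_fin invr_ge0 ltW.
move=> /(lee_wpmul2l iC0) h; rewrite muleA -EFinM mulVf ?lt0r_neq0// mul1e in h.
apply: (le_trans h).
rewrite -EFinM lee_fin [leRHS]mulrAC [leRHS]mulrC.
rewrite ler_wpM2l ?invr_ge0 ?(ltW C0_gt0)//.
have : 0 <= `|k| * I1 * ln n%:R by rewrite !mulr_ge0.
have : 0 <= I2 * ln n%:R by rewrite !mulr_ge0.
lra.
Qed.

End random.

End linear_statistic.

(** * Convergence at rate [n^(-1/4)] and the limit theorem *)

Lemma cvg_fourth_root_rate {R : realType} (u : nat -> R) (l K : R) :
  (forall n, `|u n.+1 - l| <= K / Num.sqrt (Num.sqrt n.+1%:R)) ->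
  u n @[n --> \oo] --> l.
Proof.
move=> uK; rewrite -cvg_shiftS; apply/subr_cvg0/norm_cvg0P => /=.
have c0 : K * Num.sqrt (Num.sqrt (harmonic n)) @[n --> \oo] --> (0 : R).
  rewrite -[X in _ --> X](mulr0 K); apply: cvgM; first exact: cvg_cst.
  have sqrt_cvg0 (a : nat -> R) : a n @[n --> \oo] --> (0 : R) ->
      Num.sqrt (a n) @[n --> \oo] --> (0 : R).
    by rewrite -[X in _ -> _ --> X]sqrtr0 => a0; apply: continuous_cvg a0; exact: sqrt_continuous.
  exact: (sqrt_cvg0 _ (sqrt_cvg0 _ cvg_harmonic)).
apply: (squeeze_cvgr _ (cvg_cst 0) c0); apply: nearW => n.
by rewrite normr_ge0/= (le_trans (uK n))// !sqrtrV.
Qed.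

Theorem theorem2p17 (R : realType) (d : measure_display) (T : measurableType d)
  (P : probability T R) (X : nat -> {RV P >-> R[i]})
  (indX : mutually_independent X) (idX : identically_distributed X)
  (densX : exists (f : R[i] -> R) (M : R),
     has_density (@complex_lebesgue R) (X 0%N) f /\ (forall z, f z <= M))
  (momX : ('E_P[fun w => Normc.normc (X 0%N w)] < +oo)%E)
  (phi : R[i] -> R)
  (phi_C2 : twice_cont_diff (phi \o @cplx R))
  (phi_supp : compactly_supported (phi \o @cplx R)) :
  let S (n : nat) (w : T) : R :=
    \sum_(z <- critical_points (fun i => X i w) n) phi z in
  let v : R := Num.sqrt (fine 'V_P[phi \o X 0%N]) in
  cvg_in_distribution P
    (fun n w => (Num.sqrt n%:R)^-1 * (S n w - fine 'E_P[S n]))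
    (normal_law v).
Proof.
move=> S v.
have [B phiC2] := C2_partials_twice_cont_diff phi_C2 phi_supp.
have mphi := measurable_test_function phiC2.
have [N phiN] := test_function_bounded phiC2.
have [f [M [densXf fM]]] := densX.
have [A A0 hA] := discrepancy_expectation phiC2 indX idX densXf fM momX.
pose c := Ex P (fun w => phi (X 0%N w)).
pose eta z := phi z - c.
pose D n w := discrepancy phi (fun i => X i w) n.
have mphiX i : measurable_fun [set: T] (fun w => phi (X i w)).
  by apply: (measurableT_comp mphi).
have iphi i : itg P (fun w => phi (X i w)) by exact: (@itg_bounded _ _ _ _ _ N).
have cE i : Ex P (fun w => phi (X i w)) = c by exact: (ident_Ex idX i 0%N mphi phiN).
have cN : `|c| <= N by exact: abs_Ex_le.
have meta : measurable_fun [set: R[i]] eta by apply: measurable_funB.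
have etaN z : `|eta z| <= N + N by rewrite (le_trans (ler_normB _ _))// lerD.
have eta1 : Ex P (fun w => eta (X 0%N w)) = 0.
  by rewrite ExB//; [rewrite Ex_cst subrr|exact: itg_cst].
have fineE g : fine 'E_P[g] = Ex P g by rewrite unlock.
have eta2 : Ex P (fun w => eta (X 0%N w) ^+ 2) = v ^+ 2.
  have -> : v ^+ 2 = fine 'V_P[phi \o X 0%N].
    by rewrite sqr_sqrtr//; apply/fine_ge0/variance_ge0.
  rewrite /variance covariance.unlock fineE; congr (Ex P _); apply/funext => w.
  by rewrite expr2 /= fineE.
have mD n : measurable_fun [set: T] (D n) by exact: (measurable_discrepancy phiC2).
have mS n : measurable_fun [set: T] (S n) by exact: (measurable_linear_statistic phiC2).
have iD n : itg P (D n.+1).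
  apply/integrableP; split; first exact/measurable_EFinP.
  by apply: le_lt_trans (hA n.+1 isT) _; rewrite ltry.
have iaD n : itg P (fun w => `|D n.+1 w|) by exact: (integrable_norm (iD n)).
have eD n : Ex P (fun w => `|D n.+1 w|) <= A * (1 + ln n.+1%:R).
  by rewrite -lee_fin -(ExE (iaD n)); exact: hA.
have [iW eW] : (forall n, itg P (fun w => \sum_(i < n) phi (X i w))) /\
    (forall n, Ex P (fun w => \sum_(i < n) phi (X i w)) = n%:R * c).
  suff h n : itg P (fun w => \sum_(i < n) phi (X i w)) /\
      Ex P (fun w => \sum_(i < n) phi (X i w)) = n%:R * c.
    by split => n; have [] := h n.
  elim: n => [|n [IHi IHe]].
    under eq_fun do rewrite big_ord0.
    by rewrite Ex_cst mul0r; split => //; exact: itg_cst.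
  under eq_fun do rewrite big_ord_recr/=.
  split; first exact: itgD.
  by rewrite ExD// IHe cE -natr1 mulrDl mul1r.
have SE n w : S n w = \sum_(i < n) phi (X i w) + D n w.
  by rewrite /D /discrepancy addrC subrK.
have ES n : Ex P (S n.+1) = n.+1%:R * c + Ex P (D n.+1).
  have -> : S n.+1 = (fun w => \sum_(i < n.+1) phi (X i w) + D n.+1 w).
    by apply/funext => w; exact: SE.
  by rewrite ExD// eW.
pose r n : R := (Num.sqrt n%:R)^-1.
pose Y n w := r n * (S n w - fine 'E_P[S n]).
have mY n : measurable_fun [set: T] (Y n).
  by apply: measurable_funM => //; apply: measurable_funB.
(* Centring removes [n * c] from the iid sum and leaves the discrepancy minus its own
   expectation. *)
have YE n w : Y n.+1 w = \sum_(i < n.+1) r n.+1 * eta (X i w) +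
    r n.+1 * (D n.+1 w - Ex P (D n.+1)).
  rewrite /Y fineE ES SE -mulr_sumr sumrB sumr_const card_ord -mulr_natl.
  ring.
apply: (cvg_in_distribution_taylor mY (sqrtr_ge0 _)) => C g g1 g2 gC.
pose L := lindeberg_moment (N + N) v.
apply: (@cvg_fourth_root_rate _ _ _ (10 * C * A + `|C * L|)) => n.
(* With [q = m^(1/4)] the normalization is [q ^- 2]; one factor [q^-1] absorbs [ln m], the other
   gives the rate. *)
set m := n.+1; set q := Num.sqrt (Num.sqrt m%:R).
have m1 : 1 <= m%:R :> R by rewrite ler1n.
have q1 : 1 <= q by rewrite -[leLHS]sqrtr1 ler_sqrt// -[leLHS]sqrtr1 ler_sqrt.
have q0 : 0 < q by exact: lt_le_trans q1.
have q2 : q ^+ 2 = Num.sqrt m%:R by rewrite sqr_sqrtr.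
have q4 : q ^+ 4 = m%:R by rewrite (exprM _ 2 2) q2 sqr_sqrtr.
have rE : r m = q ^- 2 by rewrite q2.
have [gb _ _] : [/\ forall x, `|g x| <= C, forall x, `|g1 x| <= C &
    forall x, `|g2 x| <= C] by split => x; have [] := taylor_bound gC x.
have [gl _ _] := taylor_lip gC.
have C0 : 0 <= C by exact: le_trans (gb 0).
have mg : measurable_fun [set: R] g by exact: (lipschitz_with_measurable gl).
pose W w : R := \sum_(i < m) r m * eta (X i w).
have mW : measurable_fun [set: T] W.
  by apply: measurable_sum => i; apply: measurable_funM => //; exact: (measurableT_comp meta).
have igY : itg P (fun w => g (Y m w)).
  by apply: (@itg_bounded _ _ _ _ _ C) => //; exact: (measurableT_comp mg (mY m)).
have igW : itg P (fun w => g (W w)).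
  by apply: (@itg_bounded _ _ _ _ _ C) => //; exact: (measurableT_comp mg mW).
have r0 : 0 <= r m by rewrite invr_ge0.
have YW : `|Ex P (fun w => g (Y m w)) - Ex P (fun w => g (W w))| <= 10 * C * A / q.
  rewrite -ExB//.
  pose U w := C * r m * (`|D m w| + Ex P (fun w => `|D m w|)).
  have iU : itg P U by apply: itgZ; apply: itgD; [exact: iaD|exact: itg_cst].
  apply: (@le_trans _ _ (Ex P U)).
    apply: abs_Ex => //; first exact: itgB.
    move=> w; rewrite YE (le_trans (gl _ _))// normrM (ger0_norm r0) /U -mulrA.
    do 2 apply: ler_wpM2l => //; rewrite (le_trans (ler_normB _ _))// lerD2l.
    by apply: abs_Ex => //; exact: iaD.
  rewrite ExZ; last by apply: itgD; [exact: iaD|exact: itg_cst].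
  rewrite ExD ?Ex_cst; [|exact: iaD|exact: itg_cst].
  (* [ln m = 4 ln q <= 4 q], and with [1 <= q] this bounds [1 + ln m] by [5 * q]. *)
  have lnq : ln m%:R <= 4 * q.
    by rewrite -q4 lnXn// -[leLHS]mulr_natl ler_wpM2l// ltW// ln_sublinear.
  have h : Ex P (fun w => `|D m w|) <= A * (5 * q).
    by rewrite (le_trans (eD n))// ler_wpM2l//; lra.
  (* The discrepancy and its expectation each contribute [5]. *)
  have -> : 10 * C * A / q = C * r m * (A * (5 * q) + A * (5 * q)).
    by rewrite rE; field; exact: lt0r_neq0.
  by rewrite ler_wpM2l ?mulr_ge0// lerD.
have WG : `|Ex P (fun w => g (W w)) - Ex gauss (fun z => g (v * z))| <= `|C * L| / q.
  have := lindeberg indX idX meta etaN eta1 eta2 (sqrtr_ge0 _) r0 m gC.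
  have -> : r m * v * Num.sqrt m%:R = v.
    by rewrite mulrAC mulVf ?mul1r// gt_eqF// sqrtr_gt0 (lt_le_trans _ m1).
  move=> /le_trans; apply.
  (* Since [m * r^3 = m^(-1/2) = q^-2], the Lindeberg error is even smaller than the rate [q^-1] to
     which it is weakened. *)
  have -> : m%:R * (C * (r m ^+ 3 * lindeberg_moment (N + N) v)) = C * L / q ^+ 2.
    by rewrite -q4 rE /L; field; exact: lt0r_neq0.
  apply: (le_trans (ler_norm _)); rewrite normrM ler_wpM2l//.
  by rewrite ger0_norm ?invr_ge0 ?exprn_ge0 ?(ltW q0)// lef_pV2 ?posrE ?exprn_gt0// ler_eXnr.
rewrite mulrDl; apply: le_trans (lerD YW WG).
by rewrite (le_trans _ (ler_normD _ _))// addrA subrK.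
Qed.
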